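(* Let $n\ge 1$. Given $j$, $1\le j\le n$, and a positive constant $C$, there exists a function $f$ in $L^1(\mathbb{R}^n)$ such that $$\|R_j^{\star}f\|_{1,\infty}\ge C\,\|R_jf\|_{1}.$$
   Context: For $\epsilon>0$ the truncated $j$-th Riesz transform is $$R_j^{\epsilon}f(x)=\int_{|y|>\epsilon} f(x-y)\,\frac{y_j}{|y|^{n+1}}\,dy .$$ The $j$-th Riesz transform is the principal value singular integral $R_jf(x)=\lim_{\epsilon\to0}R_j^{\epsilon}f(x)$, and the maximal Riesz transform is $R_j^{\star}f(x)=\sup_{\epsilon>0}|R_j^{\epsilon}f(x)|$. The case $n=1$ is that of the Hilbert transform. The weak $L^1$ quasi-norm is $\|g\|_{1,\infty}=\sup_{t>0}t\,|\{x\in\mathbb{R}^n:|g(x)|>t\}|$, where $|E|$ denotes the Lebesgue measure of $E$, and $\|\cdot\|_1$ is the $L^1(\mathbb{R}^n)$ norm. *)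

(* Defs.v *)
From HB Require Import structures.
From mathcomp Require Import all_boot all_order all_algebra.
From mathcomp Require Import all_classical all_reals all_analysis.
Set Implicit Arguments.
Unset Strict Implicit.
Unset Printing Implicit Defensive.
Import Order.TTheory GRing.Theory Num.Theory.
Import numFieldNormedType.Exports.
Local Open Scope classical_set_scope.
Local Open Scope ring_scope.

(* Points of R^n are tuples, which carry the product of the Borel
   sigma-algebras of the coordinates. *)
Notation Rn R n := (n.-tuple (measurableTypeR R)).

Section sigma_finite_of.
Context d (T : measurableType d) (R : realType) (m : set T -> \bar R).
Hypotheses (m0 : m set0 = 0%E) (m_ge0 : forall A, (0 <= m A)%E).
Hypotheses (m_sigma_additive : semi_sigma_additive m).
Hypotheses (m_sigma_finite : sigma_finite setT m).

(* An alias of [m] that records the measure axioms, so that instances can be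
   attached to it. *)
Definition sigma_finite_of of m set0 = 0%E & (forall A, (0 <= m A)%E) &
  semi_sigma_additive m & sigma_finite setT m := m.

Let mu := sigma_finite_of m0 m_ge0 m_sigma_additive m_sigma_finite.

HB.instance Definition _ := isMeasure.Build _ _ _ mu
  m0 m_ge0 m_sigma_additive.

HB.instance Definition _ := Measure_isSigmaFinite.Build _ _ _ mu
  m_sigma_finite.

Lemma sigma_finite_measureP :
  exists nu : {sigma_finite_measure set T -> \bar R}, nu = m :> (set T -> _).
Proof. by exists mu. Qed.

End sigma_finite_of.

Section LebesgueRn.
Context {R : realType}.

Definition consRn n (p : measurableTypeR R * Rn R n) : Rn R n.+1 :=
  [tuple of p.1 :: p.2].

Lemma measurable_consRn n : measurable_fun setT (@consRn n).
Proof. exact: measurable_cons. Qed.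

(* n-dimensional Lebesgue measure, as the n-fold product of the
   one-dimensional one; R^0 is a point of mass 1. *)
Fixpoint lebesgueRn n : set (Rn R n) -> \bar R :=
  match n with
  | 0 => dirac ([tuple] : Rn R 0)
  | m.+1 => pushforward (@lebesgue_measure R \x @lebesgueRn m)%E
                        (@consRn m)
  end.

Arguments lebesgueRn n : clear implicits.

Lemma lebesgueRn_subproof n :
  [/\ lebesgueRn n set0 = 0%E, forall A, (0 <= lebesgueRn n A)%E,
      semi_sigma_additive (lebesgueRn n) & sigma_finite setT (lebesgueRn n)].
Proof.
elim: n => [|n [l0 lge0 lsa lfin]].
  pose d : {finite_measure set (Rn R 0) -> \bar R} := dirac ([tuple] : Rn R 0).
  rewrite /= -[dirac _]/(d : set _ -> \bar R); split => //.
    exact: measure_semi_sigma_additive.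
  exact: sigma_finiteT.
have [mu muE] := sigma_finite_measureP l0 lge0 lsa lfin.
rewrite /= -muE => {l0 lge0 lsa lfin muE}.
have mcons := @measurable_consRn n.
pose pm : {measure set (Rn R n.+1) -> \bar R} :=
  pushforward (lebesgue_measure \x mu)%E (@consRn n).
pose m := pm mcons; split.
- by rewrite -[LHS]/(m set0) measure0.
- by move=> A; rewrite -[leRHS]/(m A).
- exact: (@measure_semi_sigma_additive _ _ _ m).
have /sigma_finiteP[F [FT ndF Foo]] := sigma_finiteT (@lebesgue_measure R).
have /sigma_finiteP[G [GT ndG Goo]] := sigma_finiteT mu.
pose unc (x : Rn R n.+1) : measurableTypeR R * Rn R n :=
  (thead x, [tuple of behead x]).
have munc : measurable_fun setT unc.
  by apply: measurable_fun_pair;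
    [exact: measurable_tnth|exact: measurable_behead].
have uncK : cancel (@consRn n) unc.
  by move=> [a x]; congr (_, _); apply/val_inj.
exists (fun i => unc @^-1` (F i `*` G i)).
  apply/esym/seteqP; split => // x _.
  have [i _ Fi] : (\bigcup_i F i) (thead x) by rewrite -FT.
  have [k _ Gk] : (\bigcup_i G i) [tuple of behead x] by rewrite -GT.
  exists (maxn i k) => //; split.
  - by move: Fi; apply/subsetPset/ndF/leq_maxl.
  - by move: Gk; apply/subsetPset/ndG/leq_maxr.
move=> i; have [? ?] := Foo i; have [? ?] := Goo i; split.
  by rewrite -[X in measurable X]setTI; apply: munc => //; exact: measurableX.
rewrite /pushforward -comp_preimage (_ : _ \o _ = id); last exact/funext.
by rewrite preimage_id product_measure1E// lte_mul_pinfty// ge0_fin_numE.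
Qed.

Section instances.
Variable n : nat.

Let lebesgueRn0 : lebesgueRn n set0 = 0%E.
Proof. by have [] := lebesgueRn_subproof n. Qed.

Let lebesgueRn_ge0 A : (0 <= lebesgueRn n A)%E.
Proof. by have [] := lebesgueRn_subproof n. Qed.

Let lebesgueRn_sigma_additive : semi_sigma_additive (lebesgueRn n).
Proof. by have [] := lebesgueRn_subproof n. Qed.

HB.instance Definition _ := isMeasure.Build _ _ _ (lebesgueRn n)
  lebesgueRn0 lebesgueRn_ge0 lebesgueRn_sigma_additive.

Let lebesgueRn_sigma_finite : sigma_finite setT (lebesgueRn n).
Proof. by have [] := lebesgueRn_subproof n. Qed.

HB.instance Definition _ := Measure_isSigmaFinite.Build _ _ _ (lebesgueRn n)
  lebesgueRn_sigma_finite.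

End instances.

Lemma lebesgueRn_box n (B : 'I_n -> set (measurableTypeR R)) :
  (forall i, measurable (B i)) ->
  lebesgueRn n [set x : Rn R n | forall i, B i (tnth x i)] =
  \big[*%E/1%E]_(i < n) lebesgue_measure (B i).
Proof.
elim: n B => [|n IHn] B mB /=.
  by rewrite big_ord0 diracE mem_set// => -[].
rewrite big_ord_recl -IHn//= /pushforward.
pose S := [set x : Rn R n | forall i, B (lift ord0 i) (tnth x i)].
have mS : measurable S.
  rewrite (_ : S = \bigcap_(i in [set: 'I_n])
      ((@tnth n (measurableTypeR R) ^~ i) @^-1` B (lift ord0 i))).
    apply: fin_bigcap_measurable => // i _; rewrite -[X in measurable X]setTI.
    exact: measurable_tnth.
  by apply/seteqP; split => [x Sx i _|x Sx i]; exact: Sx.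
rewrite -product_measure1E//; congr (product_measure1 _ _ _).
apply/seteqP; split => -[a x] /=.
  by move=> H; split => [|i]; [exact: (H ord0)|have := H (lift ord0 i); rewrite tnthS].
move=> [Ba Sx] i; case: (unliftP ord0 i) => [j ->|-> //].
by rewrite tnthS; exact: Sx.
Qed.

End LebesgueRn.
Arguments lebesgueRn {R} n.

Section RieszTransform.
Context {R : realType} {n : nat}.
Implicit Types (f : Rn R n -> R) (x y : Rn R n) (j : 'I_n) (eps : R).

Definition normRn y : R := Num.sqrt (\sum_(i < n) tnth y i ^+ 2).

Definition subRn x y : Rn R n := [tuple (tnth x i - tnth y i : R) | i < n].

Definition riesz_kernel j y : R := tnth y j / normRn y ^+ n.+1.

Definition riesz_trunc j eps f x : R :=
  \int[lebesgueRn n]_(y in [set y | eps < normRn y])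
    (f (subRn x y) * riesz_kernel j y).

(* Meaningful at the points where the limit exists, which for integrable f is
   almost every point; [lim] takes a default value elsewhere. *)
Definition riesz j f x : R := lim (riesz_trunc j eps f x @[eps --> 0^'+]).

Definition riesz_max j f x : \bar R :=
  ereal_sup [set `|riesz_trunc j eps f x|%:E | eps in [set eps | 0 < eps]].

End RieszTransform.

Definition weakL1_norm d (T : measurableType d) (R : realType)
    (mu : {measure set T -> \bar R}) (g : T -> \bar R) : \bar R :=
  ereal_sup [set (t%:E * mu [set x | t%:E < `|g x|])%E
            | t in [set t : R | 0 < t]].

(* Main.v *)
(* With g_u(z) = u^(-n/2) exp(-|z|^2/u) and q_u(z) = (z_j/u) g_u(z), take for
   small d > 0

     f(x) = int_R int_0^1 (g_(r^2+d) - g_(r^2+2d))(x - t e_j) dt dr.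

   Since y_j/|y|^(n+1) is, up to a constant, int_R q_(s^2)(y) ds and q_a * g_b is
   a multiple of q_(a+b), applying R_j turns the integrand into a function of
   r^2 + s^2 only. Polar coordinates in the (r, s) plane make the difference
   telescope to int_d^(2d) p_u(x) du with p_u(x) = int_0^1 q_u(x - t e_j) dt =
   (g_u(x - e_j) - g_u(x))/2, so ||R_j f||_1 <= c d.

   Seen from far away, the complement of the ball of radius |X| centred at X is the
   half-space {z : z.X <= 0}, so that k^n R_j^(k|x|) f(k x) tends to
   x_j/|x|^(n+1) int_(z.x <= 0) f. For x near the e_j axis this half-space
   meets the segment [0, e_j], along which f is concentrated, only at 0, and
   integrating over the layers gives the size d int_(sqrt(2d))^(1/4) dr/r.
   Hence the weak norm of R_j^* f is at least c' d log(1/d). *)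

Require Import Defs.
From mathcomp Require Import all_boot all_order all_algebra.
From mathcomp Require Import all_classical all_reals all_analysis.
From mathcomp Require Import measurable_realfun ring lra.
Import Order.TTheory GRing.Theory Num.Theory.
Import numFieldNormedType.Exports.
Local Open Scope classical_set_scope.
Local Open Scope ring_scope.

(** * Affine changes of variables in R^n *)

Section LebesgueRnTheory.
Set Implicit Arguments.
Unset Strict Implicit.
Context {R : realType}.
Local Notation mu := (@lebesgue_measure R).

(** Two Gaussians have to be subtracted: each alone has mass pi^(n/2) for all r and t, so
    integrating one family over r leaves L^1, while the difference has L^1 norm at most a multiple
    of d/(r^2 + d). Averaging over the segment is equally essential: the L^1 norm of q_u grows like
    u^(-1/2) as u tends to 0, but p_u is a difference of two Gaussians and stays bounded, so the
    window of u of length d costs only d. On the maximal side the sharp cut destroys this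
    cancellation: each r leaves about d/r, and the sum over r is the logarithm that beats C. The
    truncation radius |X| puts the origin, an end of the segment, on the sphere. Weak L^1 is
    invariant under the dilations that flatten this sphere to a hyperplane, so passing to the limit
    loses nothing. R_j f is computed without Fourier analysis. The obstacle is the singularity of
    the kernel, which blocks exchanging integrals; replacing f by its odd part in the j-th
    coordinate makes everything absolutely convergent. The area of the disc and the mass of the
    radial profile are never evaluated: only their positivity and finiteness matter. *)

Definition affine (a b : R) : measurableTypeR R -> measurableTypeR R :=
  fun x => (a * x + b)%R.

Lemma measurable_affine (a b : R) : measurable_fun setT (affine a b).
Proof. by apply: measurable_funD => //; exact: measurable_funM. Qed.

Lemma lebesgue_measure_affine (a b : R) (A : set (measurableTypeR R)) :
  a != 0 -> measurable A ->
  mu A = (`|a|%:E * mu (affine a b @^-1` A))%E.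
Proof.
move=> a0 mA.
have mT := measurable_affine a b.
pose p : {measure set (measurableTypeR R) -> \bar R} :=
  pushforward mu (affine a b).
pose nu : {measure set (measurableTypeR R) -> \bar R} := mscale (NngNum (normr_ge0 a)) (p mT).
suff -> : mu A = nu A by [].
apply: lebesgue_measure_unique => // _ [[c d]] _ <-.
rewrite /nu/= /mscale /p /= /pushforward.
have [a_gt0|a_lt0] := ltP 0 a.
  rewrite (_ : affine a b @^-1` _ = `](c - b) / a, (d - b) / a]%classic); last first.
    apply/seteqP; split => x /=; rewrite !in_itv/= ltr_pdivrMr// ler_pdivlMr//;
      by rewrite /affine mulrC ltrBlDr lerBrDr.
  rewrite !lebesgue_measure_itv/= !lte_fin ltr_pM2r ?invr_gt0// ltrD2r.
  case: ifPn => cd; last by rewrite mule0.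
  by rewrite -!EFinB -EFinM gtr0_norm//; congr EFin; field.
have {a0}a_lt0 : a < 0 by rewrite lt_neqAle a0.
(* A negative slope swaps the ends, so the preimage is closed on the left and open on the right; its
   length is the same. *)
rewrite (_ : affine a b @^-1` _ = `[(d - b) / a, (c - b) / a[%classic); last first.
  apply/seteqP; split => x /=; rewrite !in_itv/= ltr_ndivlMr// ler_ndivrMr//;
    by rewrite /affine mulrC ltrBlDr lerBrDr andbC.
rewrite !lebesgue_measure_itv/= !lte_fin ltr_nM2r ?invr_lt0// ltrD2r.
case: ifPn => cd; last by rewrite mule0.
rewrite -!EFinB -EFinM ltr0_norm//; congr EFin; field.
by rewrite lt_eqF.
Qed.

Lemma ge0_integral_affine (a b : R) (f : measurableTypeR R -> \bar R) : a != 0 ->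
  measurable_fun setT f -> (forall x, 0 <= f x)%E ->
  (\int[mu]_x f x = `|a|%:E * \int[mu]_x f (affine a b x))%E.
Proof.
move=> a0 mf f0.
have mT := measurable_affine a b.
pose p : {measure set (measurableTypeR R) -> \bar R} :=
  pushforward mu (affine a b).
pose nu := p mT.
transitivity (\int[mscale (NngNum (normr_ge0 a)) nu]_x f x)%E.
  by apply: eq_measure_integral => A mA _ /=; rewrite (lebesgue_measure_affine b a0 mA).
rewrite ge0_integral_mscale//=; congr (_ * _)%E.
by rewrite ge0_integral_pushforward.
Qed.

Lemma ge0_integral_lebesgueRnS n (f : Rn R n.+1 -> \bar R) :
  measurable_fun setT f -> (forall x, 0 <= f x)%E ->
  (\int[lebesgueRn n.+1]_x f x =
   \int[mu]_a \int[lebesgueRn n]_x f (consRn (a, x)))%E.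
Proof.
move=> mf f0.
transitivity (\int[pushforward (mu \x @lebesgueRn R n)%E (@consRn R n)]_x f x)%E.
  by [].
rewrite ge0_integral_pushforward//; last exact: measurable_consRn.
rewrite preimage_setT fubini_tonelli1//; last by move=> x; exact: f0.
by apply: measurableT_comp => //; exact: measurable_consRn.
Qed.

(** The integral of a nonnegative function is a supremum over the simple functions below it, so the
    comparison needs no measurability. This is what allows arbitrary sets in [lebesgueRn_le]. *)
Lemma ge0_le_integralW d (T : measurableType d) (m : {measure set T -> \bar R})
    (f g : T -> \bar R) :
  (forall x, 0 <= f x)%E -> (forall x, f x <= g x)%E ->
  (\int[m]_x f x <= \int[m]_x g x)%E.
Proof.
move=> f0 fg.
have g0 x : (0 <= g x)%E by exact: le_trans (fg x).
rewrite !ge0_integralTE//; apply: le_ereal_sup => _ [h /= hf <-].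
by exists h => // x; exact: le_trans (fg x).
Qed.

(* No measurability is assumed: the level sets of [riesz_max] are not known to be
   measurable. *)
Lemma lebesgueRn_le n (A B : set (Rn R n)) :
  A `<=` B -> (lebesgueRn n A <= lebesgueRn n B)%E.
Proof.
elim: n A B => [|n IH] A B AB /=.
  rewrite !diracE lee_fin ler_nat //.
  by case: (boolP ([tuple] \in A)) => //; rewrite inE => /AB /mem_set ->.
rewrite /pushforward /product_measure1; apply: ge0_le_integralW => x //.
by apply: IH => y; rewrite /xsection/= !inE => /AB.
Qed.

Definition affineRn n (a b : 'I_n -> R) (x : Rn R n) : Rn R n :=
  [tuple (a i * tnth x i + b i : R) | i < n].

Lemma tnth_affineRn n (a b : 'I_n -> R) x i :
  tnth (affineRn a b x) i = a i * tnth x i + b i.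
Proof. by rewrite tnth_mktuple. Qed.

Lemma measurable_affineRn n (a b : 'I_n -> R) : measurable_fun setT (affineRn a b).
Proof.
apply/measurable_fun_tnthP => i.
rewrite (_ : _ \o _ = fun x => a i * tnth x i + b i :> R); last first.
  by apply/funext => x; rewrite /= tnth_affineRn.
apply: measurable_funD => //; apply: measurable_funM => //.
exact: measurable_tnth.
Qed.

Lemma affineRn_consRn n (a b : 'I_n.+1 -> R) (u : R) (x : Rn R n) :
  affineRn a b (consRn (u, x)) =
  consRn (a ord0 * u + b ord0,
    affineRn (fun i => a (lift ord0 i)) (fun i => b (lift ord0 i)) x).
Proof.
apply/eq_from_tnth => i; rewrite tnth_affineRn.
case: (unliftP ord0 i) => [j ->|->]; last by rewrite !(tnth_nth 0).
by rewrite !tnthS tnth_affineRn.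
Qed.

Lemma ge0_integral_affineRn n (a b : 'I_n -> R) (f : Rn R n -> \bar R) :
  (forall i, a i != 0) -> measurable_fun setT f -> (forall x, 0 <= f x)%E ->
  (\int[lebesgueRn n]_x f x =
   (\prod_(i < n) `|a i|)%:E * \int[lebesgueRn n]_x f (affineRn a b x))%E.
Proof.
elim: n a b f => [|n IH] a b f a0 mf f0.
  rewrite big_ord0 mul1e; apply: eq_integral => x _; congr f.
  by rewrite (tuple0 x) (tuple0 (affineRn _ _ _)).
have mT := measurable_affineRn a b.
rewrite !ge0_integral_lebesgueRnS//; last exact: measurableT_comp.
pose a' i := a (lift ord0 i); pose b' i := b (lift ord0 i).
have mc u : measurable_fun setT (fun x : Rn R n => f (consRn (u, x))).
  apply: measurableT_comp => //; apply: measurableT_comp => //.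
  exact: measurable_consRn.
have mG : measurable_fun setT
    (fun u : measurableTypeR R => \int[lebesgueRn n]_x f (consRn (u, affineRn a' b' x)))%E.
  apply: (measurable_fun_fubini_tonelli_F
    (fun ux : measurableTypeR R * Rn R n => f (consRn (ux.1, affineRn a' b' ux.2)))).
    apply: measurableT_comp => //; apply: measurableT_comp.
      exact: measurable_consRn.
    apply: measurable_fun_pair => //; apply: measurableT_comp => //.
    exact: measurable_affineRn.
  by move=> x; exact: f0.
transitivity (\int[mu]_u ((\prod_(i < n) `|a' i|)%:E *
    \int[lebesgueRn n]_x f (consRn (u, affineRn a' b' x))))%E.
  apply: eq_integral => u _.
  by apply: (IH a' b' (fun x => f (consRn (u, x)))) => // i; exact: a0.
have G0 u : (0 <= \int[lebesgueRn n]_x f (consRn (u, affineRn a' b' x)))%E.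
  by apply: integral_ge0 => x _; exact: f0.
have P0 : (0 <= (\prod_(i < n) `|a' i|)%:E)%E by rewrite lee_fin prodr_ge0.
rewrite (@ge0_integralZl _ _ _ mu setT measurableT _ mG _ (fun u _ => G0 u) P0).
rewrite big_ord_recl [in RHS]mulrC EFinM -[in RHS]muleA; congr (_ * _)%E.
rewrite (ge0_integral_affine (b ord0) (a0 ord0) mG G0).
congr (_ * _)%E; apply: eq_integral => u _; apply: eq_integral => x _.
by rewrite affineRn_consRn.
Qed.

Lemma integral_isoRn n (a b : 'I_n -> R) (f : Rn R n -> \bar R) :
  (forall i, `|a i| = 1) -> measurable_fun setT f ->
  (\int[lebesgueRn n]_x f x = \int[lebesgueRn n]_x f (affineRn a b x))%E.
Proof.
move=> a1 mf.
have a0 i : a i != 0 by rewrite -normr_gt0 a1.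
have P1 : \prod_(i < n) `|a i| = 1 by apply: big1 => i _; rewrite a1.
rewrite [LHS]integralE [RHS]integralE; congr (_ - _)%E.
  rewrite (ge0_integral_affineRn b a0)//; last exact: measurable_funepos.
  by rewrite P1 mul1e; apply: eq_integral => x _;
  exact: (esym (congr1 (@^~ x) (funepos_comp f (affineRn a b)))).
rewrite (ge0_integral_affineRn b a0)//; last exact: measurable_funeneg.
by rewrite P1 mul1e; apply: eq_integral => x _;
  exact: (esym (congr1 (@^~ x) (funeneg_comp f (affineRn a b)))).
Qed.

Lemma integrable_affineRn n (a b : 'I_n -> R) (f : Rn R n -> \bar R) :
  (forall i, a i != 0) -> (lebesgueRn n).-integrable setT f ->
  (lebesgueRn n).-integrable setT (f \o affineRn a b).
Proof.
move=> a0 /integrableP[mf intf]; apply/integrableP; split.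
  by apply: measurableT_comp => //; exact: measurable_affineRn.
move: intf; rewrite (ge0_integral_affineRn b a0)//; last exact: measurableT_comp.
have P0 : 0 < \prod_(i < n) `|a i| by rewrite prodr_gt0// => i _; rewrite normr_gt0.
have [//|] := ltP (\int[lebesgueRn n]_x `|(f \o affineRn a b) x|)%E +oo%E.
rewrite leye_eq => /eqP ->.
by rewrite gt0_muley// lte_fin.
Qed.

Lemma integral_affineRn n (a b : 'I_n -> R) (f : Rn R n -> \bar R) :
  (forall i, a i != 0) -> (lebesgueRn n).-integrable setT f ->
  (\int[lebesgueRn n]_x f x =
   (\prod_(i < n) `|a i|)%:E * \int[lebesgueRn n]_x f (affineRn a b x))%E.
Proof.
move=> a0 intf; have mf := measurable_int _ intf.
have intfT := integrable_affineRn b a0 intf.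
rewrite [LHS]integralE [X in (_ * X)%E]integralE.
rewrite muleBr//; last first.
  exact: (integrable_add_def measurableT intfT).
congr (_ - _)%E.
  rewrite (ge0_integral_affineRn b a0)//; last exact: measurable_funepos.
  by congr (_ * _)%E; apply: eq_integral => x _;
  exact: (esym (congr1 (@^~ x) (funepos_comp f (affineRn a b)))).
rewrite (ge0_integral_affineRn b a0)//; last exact: measurable_funeneg.
by congr (_ * _)%E; apply: eq_integral => x _;
  exact: (esym (congr1 (@^~ x) (funeneg_comp f (affineRn a b)))).
Qed.

Lemma lebesgueRn_affine n (a b : 'I_n -> R) (A : set (Rn R n)) :
  (forall i, a i != 0) -> measurable A ->
  (lebesgueRn n A =
   (\prod_(i < n) `|a i|)%:E * lebesgueRn n (affineRn a b @^-1` A))%E.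
Proof.
move=> a0 mA; have := @ge0_integral_affineRn n a b (EFin \o \1_A) a0.
rewrite integral_indic// setIT => ->//; last 2 first.
- by apply/measurable_EFinP; exact: measurable_indic.
- by move=> x; rewrite lee_fin.
congr (_ * _)%E.
have mTA : measurable (affineRn a b @^-1` A).
  by rewrite -[X in measurable X]setTI; apply: measurable_affineRn.
rewrite -[affineRn a b @^-1` A]setIT -integral_indic//; apply: eq_integral => x _.
Qed.
End LebesgueRnTheory.

(** * Gaussians *)

Section Gaussians.
Set Implicit Arguments.
Unset Strict Implicit.
Context {R : realType}.
Local Notation mu := (@lebesgue_measure R).

Lemma measurable_inv : measurable_fun setT (@GRing.inv R).
Proof.
have -> : @GRing.inv R = fun x => if x == 0 then 0 else x^-1.
  by apply/funext => x; case: eqP => // ->; rewrite invr0.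
apply: measurable_fun_if => //=; first exact: measurable_fun_eqr.
rewrite setTI; apply: open_continuous_measurable_fun.
  rewrite (_ : _ @^-1` _ = [set x | x != 0]).
    exact: open_neq.
  by apply/seteqP; split => x /= => [/negbT//|/negbTE].
by apply/in_setP => x /= /negbT x0; exact: inv_continuous.
Qed.

Lemma measurable_sqrt : measurable_fun setT (@Num.sqrt R).
Proof. by apply: continuous_measurable_fun; exact: sqrt_continuous. Qed.

Definition sqnorm n (y : Rn R n) : R := \sum_(i < n) tnth y i ^+ 2.

Lemma sqnorm_ge0 n (y : Rn R n) : 0 <= sqnorm y.
Proof. by apply: sumr_ge0 => i _; exact: sqr_ge0. Qed.

Lemma sqr_normRn n (y : Rn R n) : normRn y ^+ 2 = sqnorm y.
Proof. by rewrite sqr_sqrtr// sqnorm_ge0. Qed.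

Lemma normRn_ge0 n (y : Rn R n) : 0 <= normRn y.
Proof. exact: sqrtr_ge0. Qed.

Lemma sqr_tnth_le n (y : Rn R n) j : tnth y j ^+ 2 <= sqnorm y.
Proof.
by rewrite /sqnorm (bigD1 j)//= lerDl sumr_ge0// => i _; exact: sqr_ge0.
Qed.

Lemma normr_tnth_le n (y : Rn R n) j : `|tnth y j| <= normRn y.
Proof. by rewrite -sqrtr_sqr ler_sqrt ?sqnorm_ge0// sqr_tnth_le. Qed.

Lemma measurable_sqnorm n : measurable_fun setT (@sqnorm n).
Proof.
apply: measurable_sum => i; apply: measurable_funX; exact: measurable_tnth.
Qed.

Lemma measurable_normRn n : measurable_fun setT (@normRn R n).
Proof.
exact: (measurableT_comp measurable_sqrt (@measurable_sqnorm n)).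
Qed.

Lemma sqnorm_affineRn n (c : R) (m : 'I_n -> R) (y : Rn R n) :
  sqnorm (affineRn (fun=> c) m y) = \sum_(i < n) (c * tnth y i + m i) ^+ 2.
Proof. by apply: eq_bigr => i _; rewrite tnth_affineRn. Qed.

Lemma subRn_affineRn n (x y : Rn R n) : subRn x y = affineRn (fun=> -1) (tnth x) y.
Proof.
by apply/eq_from_tnth => i; rewrite tnth_mktuple tnth_affineRn mulN1r addrC.
Qed.

Lemma tnth_subRn n (x y : Rn R n) i : tnth (subRn x y) i = tnth x i - tnth y i.
Proof. by rewrite tnth_mktuple. Qed.

Lemma subRnK n (x y : Rn R n) : subRn x (subRn x y) = y.
Proof. by apply/eq_from_tnth => i; rewrite !tnth_subRn subKr. Qed.

Lemma measurable_subRn n : measurable_fun setT (fun xy : Rn R n * Rn R n => subRn xy.1 xy.2).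
Proof.
apply/measurable_fun_tnthP => i.
rewrite (_ : _ \o _ = fun xy => tnth xy.1 i - tnth xy.2 i :> R); last first.
  by apply/funext => xy; rewrite /= tnth_subRn.
by apply: measurable_funB; apply: (measurableT_comp (measurable_tnth _)).
Qed.

Definition gaussRn n (u : R) (z : Rn R n) : R :=
  Num.sqrt u ^- n * expR (- (sqnorm z / u)).

(** This is -1/2 times the j-th partial derivative of [gaussRn u]. At u = 0 it vanishes because
    division by 0 gives 0, which makes the point r = 0 harmless in integrals of
    [dgaussRn j (r ^+ 2)]. *)
Definition dgaussRn n (j : 'I_n) (u : R) (z : Rn R n) : R :=
  tnth z j / u * gaussRn u z.

Lemma gaussRn_ge0 n u (z : Rn R n) : 0 <= gaussRn u z.
Proof. by rewrite mulr_ge0 ?expR_ge0// invr_ge0 exprn_ge0 ?sqrtr_ge0. Qed.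

Lemma measurable_gaussRn2 n :
  measurable_fun setT (fun p : measurableTypeR R * Rn R n => gaussRn p.1 p.2).
Proof.
apply: measurable_funM.
  rewrite (_ : (fun p => _) = (fun p : measurableTypeR R * Rn R n => (Num.sqrt p.1)^-1 ^+ n)); last first.
    by apply/funext => p; rewrite exprVn.
  apply: measurable_funX; apply: (measurableT_comp measurable_inv).
  exact: (measurableT_comp measurable_sqrt).
apply: (measurableT_comp (@measurable_expR R)).
apply: measurable_funN; apply: measurable_funM.
  by apply: (measurableT_comp (@measurable_sqnorm n)).
by apply: (measurableT_comp measurable_inv).
Qed.
Lemma measurable_gaussRn n u : measurable_fun setT (@gaussRn n u).
Proof.
exact: (measurableT_comp (@measurable_gaussRn2 n) (pair1_measurable u)).
Qed.

Lemma measurable_dgaussRn2 n (j : 'I_n) :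
  measurable_fun setT (fun p : measurableTypeR R * Rn R n => dgaussRn j p.1 p.2).
Proof.
apply: measurable_funM; last exact: measurable_gaussRn2.
apply: measurable_funM.
  by apply: (measurableT_comp (measurable_tnth j)).
by apply: (measurableT_comp measurable_inv).
Qed.

Lemma measurable_dgaussRn n (j : 'I_n) u : measurable_fun setT (@dgaussRn n j u).
Proof.
exact: (measurableT_comp (@measurable_dgaussRn2 n j) (pair1_measurable u)).
Qed.

Lemma mul_expNsqr_le1 (w : R) : `|w| * expR (- w ^+ 2) <= 1.
Proof.
rewrite expRN ler_pdivrMr ?expR_gt0// mul1r.
apply: le_trans (expR_ge1Dx _).
have := sqr_ge0 (`|w| - 1); have := sqr_ge0 w.
by rewrite sqrrB real_normK ?num_real//; lra.
Qed.

Lemma mul_expNsqr2_le1 (w : R) : `|w| * expR (- (w ^+ 2 / 2)) <= 1.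
Proof.
rewrite expRN ler_pdivrMr ?expR_gt0// mul1r.
apply: le_trans (expR_ge1Dx _).
have := sqr_ge0 (`|w| - 1); rewrite sqrrB real_normK ?num_real//; move: (normr_ge0 w); lra.
Qed.

(** Half of the exponential absorbs the factor [v]. In terms of Gaussians, a quadratic weight is
    paid for by doubling u. *)
Lemma mul_expN_le (v : R) : v * expR (- v) <= 2 * expR (- (v / 2)).
Proof.
have -> : expR (- v) = expR (- (v / 2)) * expR (- (v / 2)).
  by rewrite -expRD; congr expR; field.
rewrite mulrA ler_pM2r ?expR_gt0// expRN ler_pdivrMr ?expR_gt0//.
have := expR_ge1Dx (v / 2); lra.
Qed.

Lemma integral_expNsqnorm n :
  (\int[lebesgueRn n]_z (expR (- sqnorm z))%:E = (Num.sqrt pi ^+ n)%:E)%E.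
Proof.
have mf k : measurable_fun setT (fun z : Rn R k => (expR (- sqnorm z))%:E).
  apply/measurable_EFinP; apply: (measurableT_comp (@measurable_expR R)).
  by apply: measurable_funN; exact: measurable_sqnorm.
elim: n => [|n IH].
  rewrite expr0 [LHS]integral_dirac//=; last exact: (mf 0).
  by rewrite diracT mul1e /sqnorm big_ord0 oppr0 expR0.
rewrite ge0_integral_lebesgueRnS//.
transitivity (\int[mu]_a ((gauss_fun a)%:E * (Num.sqrt pi ^+ n)%:E))%E.
  apply: eq_integral => a _.
  rewrite -IH -ge0_integralZl//; last 2 first.
  - exact: mf.
  - by rewrite lee_fin gauss_fun_ge0.
  apply: eq_integral => z _; rewrite -EFinM; congr EFin.
  rewrite /gauss_fun -expRD; congr expR.
  rewrite /sqnorm big_ord_recl opprD; congr (- _ - _).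
  by apply: eq_bigr => i _; rewrite tnthS.
rewrite ge0_integralZr//; first last.
- by move=> a _; rewrite lee_fin gauss_fun_ge0.
- by apply/measurable_EFinP; exact: measurable_gauss_fun.
by rewrite integralT_gauss -EFinM exprS.
Qed.

Lemma prodr_norm_cst n (c : R) : 0 <= c -> \prod_(i < n) `|c| = c ^+ n.
Proof. by move=> c0; rewrite prodr_const card_ord ger0_norm. Qed.

Lemma gaussRn_scale n (u : R) (y : Rn R n) : 0 < u ->
  gaussRn u (affineRn (fun=> Num.sqrt u) (fun=> 0) y) =
  Num.sqrt u ^- n * expR (- sqnorm y).
Proof.
move=> u0; congr (_ * expR (- _)); rewrite sqnorm_affineRn.
under eq_bigr do rewrite addr0 exprMn sqr_sqrtr ?ltW//.
by rewrite -mulr_sumr mulrAC divff ?gt_eqF// mul1r.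
Qed.

Lemma integral_gaussRn n (u : R) : 0 < u ->
  (\int[lebesgueRn n]_z (gaussRn u z)%:E = (Num.sqrt pi ^+ n)%:E)%E.
Proof.
move=> u0; have su0 : 0 < Num.sqrt u by rewrite sqrtr_gt0.
have mg := @measurable_gaussRn n u.
rewrite (@ge0_integral_affineRn _ _ (fun=> Num.sqrt u) (fun=> 0)); last 3 first.
- by move=> i; rewrite gt_eqF.
- exact/measurable_EFinP.
- by move=> x; rewrite lee_fin gaussRn_ge0.
rewrite prodr_norm_cst ?ltW// -ge0_integralZl; last 4 first.
- exact: measurableT.
- apply/measurable_EFinP/(measurableT_comp mg); exact: measurable_affineRn.
- by move=> x _; rewrite lee_fin gaussRn_ge0.
- by rewrite lee_fin exprn_ge0// ltW.
rewrite -(integral_expNsqnorm n); apply: eq_integral => y _.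
rewrite gaussRn_scale// -EFinM mulrA mulfV ?mul1r// expf_neq0// gt_eqF//.
Qed.

Lemma integrable_gaussRn n (u : R) : 0 < u ->
  (lebesgueRn n).-integrable setT (fun z => (gaussRn u z)%:E).
Proof.
move=> u0; apply/integrableP; split.
  by apply/measurable_EFinP; exact: measurable_gaussRn.
under eq_integral do rewrite /= ger0_norm ?gaussRn_ge0//.
by rewrite integral_gaussRn// ltry.
Qed.

Lemma integrable_gaussRn_sub n (u : R) (x : Rn R n) : 0 < u ->
  (lebesgueRn n).-integrable setT (fun y => (gaussRn u (subRn x y))%:E).
Proof.
move=> u0.
rewrite (_ : (fun y => _) = (fun z => (gaussRn u z)%:E) \o affineRn (fun=> -1) (tnth x)).
  apply: integrable_affineRn; last exact: integrable_gaussRn.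
  by move=> i; rewrite oppr_eq0 oner_eq0.
by apply/funext => y; rewrite /= subRn_affineRn.
Qed.

Lemma gaussRn_double n (u : R) (z : Rn R n) : 0 < u ->
  Num.sqrt u ^- n * expR (- (sqnorm z / u / 2)) =
  Num.sqrt 2 ^+ n * gaussRn (2 * u) z.
Proof.
move=> u0; rewrite /gaussRn sqrtrM// exprMn invfM mulrA mulrA mulfV ?mul1r; last first.
  by rewrite expf_neq0// gt_eqF// sqrtr_gt0.
by congr (_ * expR (- _)); rewrite invfM mulrA mulrAC.
Qed.

Lemma normr_dgaussRnE n (j : 'I_n) (u : R) (z : Rn R n) : 0 < u ->
  `|dgaussRn j u z| = Num.sqrt u ^- n.+1 *
    (`|tnth z j / Num.sqrt u| * expR (- (sqnorm z / u))).
Proof.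
move=> u0; have su0 : 0 < Num.sqrt u by rewrite sqrtr_gt0.
rewrite /dgaussRn normrM (ger0_norm (gaussRn_ge0 _ _)) /gaussRn !normrM.
rewrite !normrV ?unitfE ?gt_eqF// (gtr0_norm u0) (gtr0_norm su0).
rewrite -{1}(sqr_sqrtr (ltW u0)) [in RHS]exprS.
have pn0 : Num.sqrt u ^+ n != 0 by rewrite expf_neq0// gt_eqF.
by field; rewrite pn0 gt_eqF.
Qed.

Lemma normr_dgaussRn_le n (j : 'I_n) (u : R) (z : Rn R n) : 0 < u ->
  `|dgaussRn j u z| <= Num.sqrt u ^- n.+1.
Proof.
move=> u0; have su0 : 0 < Num.sqrt u by rewrite sqrtr_gt0.
rewrite normr_dgaussRnE// ler_piMr ?invr_ge0 ?exprn_ge0 ?(ltW su0)//.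
apply: le_trans (mul_expNsqr_le1 (tnth z j / Num.sqrt u)).
rewrite ler_wpM2l// ler_expR lerN2 expr_div_n (sqr_sqrtr (ltW u0)).
by rewrite ler_pM2r ?invr_gt0// sqr_tnth_le.
Qed.

Lemma normr_dgaussRn_le_gaussRn n (j : 'I_n) (u : R) (z : Rn R n) : 0 < u ->
  `|dgaussRn j u z| <= (Num.sqrt u)^-1 * (Num.sqrt 2 ^+ n * gaussRn (2 * u) z).
Proof.
move=> u0; have su0 : 0 < Num.sqrt u by rewrite sqrtr_gt0.
rewrite normr_dgaussRnE// -gaussRn_double// exprS invfM -[leLHS]mulrA.
rewrite ler_pM2l ?invr_gt0// ler_pM2l ?invr_gt0 ?exprn_gt0//.
have -> : expR (- (sqnorm z / u)) =
    expR (- (sqnorm z / u / 2)) * expR (- (sqnorm z / u / 2)).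
  by rewrite -expRD; congr expR; field; rewrite gt_eqF.
rewrite mulrA ler_piMl ?expR_ge0//.
apply: le_trans (mul_expNsqr2_le1 (tnth z j / Num.sqrt u)).
rewrite ler_wpM2l// ler_expR lerN2 expr_div_n (sqr_sqrtr (ltW u0)).
by rewrite ler_pM2r// ler_pM2r ?invr_gt0// sqr_tnth_le.
Qed.

(** The extra coordinate removes the factor u^(-1/2) of [normr_dgaussRn_le_gaussRn]: the L^1 norm of
    the left side stays bounded as u tends to 0. This is the estimate used at the singularity of the
    Riesz kernel. *)
Lemma normr_tnth_dgaussRn_le n (j : 'I_n) (u : R) (z : Rn R n) : 0 < u ->
  `|tnth z j * dgaussRn j u z| <= 2 * (Num.sqrt 2 ^+ n * gaussRn (2 * u) z).
Proof.
move=> u0; have su0 : 0 < Num.sqrt u by rewrite sqrtr_gt0.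
rewrite -gaussRn_double// /dgaussRn /gaussRn mulrA (mulrA (tnth z j)) -expr2.
rewrite ger0_norm; last first.
  by rewrite mulr_ge0 ?gaussRn_ge0// mulr_ge0 ?sqr_ge0// invr_ge0 ltW.
rewrite mulrCA [leRHS]mulrCA ler_pM2l ?invr_gt0 ?exprn_gt0//.
apply: le_trans (mul_expN_le _).
rewrite ler_wpM2r ?expR_ge0//.
by rewrite ler_pM2r ?invr_gt0// sqr_tnth_le.
Qed.

Lemma integrable_dgaussRn n (j : 'I_n) (u : R) : 0 < u ->
  (lebesgueRn n).-integrable setT (fun z => (dgaussRn j u z)%:E).
Proof.
move=> u0; have u20 : 0 < 2 * u by rewrite mulr_gt0.
apply: (le_integrable measurableT) (integrableZl measurableT
  ((Num.sqrt u)^-1 * Num.sqrt 2 ^+ n) (integrable_gaussRn n u20)).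
  by apply/measurable_EFinP; exact: measurable_dgaussRn.
move=> z _; rewrite -EFinM !abse_EFin lee_fin.
rewrite [leRHS]ger0_norm; last by rewrite !mulr_ge0 ?exprn_ge0 ?invr_ge0 ?sqrtr_ge0 ?gaussRn_ge0.
by rewrite -mulrA normr_dgaussRn_le_gaussRn.
Qed.

Lemma integral_dgaussRn n (j : 'I_n) (u : R) : 0 < u ->
  (\int[lebesgueRn n]_z (dgaussRn j u z)%:E = 0)%E.
Proof.
move=> u0; have iq := integrable_dgaussRn j u0.
have mq := measurable_int _ iq.
have : (\int[lebesgueRn n]_z (dgaussRn j u z)%:E =
        - \int[lebesgueRn n]_z (dgaussRn j u z)%:E)%E.
  rewrite [LHS](@integral_isoRn _ _ (fun=> -1) (fun=> 0))//; last first.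
    by move=> i; rewrite normrN1.
  rewrite -mulN1e -integralZl//; apply: eq_integral => z _.
  rewrite -EFinM; congr EFin; rewrite /dgaussRn /gaussRn.
  have -> : sqnorm (affineRn (fun=> -1) (fun=> 0) z) = sqnorm z.
    by rewrite sqnorm_affineRn; apply: eq_bigr => i _; rewrite addr0 mulN1r sqrrN.
  by rewrite tnth_affineRn; ring.
have := integrable_fin_num measurableT iq.
case: (\int[_]_z _)%E => // r _ [] rN; congr EFin; lra.
Qed.

(** Completing the square: |y|^2/a + |x - y|^2/b = |y - m|^2/v + |x|^2/(a + b), with m = a x/(a + b)
    and v = ab/(a + b). *)
Lemma dgaussRn_convolution n (j : 'I_n) (a b : R) (x : Rn R n) : 0 < a -> 0 < b ->
  (lebesgueRn n).-integrable setT
    (fun y => (dgaussRn j a y * gaussRn b (subRn x y))%:E) /\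
  (\int[lebesgueRn n]_y (dgaussRn j a y * gaussRn b (subRn x y))%:E =
   (Num.sqrt pi ^+ n * dgaussRn j (a + b) x)%:E)%E.
Proof.
move=> a0 b0.
have msub : measurable_fun setT (fun y : Rn R n => subRn x y).
  exact: (measurableT_comp (@measurable_subRn n) (pair1_measurable x)).
have iF : (lebesgueRn n).-integrable setT
    (fun y => (dgaussRn j a y * gaussRn b (subRn x y))%:E).
  apply: (le_integrable measurableT) (integrableZl measurableT
    (Num.sqrt a ^- n.+1) (integrable_gaussRn_sub x b0)).
    apply/measurable_EFinP/measurable_funM; first exact: measurable_dgaussRn.
    exact: (measurableT_comp (@measurable_gaussRn n b)).
  move=> y _; rewrite -EFinM !abse_EFin lee_fin normrM [leLHS]normrM.
  rewrite ler_wpM2r// [leRHS]ger0_norm ?invr_ge0 ?exprn_ge0 ?sqrtr_ge0//.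
  exact: normr_dgaussRn_le.
split=> //.
have ab0 : 0 < a + b by rewrite addr_gt0.
pose v := a * b / (a + b); have v0 : 0 < v by rewrite divr_gt0 ?mulr_gt0.
have sv0 : 0 < Num.sqrt v by rewrite sqrtr_gt0.
pose m i := a / (a + b) * tnth x i.
rewrite (@integral_affineRn _ _ (fun=> Num.sqrt v) m _ _ iF); last first.
  by move=> i; rewrite gt_eqF.
rewrite prodr_norm_cst ?ltW//.
pose K := Num.sqrt a ^- n * Num.sqrt b ^- n * expR (- (sqnorm x / (a + b))).
(* After y = sqrt(v) w + m the linear factor splits into sqrt(v) w_j, whose Gaussian integral is 0
   by oddness, and the constant m_j, which gives the result. *)
transitivity ((Num.sqrt v ^+ n)%:E * \int[lebesgueRn n]_y
   ((K * Num.sqrt v / a)%:E * (dgaussRn j 1 y)%:E + (K * m j / a)%:E * (gaussRn 1 y)%:E))%E.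
  congr (_ * _)%E; apply: eq_integral => y _.
  rewrite -!EFinM -EFinD; congr EFin.
  rewrite /dgaussRn /gaussRn tnth_affineRn sqrtr1 expr1n invr1 !mul1r !mulr1.
  set e1 := expR (- (sqnorm (affineRn _ _ _) / a)); set e2 := expR (- (_ / b)).
  have ee : e1 * e2 = expR (- (sqnorm x / (a + b))) * expR (- sqnorm y).
    rewrite -!expRD; congr expR; rewrite -[LHS]opprD -[RHS]opprD; congr (- _).
    rewrite subRn_affineRn.
    rewrite /sqnorm !mulr_suml -!big_split/=; apply: eq_bigr => i _.
    rewrite !tnth_affineRn /m.
    set w := tnth y i; set xi := tnth x i.
    have -> : (Num.sqrt v * w + a / (a + b) * xi) ^+ 2 / a +
      (-1 * (Num.sqrt v * w + a / (a + b) * xi) + xi) ^+ 2 / b =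
      Num.sqrt v ^+ 2 * w ^+ 2 * (a^-1 + b^-1) + xi ^+ 2 / (a + b).
      by field; rewrite !gt_eqF.
    rewrite sqr_sqrtr ?(ltW v0)// /v; field; by rewrite !gt_eqF.
  transitivity ((Num.sqrt v * tnth y j + m j) / a * (Num.sqrt a ^- n * Num.sqrt b ^- n) * (e1 * e2)).
    by ring.
  rewrite ee /K; ring.
have i1 := integrableZl measurableT (K * Num.sqrt v / a) (integrable_dgaussRn j (@ltr01 R)).
have i2 := integrableZl measurableT (K * m j / a) (integrable_gaussRn n (@ltr01 R)).
rewrite integralD// integralZl//; last exact: integrable_dgaussRn.
rewrite integralZl//; last exact: integrable_gaussRn.
rewrite integral_dgaussRn// integral_gaussRn// mule0 add0e -!EFinM; congr EFin.
rewrite /K /m /dgaussRn /gaussRn.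
have -> : Num.sqrt v = Num.sqrt a * Num.sqrt b / Num.sqrt (a + b).
  by rewrite /v sqrtrM ?mulr_ge0 ?(ltW a0) ?(ltW b0)// sqrtrM ?(ltW a0)// sqrtrV ?(ltW ab0).
rewrite exprMn exprVn exprMn; field.
by rewrite ?expf_neq0 ?gt_eqF ?sqrtr_gt0//.
Qed.
End Gaussians.

(** * The Riesz kernel as a superposition of Gaussians *)

Section Kernel.
Set Implicit Arguments.
Unset Strict Implicit.
Context {R : realType}.
Local Notation mu := (@lebesgue_measure R).
Local Notation mR := (measurableTypeR R).

Lemma integral_oneDsqrV :
  (\int[mu]_x ((oneDsqr x)^-1)%:E = (pi : R)%:E)%E.
Proof.
rewrite ge0_symfun_integralT.
- rewrite -set_itvcy integral0y_oneDsqr -EFinM; congr EFin; by field.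
- by move=> x; rewrite invr_ge0 (le_trans ler01)// oneDsqr_ge1.
- exact: continuous_oneDsqrV.
- by move=> x; rewrite /= /oneDsqr sqrrN.
Qed.

Lemma integrable_oneDsqrV (C : R) :
  mu.-integrable setT (fun x => (C / oneDsqr x)%:E).
Proof.
rewrite (_ : (fun x => _) = (fun x => (C%:E * (oneDsqr x)^-1%:E)%E)); last first.
  by apply/funext => x; rewrite EFinM.
apply: (integrableZl measurableT); apply/integrableP; split.
  apply/measurable_EFinP; apply: continuous_measurable_fun.
  exact: continuous_oneDsqrV.
under eq_integral.
  move=> x _; rewrite abse_EFin ger0_norm; last first.
    by rewrite invr_ge0 (le_trans ler01)// oneDsqr_ge1.
  over.
by rewrite integral_oneDsqrV ltry.
Qed.

(** For m > 0, exp(v^2) is the m-th power of exp(v^2/m) >= 1 + v^2/m, so it is enough that v <= m +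
    v^2. The constant is crude, but only its finiteness matters. *)
Lemma exprn_expNsqr_le m (v : R) : 0 <= v ->
  v ^+ m * expR (- v ^+ 2) <= m%:R ^+ m.
Proof.
move=> v0; rewrite expRN ler_pdivrMr ?expR_gt0//.
case: m => [|m]; first by rewrite !expr0 mul1r -expR0 ler_expR sqr_ge0.
have -> : expR (v ^+ 2) = expR (v ^+ 2 / m.+1%:R) ^+ m.+1.
  by rewrite -expRM_natl mulrCA mulfV ?mulr1// pnatr_eq0.
rewrite -exprMn lerXn2r ?nnegrE ?mulr_ge0 ?expR_ge0//.
apply: (@le_trans _ _ (m.+1%:R * (1 + v ^+ 2 / m.+1%:R))); last first.
  by rewrite ler_pM2l ?ltr0n// expR_ge1Dx.
rewrite mulrDr mulr1 mulrCA mulfV ?mulr1 ?pnatr_eq0//.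
have m1 : (1 : R) <= m.+1%:R by rewrite ler1n.
have := sqr_ge0 (v - 1); have := sqr_ge0 v; rewrite sqrrB; lra.
Qed.

(* The profile of [r |-> dgaussRn j (r ^+ 2) y], see [dgaussRn_radial]. *)
Definition radial n (s : R) : R := Num.sqrt (s ^+ 2) ^- n / s ^+ 2 * expR (- (s ^+ 2)^-1).

Lemma radial_ge0 n s : 0 <= radial n s.
Proof.
by rewrite mulr_ge0 ?expR_ge0// mulr_ge0 ?invr_ge0 ?sqr_ge0 ?exprn_ge0 ?sqrtr_ge0.
Qed.

Lemma measurable_radial n : measurable_fun setT (radial n).
Proof.
apply: measurable_funM; last first.
  apply: (measurableT_comp (@measurable_expR R)); apply: measurable_funN.
  by apply: (measurableT_comp measurable_inv); exact: measurable_funX.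
apply: measurable_funM.
  apply: (measurableT_comp measurable_inv); apply: measurable_funX.
  by apply: (measurableT_comp measurable_sqrt); exact: measurable_funX.
by apply: (measurableT_comp measurable_inv); exact: measurable_funX.
Qed.

Lemma radialE n s : radial n s = (`|s|^-1) ^+ n.+2 * expR (- (`|s|^-1) ^+ 2).
Proof.
rewrite /radial sqrtr_sqr exprVn exprVn real_normK ?num_real//; congr (_ * _).
by rewrite -[in LHS](real_normK (num_real s)) -invfM -exprD addn2.
Qed.

Lemma radial_le n s : radial n s <= (n.+2%:R ^+ n.+2 + n%:R ^+ n) / oneDsqr s.
Proof.
have o0 : 0 < oneDsqr s by rewrite (lt_le_trans ltr01)// oneDsqr_ge1.
rewrite ler_pdivlMr//.
have [->|s0] := eqVneq s 0.
  by rewrite radialE normr0 invr0 expr0n/= mul0r mul0r addr_ge0// exprn_ge0.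
(* With w = 1/|s|, multiplying the profile by 1 + s^2 gives w^(n+2) exp(-w^2) + w^n exp(-w^2), one
   term for each summand of the constant. *)
rewrite radialE /oneDsqr mulrDr mulr1 lerD//.
  by apply: exprn_expNsqr_le; rewrite invr_ge0.
apply: le_trans (@exprn_expNsqr_le n (`|s|^-1) _); last by rewrite invr_ge0.
have -> : s ^+ 2 = (`|s|^-1) ^- 2 by rewrite exprVn invrK real_normK ?num_real.
by rewrite -addn2 exprD mulrAC mulfK// expf_neq0// invr_eq0 normr_eq0.
Qed.

Lemma integrable_radial n : mu.-integrable setT (fun s => (radial n s)%:E).
Proof.
apply: (le_integrable measurableT) (integrable_oneDsqrV (n.+2%:R ^+ n.+2 + n%:R ^+ n)).
  by apply/measurable_EFinP; exact: measurable_radial.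
move=> s _; rewrite !abse_EFin lee_fin ger0_norm ?radial_ge0//.
by apply: le_trans (ler_norm _); exact: radial_le.
Qed.

(** The factor between the Riesz kernel and the superposition of the functions
    [dgaussRn j (r ^+ 2)]; its value is Gamma((n+1)/2). *)
Definition radial_mass n : R := \int[mu]_s radial n s.

Lemma radial_massE n : (\int[mu]_s (radial n s)%:E)%E = (radial_mass n)%:E.
Proof. by rewrite fineK//; exact: integrable_fin_num (integrable_radial n). Qed.

Lemma radial_mass_gt0 n : 0 < radial_mass n.
Proof.
rewrite -lte_fin -radial_massE.
(* A lower bound for the profile on [1, 2], where 1/s lies between 1/2 and 1. *)
pose e := (2^-1 : R) ^+ n.+2 * expR (- 1).
have e0 : 0 < e by rewrite mulr_gt0 ?expR_gt0// exprn_gt0.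
apply: (@lt_le_trans _ _ (\int[mu]_(s in `[1%R, 2%R]%classic) (cst e%:E s))%E).
  rewrite integral_cst//= lebesgue_measure_itv/= lte_fin ltr1n.
  by rewrite -EFinB -EFinM lte_fin mulr_gt0//; lra.
apply: (@le_trans _ _ (\int[mu]_(s in `[1%R, 2%R]%classic) (radial n s)%:E)%E).
  apply: ge0_le_integral => //.
  - by move=> s _; rewrite lee_fin ltW.
  - apply: measurable_funTS; apply/measurable_EFinP; exact: measurable_radial.
  move=> s /=; rewrite in_itv/= => /andP[s1 s2].
  have s0 : 0 < s by rewrite (lt_le_trans ltr01).
  rewrite lee_fin radialE gtr0_norm// ler_pM ?exprn_ge0 ?invr_ge0 ?expR_ge0//.
    by rewrite lerXn2r ?nnegrE ?invr_ge0 ?(ltW s0)// lef_pV2 ?posrE.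
  rewrite ler_expR lerN2 exprn_ile1 ?invr_ge0 ?(ltW s0)//.
  by rewrite invf_le1.
apply: ge0_subset_integral => //.
  by apply/measurable_EFinP; exact: measurable_radial.
by move=> s _; rewrite lee_fin radial_ge0.
Qed.

Lemma dgaussRn_radial n (j : 'I_n) (y : Rn R n) (s : R) : 0 < normRn y ->
  normRn y * dgaussRn j ((normRn y * s) ^+ 2) y = riesz_kernel j y * radial n s.
Proof.
move=> N0; have [->|s0] := eqVneq s 0.
  rewrite radialE mulr0 normr0 invr0 !expr0n/= mul0r mulr0.
  by rewrite /dgaussRn invr0 mulr0 mul0r mulr0.
rewrite /dgaussRn /gaussRn /riesz_kernel /radial -sqr_normRn.
have -> : - (normRn y ^+ 2 / (normRn y * s) ^+ 2) = - (s ^+ 2)^-1.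
  by field; rewrite s0 gt_eqF.
rewrite !sqrtr_sqr normrM (gtr0_norm N0) !exprMn !exprS.
have Pn : normRn y ^+ n != 0 by rewrite expf_neq0// gt_eqF.
have Sn : `|s| ^+ n != 0 by rewrite expf_neq0// normr_eq0.
by field; rewrite ?Pn ?Sn s0 gt_eqF.
Qed.

(** The substitution r = |y| s separates y from the profile. It is done for the absolute value,
    where it needs no integrability; the signed formula follows because the sign of the integrand is
    that of y_j for every r. The absolute version is also what Tonelli uses in [intG]. *)
Lemma integral_dgaussRn_sqr n (j : 'I_n) (y : Rn R n) :
  mu.-integrable setT (fun r => (dgaussRn j (r ^+ 2) y)%:E) /\
  (\int[mu]_r (dgaussRn j (r ^+ 2) y)%:E = (riesz_kernel j y * radial_mass n)%:E)%E /\
  (\int[mu]_r `|dgaussRn j (r ^+ 2) y|%:E = (`|riesz_kernel j y| * radial_mass n)%:E)%E.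
Proof.
have mq : measurable_fun setT (fun r : mR => dgaussRn j (r ^+ 2) y).
  have m1 : measurable_fun setT (fun r : mR => (r ^+ 2, y) : mR * Rn R n).
    by apply: measurable_fun_pair => //; exact: measurable_funX.
  exact: (measurableT_comp (@measurable_dgaussRn2 R n j) m1).
(* At the origin all three quantities are 0, the kernel by division by zero. *)
have [N0|N0] := eqVneq (normRn y) 0.
  have y0 : tnth y j = 0.
    by apply/eqP; rewrite -normr_le0 -N0; exact: normr_tnth_le.
  have E r : dgaussRn j (r ^+ 2) y = 0 by rewrite /dgaussRn y0 !mul0r.
  split; first by under eq_fun do rewrite E; exact: integrable0.
  split; under eq_integral do rewrite E ?normr0; rewrite integral0.
    by rewrite /riesz_kernel y0 !mul0r.
  by rewrite /riesz_kernel y0 !mul0r normr0 mul0r.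
have {}N0 : 0 < normRn y by rewrite lt_neqAle eq_sym N0 normRn_ge0.
have absE : (\int[mu]_r `|dgaussRn j (r ^+ 2) y|%:E =
    (`|riesz_kernel j y| * radial_mass n)%:E)%E.
  rewrite (@ge0_integral_affine _ (normRn y) 0 (fun r : mR => `|dgaussRn j (r ^+ 2) y|%:E)).
  - rewrite -ge0_integralZl//; last first.
    + apply/measurable_EFinP/measurableT_comp => //.
      exact: (measurableT_comp mq (measurable_affine _ _)).
    rewrite EFinM -radial_massE -integralZl//; last exact: integrable_radial.
    apply: eq_integral => s _; rewrite -!EFinM; congr EFin.
    rewrite -normrM /affine addr0 dgaussRn_radial//.
    by rewrite normrM (ger0_norm (radial_ge0 _ _)).
  - by rewrite gt_eqF.
  - by apply/measurable_EFinP; apply: measurableT_comp.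
  - by move=> r; rewrite lee_fin.
have iq : mu.-integrable setT (fun r => (dgaussRn j (r ^+ 2) y)%:E).
  apply/integrableP; split; first exact/measurable_EFinP.
  by under eq_integral do rewrite abse_EFin; rewrite absE ltry.
split=> //; split=> //.
(* the sign of the integrand is that of the [j]-th coordinate *)
have [y0|y0] := leP 0 (tnth y j).
  have E r : dgaussRn j (r ^+ 2) y = `|dgaussRn j (r ^+ 2) y|.
    by rewrite ger0_norm// mulr_ge0 ?gaussRn_ge0// mulr_ge0// invr_ge0 sqr_ge0.
  under eq_integral do rewrite E.
  rewrite absE ger0_norm// /riesz_kernel mulr_ge0// invr_ge0.
  by rewrite exprn_ge0// normRn_ge0.
have E r : dgaussRn j (r ^+ 2) y = - `|dgaussRn j (r ^+ 2) y|.
  rewrite ler0_norm ?opprK// mulr_le0_ge0 ?gaussRn_ge0//.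
  by rewrite mulr_le0_ge0 ?(ltW y0)// invr_ge0 sqr_ge0.
under eq_integral do rewrite E EFinN.
rewrite integralN; last first.
  apply: (@integrable_add_def _ _ _ mu setT measurableT (fun r => `|dgaussRn j (r ^+ 2) y|%:E)).
  exact: (integrable_abse iq).
rewrite absE -EFinN ler0_norm ?mulNr ?opprK// mulr_le0_ge0 ?(ltW y0)//.
by rewrite invr_ge0 exprn_ge0// normRn_ge0.
Qed.
End Kernel.

(** * Convergence of the truncated Riesz transforms *)

Section RieszFormula.
Set Implicit Arguments.
Unset Strict Implicit.
Context {R : realType} {n : nat}.
Local Notation mu := (@lebesgue_measure R).
Local Notation mR := (measurableTypeR R).
Local Notation leb := (@lebesgueRn R n).
Implicit Types (j : 'I_n) (f : Rn R n -> R) (x y : Rn R n).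

(** The kernel is odd under this reflection as well as under y -> -y. The reflection is preferred
    because x - y and x - [flip j y] differ in one coordinate only, by 2 y_j, and |y_j| is the
    weight handled by [normr_tnth_dgaussRn_le]. *)
Definition flip j : Rn R n -> Rn R n :=
  affineRn (fun i => if i == j then -1 else 1) (fun=> 0).

Lemma tnth_flip j y i : tnth (flip j y) i = if i == j then - tnth y i else tnth y i.
Proof. by rewrite tnth_affineRn addr0; case: ifP => _; rewrite ?mulN1r ?mul1r. Qed.

Lemma sqnorm_flip j y : sqnorm (flip j y) = sqnorm y.
Proof. by apply: eq_bigr => i _; rewrite tnth_flip; case: ifP; rewrite ?sqrrN. Qed.

Lemma normRn_flip j y : normRn (flip j y) = normRn y.
Proof. exact: (congr1 Num.sqrt (sqnorm_flip j y)). Qed.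

Lemma dgaussRn_flip j u y : dgaussRn j u (flip j y) = - dgaussRn j u y.
Proof.
by rewrite /dgaussRn /gaussRn sqnorm_flip tnth_flip eqxx !mulNr.
Qed.

Lemma riesz_kernel_flip j y : riesz_kernel j (flip j y) = - riesz_kernel j y.
Proof. by rewrite /riesz_kernel normRn_flip tnth_flip eqxx mulNr. Qed.

Lemma measurable_flip j : measurable_fun setT (flip j).
Proof. exact: measurable_affineRn. Qed.

Lemma measurable_subRnl x : measurable_fun setT (fun y => subRn x y).
Proof. exact: (measurableT_comp (@measurable_subRn R n) (pair1_measurable x)). Qed.

Lemma integrable_subRn f x : leb.-integrable setT (EFin \o f) ->
  leb.-integrable setT (fun y => (f (subRn x y))%:E).
Proof.
move=> intf; rewrite (_ : (fun y => _) = (EFin \o f) \o affineRn (fun=> -1) (tnth x)).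
  by apply: integrable_affineRn => // i; rewrite oppr_eq0 oner_eq0.
by apply/funext => y; rewrite /= subRn_affineRn.
Qed.

Lemma integrable_flip j (f : Rn R n -> \bar R) : leb.-integrable setT f ->
  leb.-integrable setT (f \o flip j).
Proof.
by apply: integrable_affineRn => i; case: ifP; rewrite ?oppr_eq0 oner_eq0.
Qed.

Lemma integral_flip j (f : Rn R n -> \bar R) : measurable_fun setT f ->
  (\int[leb]_y f (flip j y) = \int[leb]_y f y)%E.
Proof.
move=> mf; rewrite [RHS](integral_isoRn (a := fun i => if i == j then -1 else 1) (fun=> 0))//.
by move=> i; case: ifP; rewrite ?normrN normr1.
Qed.

Lemma measurable_riesz_kernel j : measurable_fun setT (riesz_kernel (R := R) j).
Proof.
apply: measurable_funM; first exact: measurable_tnth.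
apply: (measurableT_comp measurable_inv); apply: measurable_funX.
exact: measurable_normRn.
Qed.

Lemma normr_riesz_kernel_le j y : `|riesz_kernel j y| <= normRn y ^- n.
Proof.
have [N0|N0] := eqVneq (normRn y) 0.
  rewrite /riesz_kernel N0 expr0n/= invr0 mulr0 normr0.
  by rewrite invr_ge0 exprn_ge0.
have {}N0 : 0 < normRn y by rewrite lt_neqAle eq_sym N0 normRn_ge0.
rewrite /riesz_kernel normrM [X in _ * X]ger0_norm ?invr_ge0 ?exprn_ge0 ?(ltW N0)//.
rewrite exprS invfM mulrA ler_piMl ?invr_ge0 ?exprn_ge0 ?(ltW N0)//.
by rewrite ler_pdivrMr// mul1r normr_tnth_le.
Qed.

(** * Antisymmetrisation in the j-th coordinate *)

Section odd_part.
Variables (j : 'I_n) (f : Rn R n -> R) (x : Rn R n).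
Hypothesis intf : leb.-integrable setT (EFin \o f).

Definition odd_part y : R := (f (subRn x y) - f (subRn x (flip j y))) / 2.

Let mf : measurable_fun setT f.
Proof. by apply/measurable_EFinP; exact: measurable_int intf. Qed.

Lemma measurable_odd_part : measurable_fun setT odd_part.
Proof.
apply: measurable_funM => //; apply: measurable_funB.
  exact: (measurableT_comp mf (measurable_subRnl x)).
exact: (measurableT_comp mf (measurableT_comp (measurable_subRnl x) (@measurable_flip j))).
Qed.

Lemma integrable_odd_part : leb.-integrable setT (EFin \o odd_part).
Proof.
have i1 := integrable_subRn x intf.
have i2 := integrable_flip j i1.
have := integrableZl measurableT 2^-1 (integrableB measurableT i1 i2).
apply: eq_integrable => // y _ /=.
by rewrite -EFinB -EFinM mulrC.
Qed.

(** The integral is averaged with its reflected copy, which has the same value. The gain is that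
    [odd_part] can be small near y_j = 0, where [f] itself is not. *)
Lemma integral_odd_kernel (K : Rn R n -> R) :
  measurable_fun setT K -> (forall y, K (flip j y) = - K y) ->
  leb.-integrable setT (fun y => (K y * f (subRn x y))%:E) ->
  (\int[leb]_y (K y * f (subRn x y))%:E = \int[leb]_y (K y * odd_part y)%:E)%E.
Proof.
move=> mK Kodd i1.
have i2 : leb.-integrable setT (fun y => (- (K y * f (subRn x (flip j y))))%:E).
  apply: eq_integrable (integrable_flip j i1) => // y _ /=.
  by rewrite Kodd mulNr.
have e2 : (\int[leb]_y (- (K y * f (subRn x (flip j y))))%:E =
    \int[leb]_y (K y * f (subRn x y))%:E)%E.
  rewrite -[RHS](integral_flip j); last exact: measurable_int i1.
  by apply: eq_integral => y _; rewrite Kodd mulNr.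
transitivity (\int[leb]_y ((2^-1)%:E * ((K y * f (subRn x y))%:E +
    (- (K y * f (subRn x (flip j y))))%:E)))%E; last first.
  apply: eq_integral => y _; rewrite -EFinD -EFinM; congr EFin.
  by rewrite /odd_part; field.
rewrite integralZl//; last exact: integrableD.
rewrite integralD// e2.
have := integrable_fin_num measurableT i1.
case: (\int[_]_y _)%E => // r _.
by rewrite -EFinD -EFinM; congr EFin; field.
Qed.
End odd_part.

(** * Principal values for functions that are Lipschitz along the reflection *)

Section formula.
Variables (j : 'I_n) (f : Rn R n -> R) (x : Rn R n) (L : R).
Hypothesis intf : leb.-integrable setT (EFin \o f).
Hypothesis L0 : 0 <= L.
Hypothesis lipf : forall y, `|f (subRn x y) - f (subRn x (flip j y))| <= L * `|tnth y j|.

Local Notation D := (odd_part j f x).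

Let odd_part_le y : `|D y| <= L / 2 * `|tnth y j|.
Proof.
rewrite /odd_part normrM [X in _ * X]ger0_norm// mulrAC.
by rewrite ler_pM2r.
Qed.

Let Phi (ry : mR * Rn R n) : R := dgaussRn j (ry.1 ^+ 2) ry.2 * D ry.2.

Let mdgauss2 : measurable_fun setT (fun ry : mR * Rn R n => dgaussRn j (ry.1 ^+ 2) ry.2).
Proof.
have m1 : measurable_fun setT (fun ry : mR * Rn R n => (ry.1 ^+ 2, ry.2) : mR * Rn R n).
  by apply: measurable_fun_pair => //; exact: measurable_funX.
exact: (measurableT_comp (@measurable_dgaussRn2 R n j) m1).
Qed.

Let mPhi : measurable_fun setT Phi.
Proof.
apply: measurable_funM => //.
by apply: (measurableT_comp (measurable_odd_part j x intf)).
Qed.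

Let M : R := \int[leb]_y `|D y|.

Let ME : (\int[leb]_y `|D y|%:E = M%:E)%E.
Proof.
rewrite fineK//.
exact: integrable_fin_num (integrable_abse (integrable_odd_part j x intf)).
Qed.

Let M0 : 0 <= M. Proof. by apply: Rintegral_ge0. Qed.

Let K1 : R := L * (Num.sqrt 2 ^+ n * Num.sqrt pi ^+ n).

Let K10 : 0 <= K1.
Proof. by rewrite !mulr_ge0 ?exprn_ge0 ?sqrtr_ge0. Qed.

(** The bound for small r: the factor |y_j| from [lipf] cancels the growth of order 1/|r| of the L^1
    norm of [dgaussRn j (r ^+ 2)]. *)
Let slice_le1 (r : R) : r != 0 -> (\int[leb]_y `|Phi (r, y)|%:E <= K1%:E)%E.
Proof.
move=> r0; have u0 : 0 < r ^+ 2 by rewrite exprn_even_gt0.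
have u20 : 0 < 2 * r ^+ 2 by rewrite mulr_gt0.
have -> : (K1%:E = \int[leb]_y ((L * Num.sqrt 2 ^+ n)%:E * (gaussRn (2 * r ^+ 2) y)%:E))%E.
  rewrite integralZl//; last exact: integrable_gaussRn.
  by rewrite integral_gaussRn// -EFinM /K1 mulrA.
apply: ge0_le_integralW => y; first by rewrite lee_fin.
rewrite -EFinM lee_fin /Phi/= normrM.
apply: (@le_trans _ _ (`|dgaussRn j (r ^+ 2) y| * (L / 2 * `|tnth y j|))).
  by rewrite ler_wpM2l.
rewrite mulrCA -normrM [dgaussRn _ _ _ * _]mulrC.
apply: (@le_trans _ _ (L / 2 * (2 * (Num.sqrt 2 ^+ n * gaussRn (2 * r ^+ 2) y)))).
  by rewrite ler_wpM2l ?mulr_ge0// normr_tnth_dgaussRn_le.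
by rewrite le_eqVlt; apply/orP; left; apply/eqP; field.
Qed.

(** The bound for large r: the supremum of the Gaussian factor decays like |r|^-(n+1), hence at
    least like r^-2 once n >= 1. *)
Let slice_le2 (r : R) : r != 0 ->
  (\int[leb]_y `|Phi (r, y)|%:E <= (`|r| ^- n.+1 * M)%:E)%E.
Proof.
move=> r0; have u0 : 0 < r ^+ 2 by rewrite exprn_even_gt0.
rewrite EFinM -ME -integralZl//; last first.
  exact: (integrable_abse (integrable_odd_part j x intf)).
apply: ge0_le_integralW => y; first by rewrite lee_fin.
rewrite -EFinM lee_fin /Phi/= normrM ler_wpM2r//.
by have := normr_dgaussRn_le j y u0; rewrite sqrtr_sqr.
Qed.

Let slice_le (r : R) : (0 < n)%N ->
  (\int[leb]_y `|Phi (r, y)|%:E <= (2 * (K1 + M) / oneDsqr r)%:E)%E.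
Proof.
move=> n0; have o0 : 0 < oneDsqr r by rewrite (lt_le_trans ltr01)// oneDsqr_ge1.
have [->|r0] := eqVneq r 0.
  under eq_integral do rewrite /Phi/= expr0n/= /dgaussRn invr0 mulr0 !mul0r normr0.
  by rewrite integral0 lee_fin divr_ge0 ?(ltW o0)// mulr_ge0// addr_ge0.
have r20 := sqr_ge0 r.
have [r1|r1] := leP (r ^+ 2) 1.
  apply: le_trans (slice_le1 r0) _.
  rewrite lee_fin ler_pdivlMr// /oneDsqr.
  apply: (@le_trans _ _ (K1 * 2)); first by rewrite ler_wpM2l//; lra.
  by move: M0 K10; lra.
apply: le_trans (slice_le2 r0) _.
rewrite lee_fin ler_pdivlMr//.
have r1' : 1 < `|r|.
  by move: r1; rewrite -(real_normK (num_real r)) expr_gt1.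
have h : `|r| ^- n.+1 * oneDsqr r <= 2.
  rewrite mulrC ler_pdivrMr ?exprn_gt0 ?normr_gt0//.
  apply: (@le_trans _ _ (2 * `|r| ^+ 2)).
    by rewrite real_normK ?num_real// /oneDsqr; lra.
  by rewrite ler_pM2l// ler_eXn2l.
rewrite mulrAC; apply: (@le_trans _ _ (2 * M)); first by rewrite ler_wpM2r.
by rewrite ler_pM2l// lerDr.
Qed.

Let intPhi : (0 < n)%N -> (mu \x leb)%E.-integrable setT (EFin \o Phi).
Proof.
move=> n0; apply/integrable12ltyP; first exact/measurable_EFinP.
apply: (@le_lt_trans _ _ (\int[mu]_r (2 * (K1 + M) / oneDsqr r)%:E)%E).
  apply: ge0_le_integralW => r; first exact: integral_ge0.
  exact: slice_le.
by apply: integrable_lty => //; exact: integrable_oneDsqrV.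
Qed.

Let G y : R := riesz_kernel j y * D y.

Let mG : measurable_fun setT G.
Proof.
apply: measurable_funM; first exact: measurable_riesz_kernel.
exact: measurable_odd_part.
Qed.

(** Integrating |[Phi]| first over r reproduces |[G]| up to the factor [radial_mass n], so the
    integrability of [Phi] on the product passes to the kernel with its singularity included. *)
Let intG : (0 < n)%N -> leb.-integrable setT (EFin \o G).
Proof.
move=> n0; apply/integrableP; split; first exact/measurable_EFinP.
have : (\int[leb]_y \int[mu]_r `|(EFin \o Phi) (r, y)| < +oo)%E.
  by apply/(@integrable21ltyP _ _ _ _ _ mu leb); [exact/measurable_EFinP|exact: intPhi].
have -> : (\int[leb]_y \int[mu]_r `|(EFin \o Phi) (r, y)| =
    \int[leb]_y ((radial_mass n)%:E * `|(EFin \o G) y|))%E.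
  apply: eq_integral => y _.
  have [i1 [_ e1]] := integral_dgaussRn_sqr j y.
  transitivity (\int[mu]_r (`|D y|%:E * `|dgaussRn j (r ^+ 2) y|%:E))%E.
    by apply: eq_integral => r _; rewrite -EFinM -normrM mulrC.
  rewrite integralZl//; last exact: (integrable_abse i1).
  by rewrite e1 -!EFinM; congr EFin; rewrite /G (normrM (riesz_kernel j y)); ring.
rewrite ge0_integralZl//; last 2 first.
- by apply: measurableT_comp => //; exact/measurable_EFinP.
- by rewrite lee_fin ltW// radial_mass_gt0.
have [//|] := ltP (\int[leb]_y `|(EFin \o G) y|)%E +oo%E.
by rewrite leye_eq => /eqP ->; rewrite gt0_muley ?ltxx// lte_fin radial_mass_gt0.
Qed.

(** Fubini for [Phi]; afterwards [odd_part] is traded back for [f] in each slice, where the kernel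
    [dgaussRn j (r ^+ 2)] is bounded and the original integral converges. *)
Let integral_GE : (0 < n)%N ->
  ((radial_mass n)%:E * \int[leb]_y (G y)%:E =
   \int[mu]_r \int[leb]_y (dgaussRn j (r ^+ 2) y * f (subRn x y))%:E)%E.
Proof.
move=> n0.
transitivity (\int[mu]_r \int[leb]_y (EFin \o Phi) (r, y))%E.
  rewrite (Fubini (intPhi n0)) -integralZl//; last exact: intG.
  apply: eq_integral => y _.
  have [i1 [e1 _]] := integral_dgaussRn_sqr j y.
  transitivity (\int[mu]_r ((D y)%:E * (dgaussRn j (r ^+ 2) y)%:E))%E; last first.
    by apply: eq_integral => r _; rewrite -EFinM mulrC.
  by rewrite integralZl// e1 -!EFinM; congr EFin; rewrite /G; ring.
apply: eq_integral => r _ /=; rewrite /Phi/=.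
have [->|r0] := eqVneq r 0.
  by congr (integral _ _ _); apply/funext => y; rewrite expr0n/= /dgaussRn invr0 mulr0 !mul0r.
have u0 : 0 < r ^+ 2 by rewrite exprn_even_gt0.
apply/esym/integral_odd_kernel => //; [exact: measurable_dgaussRn|exact: dgaussRn_flip|].
apply: (le_integrable measurableT) (integrableZl measurableT (Num.sqrt (r ^+ 2) ^- n.+1)
  (integrable_subRn x intf)).
  apply/measurable_EFinP/measurable_funM; first exact: measurable_dgaussRn.
  apply: (measurableT_comp _ (measurable_subRnl x)).
  by apply/measurable_EFinP; exact: measurable_int intf.
move=> y _; rewrite -EFinM !abse_EFin lee_fin normrM [leLHS]normrM ler_wpM2r//.
by apply: le_trans (ler_norm _); exact: normr_dgaussRn_le.
Qed.

(** The cut-off |y| > eps is invariant under [flip], so the truncated kernel is still odd, and it is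
    bounded by eps^(-n). Hence [f] may be replaced by its odd part before eps tends to 0. *)
Let riesz_truncE (eps : R) : 0 < eps ->
  riesz_trunc j eps f x = fine (\int[leb]_y (if eps < normRn y then G y else 0)%:E).
Proof.
move=> e0.
pose K y : R := if eps < normRn y then riesz_kernel j y else 0.
have mlt : measurable_fun setT (fun y : Rn R n => eps < normRn y).
  by apply: measurable_fun_ltr => //; exact: measurable_normRn.
have mK : measurable_fun setT K.
  by apply: measurable_fun_ifT => //; exact: measurable_riesz_kernel.
have Kodd y : K (flip j y) = - K y.
  by rewrite /K normRn_flip; case: ifP; rewrite ?riesz_kernel_flip ?oppr0.
have Kle y : `|K y| <= eps ^- n.
  rewrite /K; case: ifPn => h; last by rewrite normr0 invr_ge0 exprn_ge0// ltW.
  apply: le_trans (normr_riesz_kernel_le _ _) _.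
  rewrite lef_pV2 ?posrE ?exprn_gt0//; last exact: lt_trans h.
  by rewrite lerXn2r ?nnegrE ?(ltW e0) ?normRn_ge0// ltW.
have iK : leb.-integrable setT (fun y => (K y * f (subRn x y))%:E).
  apply: (le_integrable measurableT) (integrableZl measurableT (eps ^- n)
    (integrable_subRn x intf)).
    apply/measurable_EFinP/measurable_funM => //.
    apply: (measurableT_comp _ (measurable_subRnl x)).
    by apply/measurable_EFinP; exact: measurable_int intf.
  move=> y _; rewrite -EFinM !abse_EFin lee_fin (normrM (K y)) (normrM (eps ^- n)).
  by rewrite ler_wpM2r//; apply: le_trans (ler_norm _); exact: Kle.
rewrite /riesz_trunc /Rintegral integral_mkcond; congr fine.
transitivity (\int[leb]_y (K y * f (subRn x y))%:E)%E.
  apply: eq_integral => y _; rewrite patchE /K; case: ifPn => h.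
    by move: h; rewrite inE/= => ->; rewrite mulrC.
  by move: h; rewrite notin_setE/= => /negP/negbTE ->; rewrite mul0r.
rewrite (integral_odd_kernel mK Kodd iK).
by apply: eq_integral => y _; rewrite /K /G; case: ifP => _; rewrite ?mul0r.
Qed.

(** All truncations are dominated by the integrable [G], so the limit exists at the given point [x]
    itself and not merely almost everywhere. *)
Lemma riesz_truncation_cvg : (0 < n)%N ->
  riesz_trunc j eps f x @[eps --> 0^'+] -->
  (radial_mass n)^-1 * fine (\int[mu]_r \int[leb]_y
     (dgaussRn j (r ^+ 2) y * f (subRn x y))%:E).
Proof.
move=> n0; have m0 := radial_mass_gt0 (R := R) n.
rewrite -(integral_GE n0).
have finG := integrable_fin_num measurableT (intG n0).
rewrite fineM// mulrA mulVf ?gt_eqF// mul1r.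
apply/cvg_at_rightP => e [e0 ecvg].
under eq_fun do rewrite (riesz_truncE (e0 _)).
apply: fine_cvg; rewrite fineK//.
pose g k y : R := if e k < normRn y then G y else 0.
have mg k : measurable_fun setT (EFin \o g k).
  apply/measurable_EFinP; apply: measurable_fun_ifT => //.
  by apply: measurable_fun_ltr => //; exact: measurable_normRn.
have gG : {ae leb, forall y, setT y -> EFin (g k y) @[k --> \oo] --> (G y)%:E}.
  apply: aeW => y _.
  have [N0|N0] := eqVneq (normRn y) 0.
    (* The origin is never in the truncated domain, and the kernel is 0/0 = 0 there, so the limit
       agrees. *)
    have -> : G y = 0 by rewrite /G /riesz_kernel N0 expr0n/= invr0 mulr0 mul0r.
    rewrite (_ : (fun _ => _) = cst 0%E); first exact: cvg_cst.
    by apply/funext => k; rewrite /g N0 ltNge (ltW (e0 k)).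
  have {}N0 : 0 < normRn y by rewrite lt_neqAle eq_sym N0 normRn_ge0.
  apply: cvg_near_cst; near=> k.
  rewrite /g ifT//; near: k.
  exact: (cvgr_lt _ ecvg).
have gle : {ae leb, forall y k, setT y -> (`|(EFin \o g k) y| <= `|(G y)%:E|)%E}.
  apply: aeW => y k _; rewrite !abse_EFin lee_fin /g.
  by case: ifP => // _; rewrite normr0.
have mGE : measurable_fun setT (EFin \o G) by exact/measurable_EFinP.
by have [] := dominated_convergence measurableT mg mGE gG (integrable_abse (intG n0)) gle.
Unshelve. all: by end_near. Qed.
End formula.
End RieszFormula.

(** * Polar coordinates *)

Section Polar.
Set Implicit Arguments.
Unset Strict Implicit.
Context {R : realType}.
Local Notation mu := (@lebesgue_measure R).
Local Notation mR := (measurableTypeR R).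
Local Notation mu2 := (mu \x mu)%E.

Definition sqnorm2 (p : mR * mR) : mR := p.1 ^+ 2 + p.2 ^+ 2.

Lemma measurable_sqnorm2 : measurable_fun setT sqnorm2.
Proof. by apply: measurable_funD; exact: measurable_funX. Qed.

Definition disc (b : R) : set (mR * mR) := [set p | sqnorm2 p <= b].

Lemma measurable_disc b : measurable (disc b).
Proof.
rewrite (_ : disc b = sqnorm2 @^-1` [set` `]-oo, b]]).
  by rewrite -[X in measurable X]setTI; exact: measurable_sqnorm2.
by apply/seteqP; split => p /=; rewrite in_itv.
Qed.

Lemma disc_scale b : 0 < b -> mu2 (disc b) = (b%:E * mu2 (disc 1))%E.
Proof.
move=> b0; have sb0 : 0 < Num.sqrt b by rewrite sqrtr_gt0.
pose F c (p : mR * mR) : \bar R := (\1_(disc c) p)%:E.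
have mF c : measurable_fun setT (F c).
  by apply/measurable_EFinP; exact: measurable_indic (measurable_disc c).
have F0 c p : (0 <= F c p)%E by rewrite lee_fin.
have discE c : mu2 (disc c) = (\int[mu]_r \int[mu]_s F c (r, s))%E.
  rewrite -fubini_tonelli1// integral_indic ?setIT//.
  exact: measurable_disc.
have Fsb : forall r s, F b (affine (Num.sqrt b) 0 r, affine (Num.sqrt b) 0 s) = F 1 (r, s).
  move=> r s; rewrite /F !indicE; congr (_%:R%:E); congr nat_of_bool.
  rewrite /disc /sqnorm2 /affine; apply/idP/idP; rewrite !inE/= !addr0 !exprMn sqr_sqrtr ?(ltW b0)//;
    by rewrite -mulrDr ger_pMr.
rewrite !discE (@ge0_integral_affine _ (Num.sqrt b) 0); last 3 first.
- by rewrite gt_eqF.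
- exact: (measurable_fun_fubini_tonelli_F (F b)).
- by move=> r; apply: integral_ge0.
have E r : (\int[mu]_s F b (affine (Num.sqrt b) 0 r, s) =
    (Num.sqrt b)%:E * \int[mu]_s F 1%R (r, s))%E.
  rewrite (@ge0_integral_affine _ (Num.sqrt b) 0); last 3 first.
  - by rewrite gt_eqF.
  - exact: (measurableT_comp (mF b) (pair1_measurable _)).
  - by [].
  rewrite gtr0_norm//; congr (_ * _)%E.
  by apply: eq_integral => s _; exact: Fsb.
under eq_integral do rewrite E.
rewrite ge0_integralZl//; last 2 first.
- exact: (measurable_fun_fubini_tonelli_F (F 1)).
- by move=> r _; apply: integral_ge0.
by rewrite gtr0_norm// muleA -EFinM -expr2 sqr_sqrtr// ltW.
Qed.

Lemma disc_neg b : b < 0 -> mu2 (disc b) = 0%E.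
Proof.
move=> b0; rewrite (_ : disc b = set0) ?measure0//.
apply/seteqP; split => // p /= /le_lt_trans /(_ b0).
by rewrite ltNge addr_ge0 ?sqr_ge0.
Qed.

Lemma disc0 : mu2 (disc 0) = 0%E.
Proof.
rewrite (_ : disc 0 = [set 0] `*` [set 0]).
  by rewrite product_measure1E//= lebesgue_measure_set1 mule0.
apply/seteqP; split => -[r s] /=.
  rewrite /disc/= /sqnorm2/= => h.
  have := sqr_ge0 r; have := sqr_ge0 s => s0 r0.
  by split; apply/eqP; rewrite -sqrf_eq0 eq_le ?r0 ?s0 andbT; lra.
by move=> [-> ->]; rewrite /disc/= /sqnorm2/= expr0n/= addr0.
Qed.

(** The number pi, in a form that needs no evaluation: the disc lies between two squares, and its
    behaviour under dilation suffices. *)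
Definition disc_area : R := fine (mu2 (disc 1)).

Lemma disc_areaE : mu2 (disc 1) = disc_area%:E.
Proof.
rewrite fineK// ge0_fin_numE//.
apply: (@le_lt_trans _ _ (mu2 (`[-1, 1]%classic `*` `[-1, 1]%classic))).
  apply: le_measure; rewrite ?inE; [exact: measurable_disc|exact: measurableX|].
  move=> [r s]; rewrite /disc/= /sqnorm2/= => h.
  have := sqr_ge0 r; have := sqr_ge0 s => s0 r0.
  rewrite !in_itv/= -!ler_norml.
  by split; rewrite -[leRHS](expr1n _ 2) -ler_sqr ?nnegrE// ?real_normK ?num_real//; lra.
rewrite product_measure1E//= !lebesgue_measure_itv/=.
by case: ifP => _; rewrite -?EFinB -?EFinM ?mule0 ltry.
Qed.

Lemma disc_area_gt0 : 0 < disc_area.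
Proof.
rewrite -lte_fin -disc_areaE.
apply: (@lt_le_trans _ _ (mu2 (`[0, 2^-1]%classic `*` `[0, 2^-1]%classic))).
  rewrite product_measure1E//= !lebesgue_measure_itv/= lte_fin invr_gt0 ltr0n/=.
  by rewrite -EFinB -EFinM lte_fin subr0 mulr_gt0.
apply: le_measure; rewrite ?inE; [exact: measurableX|exact: measurable_disc|].
move=> [r s] /=; rewrite !in_itv/= /disc/= /sqnorm2/= => -[/andP[r0 r1] /andP[s0 s1]].
have r2 : r ^+ 2 <= (2^-1) ^+ 2 by rewrite lerXn2r ?nnegrE.
have s2 : s ^+ 2 <= (2^-1) ^+ 2 by rewrite lerXn2r ?nnegrE.
by move: r2 s2; lra.
Qed.

Lemma mu2_disc b : mu2 (disc b) = (disc_area * Num.max b 0)%:E.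
Proof.
have [b0|b0|->] := ltgtP b 0.
- by rewrite disc_neg// mulr0.
- by rewrite disc_scale// disc_areaE -EFinM mulrC.
- by rewrite disc0 mulr0.
Qed.

Lemma sqnorm2_itv a b : a < b ->
  mu2 (sqnorm2 @^-1` `]a, b]%classic) =
  (disc_area * (Num.max b 0 - Num.max a 0))%:E.
Proof.
move=> ab; rewrite (_ : _ @^-1` _ = disc b `\` disc a).
  have boo : (mu2 (disc b) < +oo)%E by rewrite mu2_disc ltry.
  have /= -> := measureD (measurable_disc b) (measurable_disc a) boo.
  rewrite (_ : disc b `&` disc a = disc a) ?mu2_disc -?EFinB ?mulrBr//.
  by apply/setIidPr => p; rewrite /disc/= => /le_trans; apply; exact: ltW.
apply/seteqP; split => p /=; rewrite in_itv/= /disc/=.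
  by move=> /andP[h1 h2]; split => //; apply/negP; rewrite -ltNge.
by move=> [-> /negP]; rewrite -ltNge => ->.
Qed.

(** Lebesgue measure is determined by its values on half-open intervals of the whole line, whereas
    the image of the planar measure under [sqnorm2] lives on [0, +oo[. The auxiliary [nu] therefore
    adds Lebesgue measure on the negative half-line to the normalised image; the added part is
    invisible to [A]. *)
Lemma polar_measure (A : set mR) : measurable A -> A `<=` `[0, +oo[%classic ->
  mu2 (sqnorm2 @^-1` A) = (disc_area%:E * mu A)%E.
Proof.
move=> mA A0.
have k0 : 0 <= disc_area^-1 by rewrite invr_ge0 ltW// disc_area_gt0.
pose p : {measure set mR -> \bar R} := pushforward mu2 sqnorm2.
pose m1 : {measure set mR -> \bar R} := mscale (NngNum k0) (p measurable_sqnorm2).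
have mneg : measurable (`]-oo, 0[%classic : set mR) by [].
pose m2 : {measure set mR -> \bar R} := mrestr mu mneg.
pose nu : {measure set mR -> \bar R} := measure_add m1 m2.
have nuE B : nu B = (disc_area^-1%:E * mu2 (sqnorm2 @^-1` B) + mu (B `&` `]-oo, 0%R[%classic))%E.
  by rewrite -[nu B]/(measure_add m1 m2 B) measure_addE.
have munu : mu A = nu A.
  apply: lebesgue_measure_unique => // _ [[a b]] _ <-.
  rewrite nuE/=.
  have [ab|ba] := ltP a b; last first.
    by rewrite set_itv_ge ?bnd_simp -?leNgt// preimage_set0 set0I !measure0 mule0 adde0.
  rewrite sqnorm2_itv// -EFinM mulKf ?gt_eqF ?disc_area_gt0//.
  have [b0|b0] := ltP b 0.
    rewrite (_ : `]a, b]%classic `&` _ = `]a, b]%classic); last first.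
      apply/setIidPl => x /=; rewrite !in_itv/= => /andP[_ /le_lt_trans]; exact.
    rewrite !lebesgue_measure_itv/= lte_fin ab -EFinB -EFinD; congr EFin.
    by rewrite (max_r (ltW (lt_trans ab b0))); lra.
  rewrite (_ : `]a, b]%classic `&` _ = `]a, 0[%classic); last first.
    apply/seteqP; split => x /=; rewrite !in_itv/=; first by move=> [/andP[-> _] ->].
    by move=> /andP[h1 h2]; rewrite h1 h2 (le_trans (ltW h2)).
  rewrite !lebesgue_measure_itv/= !lte_fin ab -EFinB.
  have [a0|a0] := ltP a 0; last by rewrite adde0.
  by rewrite -EFinB -EFinD; congr EFin; lra.
rewrite munu nuE (_ : A `&` _ = set0) ?measure0 ?adde0; last first.
  apply/seteqP; split => // x [/A0] /=; rewrite !in_itv/= andbT => x0.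
  by rewrite ltNge x0.
by rewrite muleA -EFinM mulfV ?mul1e// gt_eqF// disc_area_gt0.
Qed.

Lemma ge0_integral_polar (h : mR -> \bar R) : measurable_fun setT h ->
  (forall u, 0 <= h u)%E ->
  (\int[mu2]_p h (sqnorm2 p) = disc_area%:E * \int[mu]_(u in `[0%R, +oo[) h u)%E.
Proof.
move=> mh h0.
have mh' : measurable_fun (`[0%R, +oo[%classic : set mR) h by exact: measurable_funTS.
have k0 : 0 <= disc_area by rewrite ltW// disc_area_gt0.
pose p0 : {measure set mR -> \bar R} := pushforward mu2 sqnorm2.
pose p := p0 measurable_sqnorm2.
transitivity (\int[p]_(u in `[0%R, +oo[) h u)%E.
  rewrite ge0_integral_pushforward//; last exact: measurable_sqnorm2.
  rewrite (_ : sqnorm2 @^-1` _ = setT)//.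
  apply/seteqP; split => // z _ /=; rewrite in_itv/= andbT.
  by rewrite addr_ge0// sqr_ge0.
transitivity (\int[mscale (NngNum k0) mu]_(u in `[0%R, +oo[) h u)%E.
  by apply: eq_measure_integral => A mA A0; exact: (polar_measure mA A0).
by rewrite ge0_integral_mscale.
Qed.
End Polar.

(** * Estimates on Gaussians *)

Section GaussianEstimates.
Set Implicit Arguments.
Unset Strict Implicit.
Context {R : realType}.
Local Notation mu := (@lebesgue_measure R).
Local Notation mR := (measurableTypeR R).
Local Notation mu2 := (mu \x mu)%E.

Lemma expN_sub_le (a b : R) : 0 <= a -> 0 <= b -> `|expR (- a) - expR (- b)| <= `|a - b|.
Proof.
wlog ab : a b / a <= b => [hw a0 b0|a0 b0].
  have [ab|/ltW ba] := leP a b; first exact: hw.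
  by rewrite distrC [leRHS]distrC; exact: hw.
rewrite ger0_norm; last by rewrite subr_ge0 ler_expR lerN2.
rewrite ler0_norm ?subr_le0// opprB.
have -> : expR (- b) = expR (- a) * expR (- (b - a)).
  by rewrite -expRD; congr expR; ring.
rewrite -{1}[expR (- a)]mulr1 -mulrBr.
have h1 : expR (- a) <= 1 by rewrite -expR0 ler_expR oppr_le0.
have h2 : 1 - expR (- (b - a)) <= b - a.
  by have := expR_ge1Dx (- (b - a)); lra.
have h3 : 0 <= 1 - expR (- (b - a)).
  by rewrite subr_ge0 -expR0 ler_expR oppr_le0 subr_ge0.
by apply: le_trans h2; rewrite ler_piMl.
Qed.

Lemma expNsqr_sub_le (p q : R) : `|expR (- p ^+ 2) - expR (- q ^+ 2)| <= 2 * `|p - q|.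
Proof.
wlog pq : p q / `|p| <= `|q| => [hw|].
  have [pq|/ltW qp] := leP `|p| `|q|; first exact: hw.
  by rewrite distrC [X in _ <= 2 * X]distrC; exact: hw.
have p2q2 : p ^+ 2 <= q ^+ 2.
  by rewrite -(real_normK (num_real p)) -(real_normK (num_real q)) lerXn2r ?nnegrE.
have e1 (a : R) : expR (- a ^+ 2) <= 1.
  by rewrite -expR0 ler_expR oppr_le0 sqr_ge0.
rewrite ger0_norm; last by rewrite subr_ge0 ler_expR lerN2.
(* Far apart, the bound is trivial since the values lie in [0, 1]. Otherwise q^2 - p^2 <= |p - q|
   (2|p| + 1), and exp(-p^2) absorbs the factor 2|p| + 1 at the price of 2. *)
have [d1|d1] := leP 1 `|p - q|.
  by have := e1 p; have := expR_gt0 (- q ^+ 2); lra.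
have -> : expR (- q ^+ 2) = expR (- p ^+ 2) * expR (- (q ^+ 2 - p ^+ 2)).
  by rewrite -expRD; congr expR; ring.
rewrite -{1}[expR (- p ^+ 2)]mulr1 -mulrBr.
have h2 : 1 - expR (- (q ^+ 2 - p ^+ 2)) <= q ^+ 2 - p ^+ 2.
  by have := expR_ge1Dx (- (q ^+ 2 - p ^+ 2)); lra.
have qp : `|q| <= `|p| + `|p - q|.
  by rewrite -{1}(subKr p q) (le_trans (ler_normB _ _)).
have h3 : q ^+ 2 - p ^+ 2 <= `|p - q| * (2 * `|p| + 1).
  rewrite -(real_normK (num_real p)) -(real_normK (num_real q)).
  apply: (@le_trans _ _ ((`|p| + `|p - q|) ^+ 2 - `|p| ^+ 2)).
    by rewrite lerD2r lerXn2r ?nnegrE// addr_ge0.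
  have -> : (`|p| + `|p - q|) ^+ 2 - `|p| ^+ 2 = `|p - q| * (2 * `|p| + `|p - q|) by ring.
  by rewrite ler_wpM2l// lerD2l ltW.
apply: (@le_trans _ _ (expR (- p ^+ 2) * (`|p - q| * (2 * `|p| + 1)))).
  by rewrite ler_wpM2l ?expR_ge0// (le_trans h2).
have -> : expR (- p ^+ 2) * (`|p - q| * (2 * `|p| + 1)) =
    `|p - q| * (2 * `|p| * expR (- p ^+ 2) + expR (- p ^+ 2)) by ring.
rewrite [leRHS]mulrC ler_wpM2l//.
have h5 := e1 p.
have h6 : 2 * `|p| * expR (- p ^+ 2) <= 1.
  rewrite expRN ler_pdivrMr ?expR_gt0// mul1r.
  apply: le_trans (expR_ge1Dx _).
  by have := sqr_ge0 (`|p| - 1); rewrite sqrrB real_normK ?num_real//; lra.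
by move: h6 h5; lra.
Qed.

Lemma gaussRn_le n (u : R) (z : Rn R n) : 0 < u -> gaussRn u z <= Num.sqrt u ^- n.
Proof.
move=> u0; rewrite /gaussRn ler_piMr ?invr_ge0 ?exprn_ge0 ?sqrtr_ge0//.
by rewrite -expR0 ler_expR oppr_le0 divr_ge0 ?sqnorm_ge0// ltW.
Qed.

Lemma sqnormD1 n (j : 'I_n) (z : Rn R n) :
  sqnorm z = tnth z j ^+ 2 + \sum_(i < n | i != j) tnth z i ^+ 2.
Proof. by rewrite /sqnorm (bigD1 j). Qed.

Lemma gaussRn_sub_le n (j : 'I_n) (u : R) (z z' : Rn R n) : 0 < u ->
  (forall i, i != j -> tnth z i = tnth z' i) ->
  `|gaussRn u z - gaussRn u z'| <= 2 * Num.sqrt u ^- n.+1 * `|tnth z j - tnth z' j|.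
Proof.
move=> u0 zz'; have su0 : 0 < Num.sqrt u by rewrite sqrtr_gt0.
pose c := \sum_(i < n | i != j) tnth z i ^+ 2.
have c0 : 0 <= c by apply: sumr_ge0 => i _; exact: sqr_ge0.
have cz' : \sum_(i < n | i != j) tnth z' i ^+ 2 = c.
  by apply: eq_bigr => i ij; rewrite zz'.
have E (y : Rn R n) : \sum_(i < n | i != j) tnth y i ^+ 2 = c ->
    gaussRn u y = Num.sqrt u ^- n * (expR (- (c / u)) * expR (- (tnth y j / Num.sqrt u) ^+ 2)).
  move=> cy; rewrite /gaussRn (sqnormD1 j) cy -expRD; congr (_ * expR _).
  by rewrite expr_div_n (sqr_sqrtr (ltW u0)); ring.
rewrite !E// -mulrBr -mulrBr normrM ger0_norm ?invr_ge0 ?exprn_ge0 ?(ltW su0)//.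
rewrite normrM (ger0_norm (expR_ge0 _)).
apply: (@le_trans _ _ (Num.sqrt u ^- n * (2 * `|tnth z j / Num.sqrt u - tnth z' j / Num.sqrt u|))).
  rewrite ler_wpM2l ?invr_ge0 ?exprn_ge0 ?(ltW su0)//.
  apply: le_trans (expNsqr_sub_le _ _); rewrite ler_piMl//.
  by rewrite -expR0 ler_expR oppr_le0 divr_ge0 ?(ltW u0).
rewrite -mulrBl normrM (@ger0_norm _ (Num.sqrt u)^-1) ?invr_ge0 ?(ltW su0)//.
by rewrite exprS invfM le_eqVlt; apply/orP; left; apply/eqP; ring.
Qed.

(** Convexity: on [0, 1] the power lies below its chord from 1 to 2^n. *)
Lemma exprD1_le n (x : R) : 0 <= x -> x <= 1 -> (1 + x) ^+ n <= 1 + 2 ^+ n * x.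
Proof.
move=> x0 x1; have h : (1 + x) ^+ n <= 1 + (2 ^+ n - 1) * x.
  elim: n => [|n IH]; first by rewrite !expr0; lra.
  rewrite exprS; apply: (@le_trans _ _ ((1 + x) * (1 + (2 ^+ n - 1) * x))).
    by rewrite ler_wpM2l// addr_ge0.
  have t1 : 1 <= 2 ^+ n :> R by rewrite exprn_ege1// ler1n.
  have : 0 <= (2 ^+ n - 1) * x * (1 - x) by rewrite !mulr_ge0// subr_ge0.
  by rewrite exprS; lra.
by apply: le_trans h _; lra.
Qed.

(** Increasing u by d changes the prefactor and the exponent by a relative amount d/u each; the
    weight |z|^2/(u + d) produced by the exponent is absorbed by doubling the parameter. With u =
    r^2 + d, the factor d/u is what makes the layers summable over r. *)
Lemma gaussRn_sub_time n (u d : R) (z : Rn R n) : 0 < d -> d <= u ->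
  `|gaussRn u z - gaussRn (u + d) z| <=
  (2 ^+ n + 2) * Num.sqrt 2 ^+ n * (d / u) * gaussRn (2 * (u + d)) z.
Proof.
move=> d0 du; have u0 : 0 < u by exact: lt_le_trans du.
have ud0 : 0 < u + d by rewrite addr_gt0.
have su0 : 0 < Num.sqrt u by rewrite sqrtr_gt0.
have sv0 : 0 < Num.sqrt (u + d) by rewrite sqrtr_gt0.
have x0 : 0 < d / u by rewrite divr_gt0.
have x1 : d / u <= 1 by rewrite ler_pdivrMr// mul1r.
have s0 := sqnorm_ge0 z.
pose e := expR (- (sqnorm z / (u + d) / 2)).
have -> : (2 ^+ n + 2) * Num.sqrt 2 ^+ n * (d / u) * gaussRn (2 * (u + d)) z =
    Num.sqrt (u + d) ^- n * (2 ^+ n * (d / u) * e) +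
    Num.sqrt (u + d) ^- n * ((d / u) * (2 * e)).
  have := gaussRn_double z ud0; rewrite -/e => h.
  transitivity ((2 ^+ n + 2) * (d / u) * (Num.sqrt 2 ^+ n * gaussRn (2 * (u + d)) z)); first by ring.
  by rewrite -h; ring.
have eu : expR (- (sqnorm z / u)) <= expR (- (sqnorm z / (u + d))).
  rewrite ler_expR lerN2 ler_wpM2l// lef_pV2 ?posrE//; lra.
have ee : expR (- (sqnorm z / (u + d))) <= e.
  rewrite ler_expR lerN2 ler_pdivrMr// ler_peMr ?divr_ge0 ?(ltW ud0)//; lra.
pose k := (Num.sqrt (u + d) / Num.sqrt u) ^+ n.
have kE : Num.sqrt u ^- n = Num.sqrt (u + d) ^- n * k.
  by rewrite /k expr_div_n mulrA mulVf ?mul1r// expf_neq0// gt_eqF.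
have ratio : 1 <= Num.sqrt (u + d) / Num.sqrt u <= 1 + d / u.
  have sE : (Num.sqrt (u + d) / Num.sqrt u) ^+ 2 = 1 + d / u.
    by rewrite expr_div_n !sqr_sqrtr ?(ltW u0) ?(ltW ud0)//; field; rewrite gt_eqF.
  have r1 : 1 <= Num.sqrt (u + d) / Num.sqrt u.
    by rewrite ler_pdivlMr// mul1r ler_sqrt ?(ltW ud0)//; lra.
  by rewrite r1 -sE expr2 ler_peMl ?(le_trans ler01).
have k1 : 1 <= k by rewrite exprn_ege1//; case/andP: ratio.
have k2 : k <= 1 + 2 ^+ n * (d / u).
  apply: le_trans (exprD1_le n (ltW x0) x1).
  have /andP[r1 r2] := ratio.
  by rewrite lerXn2r ?nnegrE// (le_trans ler01)//; lra.
have -> : gaussRn u z - gaussRn (u + d) z =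
    Num.sqrt (u + d) ^- n * ((k - 1) * expR (- (sqnorm z / u))) +
    Num.sqrt (u + d) ^- n * (expR (- (sqnorm z / u)) - expR (- (sqnorm z / (u + d)))).
  by rewrite /gaussRn kE; ring.
apply: le_trans (ler_normD _ _) _.
have v0 : 0 <= Num.sqrt (u + d) ^- n by rewrite invr_ge0 exprn_ge0// ltW.
rewrite !normrM !(ger0_norm v0) lerD// ler_wpM2l//.
  rewrite (ger0_norm (expR_ge0 _)) ger0_norm ?subr_ge0//.
  by rewrite ler_pM ?subr_ge0 ?expR_ge0 ?(le_trans eu ee)//; lra.
rewrite distrC ger0_norm ?subr_ge0//.
(* Since 1/u - 1/(u + d) = (d/u)/(u + d), the exponents differ by d/u times |z|^2/(u + d). *)
have -> : expR (- (sqnorm z / u)) = expR (- (sqnorm z / (u + d))) *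
    expR (- ((d / u) * (sqnorm z / (u + d)))).
  by rewrite -expRD; congr expR; field; rewrite !gt_eqF.
rewrite -{1}[expR (- (sqnorm z / (u + d)))]mulr1 -mulrBr.
apply: (@le_trans _ _ (expR (- (sqnorm z / (u + d))) * ((d / u) * (sqnorm z / (u + d))))).
  rewrite ler_wpM2l ?expR_ge0//.
  by have := expR_ge1Dx (- ((d / u) * (sqnorm z / (u + d)))); lra.
rewrite mulrCA ler_wpM2l ?(ltW x0)// mulrC.
exact: mul_expN_le.
Qed.

Definition shiftRn n (j : 'I_n) (t : R) : Rn R n -> Rn R n :=
  affineRn (fun=> 1) (fun i => if i == j then - t else 0).

Lemma tnth_shiftRn n (j : 'I_n) t z i :
  tnth (shiftRn j t z) i = if i == j then tnth z i - t else tnth z i.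
Proof. by rewrite tnth_affineRn mul1r; case: ifP; rewrite ?addr0. Qed.

Lemma shiftRn0 n (j : 'I_n) z : shiftRn j 0 z = z.
Proof.
by apply/eq_from_tnth => i; rewrite tnth_shiftRn subr0; case: ifP.
Qed.

Lemma shiftRn_subRn n (j : 'I_n) t x y :
  shiftRn j t (subRn x y) = subRn (shiftRn j t x) y.
Proof.
apply/eq_from_tnth => i; rewrite tnth_shiftRn !tnth_subRn tnth_shiftRn.
by case: ifP => // _; rewrite addrAC.
Qed.

Lemma measurable_shiftRn n (j : 'I_n) :
  measurable_fun setT (fun tz : mR * Rn R n => shiftRn j tz.1 tz.2).
Proof.
apply/measurable_fun_tnthP => i.
rewrite (_ : _ \o _ = fun tz => if i == j then tnth tz.2 i - tz.1 else tnth tz.2 i :> R); last first.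
  by apply/funext => tz; rewrite /= tnth_shiftRn.
case: (i == j); last by apply: (measurableT_comp (measurable_tnth _)).
by apply: measurable_funB => //; apply: (measurableT_comp (measurable_tnth _)).
Qed.

Lemma sqnorm_shiftRn n (j : 'I_n) t (z : Rn R n) :
  sqnorm (shiftRn j t z) = sqnorm z - 2 * t * tnth z j + t ^+ 2.
Proof.
rewrite !(sqnormD1 j) tnth_shiftRn eqxx.
rewrite (eq_bigr (fun i => tnth z i ^+ 2)); first by ring.
by move=> i ij; rewrite tnth_shiftRn (negbTE ij).
Qed.

Lemma integral_shiftRn n (j : 'I_n) t (f : Rn R n -> \bar R) : measurable_fun setT f ->
  (\int[lebesgueRn n]_z f (shiftRn j t z) = \int[lebesgueRn n]_z f z)%E.
Proof. by move=> mf; rewrite [RHS](integral_isoRn (a := fun=> 1) (fun i => if i == j then - t else 0) (fun=> normr1 _) mf). Qed.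

Lemma integral_expR_horner (p : {poly R}) :
  (\int[mu]_(t in `[0%R, 1%R]) ((p^`()).[t] * expR p.[t])%:E = (expR p.[1%R] - expR p.[0%R])%:E)%E.
Proof.
pose F (t : R) := expR p.[t].
have dF (t : R) : is_derive t 1 F ((p^`()).[t] * expR p.[t]).
  rewrite mulrC; exact: (@is_derive1_comp _ expR (horner p)).
have cF : continuous F.
  move=> t; apply: differentiable_continuous; apply/derivable1_diffP.
  by case: (dF t).
rewrite (@continuous_FTC2 _ _ F)// -?EFinB//.
- apply: continuous_subspaceT => t; apply: cvgM; first exact: continuous_horner.
  exact: cF.
- split=> //.
  + by apply: cvg_at_right_filter; exact: cF.
  + by apply: cvg_at_left_filter; exact: cF.
- by move=> t _; rewrite derive1E; apply: derive_val; exact: dF.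
Qed.

(** Along the segment the exponent is a quadratic polynomial in t with derivative 2 (x_j - t)/u, so
    the integrand is half the derivative of the Gaussian. *)
Lemma dgaussRn_shiftRn_integral n (j : 'I_n) (u : R) (x : Rn R n) : 0 < u ->
  (\int[mu]_(t in `[0%R, 1%R]) (dgaussRn j u (shiftRn j t x))%:E =
   ((gaussRn u (shiftRn j 1 x) - gaussRn u x) / 2)%:E)%E.
Proof.
move=> u0.
pose p : {poly R} := (- (sqnorm x / u))%:P + (2 * tnth x j / u) *: 'X + (- u^-1) *: 'X ^+ 2.
have pE t : p.[t] = - (sqnorm (shiftRn j t x) / u).
  rewrite sqnorm_shiftRn /p !(hornerD, hornerC, hornerZ, hornerX, hornerXn).
  by ring.
have dpE t : (p^`()).[t] = 2 * (tnth x j - t) / u.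
  rewrite /p !(derivD, derivC, derivZ, derivX, derivXn).
  rewrite !(hornerD, hornerC, hornerZ, hornerX, hornerXn, hornerMn); ring.
transitivity (\int[mu]_(t in `[0%R, 1%R])
    ((Num.sqrt u ^- n / 2)%:E * ((p^`()).[t] * expR p.[t])%:E))%E.
  apply: eq_integral => t _; rewrite -EFinM; congr EFin.
  rewrite pE dpE /dgaussRn /gaussRn tnth_shiftRn eqxx.
  have pn0 : Num.sqrt u ^+ n != 0 by rewrite expf_neq0// gt_eqF// sqrtr_gt0.
  by field; rewrite pn0 gt_eqF.
rewrite integralZl//; last first.
  apply: continuous_compact_integrable; first exact: segment_compact.
  apply: continuous_subspaceT => t; apply: cvgM; first exact: continuous_horner.
  by apply: continuous_comp; [exact: continuous_horner|exact: continuous_expR].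
rewrite integral_expR_horner -EFinM; congr EFin.
rewrite !pE shiftRn0 /gaussRn.
have pn0 : Num.sqrt u ^+ n != 0 by rewrite expf_neq0// gt_eqF// sqrtr_gt0.
by field.
Qed.
End GaussianEstimates.

(** * The extremal function and the norm of its Riesz transform *)

Section Superposition.
Set Implicit Arguments.
Unset Strict Implicit.
Context {R : realType} {n : nat} {dT : measure_display} {T : measurableType dT}.
Variable m : {sigma_finite_measure set T -> \bar R}.
Local Notation leb := (@lebesgueRn R n).
Variables (W : T -> Rn R n -> R) (P : T -> R).
Hypothesis mW : measurable_fun setT (fun wx : T * Rn R n => W wx.1 wx.2).
Hypothesis intP : m.-integrable setT (EFin \o P).
Hypothesis WP : forall w, (\int[leb]_x `|W w x|%:E <= (P w)%:E)%E.
Hypothesis intW : forall x, m.-integrable setT (fun w => (W w x)%:E).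

Definition superposition (x : Rn R n) : R := \int[m]_w W w x.

Lemma superpositionE x : (superposition x)%:E = (\int[m]_w (W w x)%:E)%E.
Proof. by rewrite fineK//; exact: integrable_fin_num (intW x). Qed.

Lemma integrable_superposition2 :
  (m \x leb)%E.-integrable setT (fun wx => (W wx.1 wx.2)%:E).
Proof.
apply/integrable12ltyP; first exact/measurable_EFinP.
apply: le_lt_trans (integrable_lty measurableT intP).
by apply: ge0_le_integralW => w; [exact: integral_ge0|exact: WP].
Qed.

Lemma integrable_superposition : leb.-integrable setT (EFin \o superposition).
Proof.
have i2 := integrable_superposition2.
have mF := measurable_int _ i2.
have -> : EFin \o superposition = fubini_G m (fun wx => (W wx.1 wx.2)%:E).
  by apply/funext => x; rewrite /= superpositionE.
apply/integrableP; split; first exact: (measurable_fubini_G i2).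
have := (@integrable21ltyP _ _ _ _ R m leb _ mF).1 i2; apply: le_lt_trans.
apply: ge0_le_integralW => x //.
by apply: le_abse_integral => //; exact: measurable_int (intW x).
Qed.

Lemma superposition_sub_le (B : T -> R) x x' : m.-integrable setT (EFin \o B) ->
  (forall w, `|W w x - W w x'| <= B w) ->
  (`|superposition x - superposition x'|%:E <= \int[m]_w (B w)%:E)%E.
Proof.
move=> intB WB; rewrite -abse_EFin EFinB !superpositionE -integralB//.
have mB : measurable_fun setT (fun w => (W w x)%:E - (W w x')%:E)%E.
  by apply: emeasurable_funB; exact: measurable_int (intW _).
apply: le_trans (le_abse_integral m measurableT mB) _.
apply: ge0_le_integralW => w //.
by rewrite -EFinB abse_EFin lee_fin.
Qed.

(** A bounded kernel and the slice bound [P] give absolute convergence on the product, since y -> x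
    - y preserves the L^1 norm of a slice. The integrability in [w] is kept in the conclusion
    because it is needed to write the planar integral as an iterated one. *)
Lemma superposition_convolution (K : Rn R n -> R) (C : R) x :
  measurable_fun setT K -> (forall y, `|K y| <= C) ->
  m.-integrable setT (fun w => \int[leb]_y (K y * W w (subRn x y))%:E)%E /\
  (\int[leb]_y (K y * superposition (subRn x y))%:E =
   \int[m]_w \int[leb]_y (K y * W w (subRn x y))%:E)%E.
Proof.
move=> mK KC.
have mWx w : measurable_fun setT (fun y => `|W w y|%:E).
  apply/measurable_EFinP; apply: measurableT_comp => //.
  exact: (measurableT_comp mW (pair1_measurable w)).
pose F (wy : T * Rn R n) := (K wy.2 * W wy.1 (subRn x wy.2))%:E.
have mF : measurable_fun setT F.
  apply/measurable_EFinP; apply: measurable_funM.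
    exact: (measurableT_comp mK measurable_snd).
  have mp : measurable_fun setT (fun wy : T * Rn R n => (wy.1, subRn x wy.2)).
    apply: measurable_fun_pair => //.
    exact: (measurableT_comp (measurable_subRnl x) measurable_snd).
  exact: (measurableT_comp mW mp).
have C0 : 0 <= C by apply: le_trans (normr_ge0 (K x)) (KC x).
have iF : (m \x leb)%E.-integrable setT F.
  apply/integrable12ltyP => //.
  apply: le_lt_trans (integrable_lty measurableT (integrableZl measurableT C intP)).
  apply: ge0_le_integralW => w; first exact: integral_ge0.
  apply: (@le_trans _ _ (\int[leb]_y (C%:E * `|W w (subRn x y)|%:E))%E).
    apply: ge0_le_integralW => y //.
    by rewrite -EFinM abse_EFin lee_fin normrM ler_wpM2r.
  rewrite ge0_integralZl//; last first.
    exact: (measurableT_comp (mWx w) (measurable_subRnl x)).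
  rewrite lee_wpmul2l ?lee_fin//; apply: le_trans (WP w).
  under eq_integral do rewrite subRn_affineRn.
  rewrite -(@integral_isoRn _ _ (fun=> -1) (tnth x) (fun z => `|W w z|%:E))//.
  by move=> i; rewrite normrN1.
split; first exact: (integrable_fubini_F iF).
rewrite -[RHS]/(\int[m]_w \int[leb]_y F (w, y))%E (Fubini iF).
apply: eq_integral => y _; rewrite EFinM superpositionE -integralZl//.
Qed.
End Superposition.

(** * Lebesgue measure on the plane of parameters *)

Section Plane.
Context {R : realType}.
Local Notation mR := (measurableTypeR R).
Local Notation mu := (@lebesgue_measure R).

Lemma sigma_finite_plane : sigma_finite [set: mR * mR] (mu \x mu)%E.
Proof.
have /sigma_finiteP[F [FT ndF Foo]] := sigma_finiteT mu.
exists (fun k => F k `*` F k).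
  apply/esym/seteqP; split => // -[x y] _.
  have [i _ Fi] : (\bigcup_k F k) x by rewrite -FT.
  have [k _ Fk] : (\bigcup_k F k) y by rewrite -FT.
  exists (maxn i k) => //; split.
  - by move: Fi; apply/subsetPset/ndF/leq_maxl.
  - by move: Fk; apply/subsetPset/ndF/leq_maxr.
move=> k; have [? ?] := Foo k; split; first exact: measurableX.
by rewrite product_measure1E// lte_mul_pinfty// ge0_fin_numE.
Qed.

(* No sigma-finite instance is inferred for the product [mu \x mu] itself. *)
Definition plane : {sigma_finite_measure set (mR * mR)%type -> \bar R} :=
  sigma_finite_of (@measure0 _ _ _ (mu \x mu)%E) (@measure_ge0 _ _ _ (mu \x mu)%E)
    (@measure_semi_sigma_additive _ _ _ (mu \x mu)%E) sigma_finite_plane.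

Lemma integral_planeE (f : mR * mR -> \bar R) :
  (\int[plane]_w f w = \int[(mu \x mu)%E]_w f w)%E.
Proof. by []. Qed.

Lemma ge0_integral_plane (f : mR * mR -> \bar R) :
  measurable_fun setT f -> (forall w, 0 <= f w)%E ->
  (\int[plane]_w f w = \int[mu]_r \int[mu]_t f (r, t))%E.
Proof. by move=> mf f0; rewrite integral_planeE fubini_tonelli1. Qed.

Lemma integral_plane (f : mR * mR -> \bar R) : plane.-integrable setT f ->
  (\int[plane]_w f w = \int[mu]_r \int[mu]_t f (r, t))%E.
Proof. by move=> intf; rewrite integral_planeE integral12_prod_meas1. Qed.
End Plane.

(** * The extremal function, its integrability and the L^1 norm of its Riesz transform *)

Section Example.
Set Implicit Arguments.
Unset Strict Implicit.
Context {R : realType} {n : nat}.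
Variables (j : 'I_n) (d : R).
Hypotheses (n0 : (0 < n)%N) (d0 : 0 < d) (d1 : d <= 1).
Local Notation mu := (@lebesgue_measure R).
Local Notation mR := (measurableTypeR R).
Local Notation mu2 := (@plane R).
Local Notation leb := (@lebesgueRn R n).
Local Notation Zn := (Num.sqrt pi ^+ n : R).

(** A weight in place of a restricted domain, so that the parameters range over the whole of [plane]
    and one sigma-finite measure serves both for (r, t) and for the two radial variables later. *)
Definition unit_window (t : R) : R := if 0 <= t <= 1 then 1 else 0.

(** The parameter [w] is the pair (r, t): [w.1] fixes the widths and [w.2] the centre t e_j. *)
Definition layer (w : mR * mR) (x : Rn R n) : R :=
  unit_window w.2 * (gaussRn (w.1 ^+ 2 + d) (shiftRn j w.2 x) -
                   gaussRn (w.1 ^+ 2 + 2 * d) (shiftRn j w.2 x)).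

Definition extremal : Rn R n -> R := superposition mu2 layer.

Let C1 : R := (2 ^+ n + 2) * Num.sqrt 2 ^+ n.

Let C10 : 0 <= C1. Proof. by rewrite mulr_ge0 ?addr_ge0 ?exprn_ge0 ?sqrtr_ge0. Qed.

Let o0 (r : R) : 0 < oneDsqr r.
Proof. by rewrite (lt_le_trans ltr01)// oneDsqr_ge1. Qed.

Let time_gt0 (r : R) (e : R) : 0 < e -> 0 < r ^+ 2 + e.
Proof. by move=> e0; rewrite ltr_wpDl// sqr_ge0. Qed.

Let d20 : 0 < 2 * d. Proof. by rewrite mulr_gt0. Qed.

Lemma unit_window_ge0 t : 0 <= unit_window t.
Proof. by rewrite /unit_window; case: ifP. Qed.
Hint Resolve unit_window_ge0 : core.

(** Clearing denominators leaves d r^2 <= r^2, where d <= 1 enters. It lets one integrable profile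
    1/(1 + r^2) dominate the layers. *)
Let time_ratio (r : R) : d / (r ^+ 2 + d) <= (oneDsqr r)^-1.
Proof.
rewrite ler_pdivrMr ?time_gt0// mulrC ler_pdivlMr// /oneDsqr.
have : d * r ^+ 2 <= r ^+ 2 by rewrite ler_piMl// sqr_ge0.
lra.
Qed.

Lemma layer_le w x : `|layer w x| <= unit_window w.2 * (C1 / oneDsqr w.1) *
  gaussRn (2 * (w.1 ^+ 2 + 2 * d)) (shiftRn j w.2 x).
Proof.
rewrite /layer normrM (ger0_norm (unit_window_ge0 _)) -mulrA ler_wpM2l//.
have -> : w.1 ^+ 2 + 2 * d = w.1 ^+ 2 + d + d by ring.
apply: le_trans (gaussRn_sub_time _ d0 _) _; first by rewrite lerDr sqr_ge0.
rewrite ler_wpM2r ?gaussRn_ge0// -/C1 ler_wpM2l//.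
Qed.

Lemma measurable_unit_window : measurable_fun setT unit_window.
Proof.
rewrite (_ : unit_window = \1_(`[0, 1]%classic)) ?measurable_indic//.
by apply/funext => t; rewrite indicE /unit_window mem_setE in_itv/=; case: ifP.
Qed.

Lemma measurable_gaussRn_comp d' (T : measurableType d') (u : T -> mR) (z : T -> Rn R n) :
  measurable_fun setT u -> measurable_fun setT z ->
  measurable_fun setT (fun t => gaussRn (u t) (z t)).
Proof.
move=> mu_ mz.
exact: (measurableT_comp (@measurable_gaussRn2 R n) (measurable_fun_pair mu_ mz)).
Qed.

Lemma measurable_shiftRn_comp d' (T : measurableType d') (u : T -> mR) (z : T -> Rn R n) :
  measurable_fun setT u -> measurable_fun setT z ->
  measurable_fun setT (fun t => shiftRn j (u t) (z t)).
Proof.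
move=> mu_ mz.
exact: (measurableT_comp (@measurable_shiftRn R n j) (measurable_fun_pair mu_ mz)).
Qed.

Lemma measurable_layer2 :
  measurable_fun setT (fun wx : (mR * mR) * Rn R n => layer wx.1 wx.2).
Proof.
have m11 : measurable_fun setT (fun wx : (mR * mR) * Rn R n => wx.1.1).
  exact: (measurableT_comp measurable_fst measurable_fst).
have m12 : measurable_fun setT (fun wx : (mR * mR) * Rn R n => wx.1.2).
  exact: (measurableT_comp measurable_snd measurable_fst).
have m2 : measurable_fun setT (fun wx : (mR * mR) * Rn R n => wx.2) by exact: measurable_snd.
apply: measurable_funM; first exact: (measurableT_comp measurable_unit_window).
apply: measurable_funB; apply: measurable_gaussRn_comp; try exact: measurable_shiftRn_comp.
- by apply: measurable_funD => //; exact: measurable_funX.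
- by apply: measurable_funD => //; exact: measurable_funX.
Qed.

Lemma measurable_layer1 x : measurable_fun setT (layer^~ x).
Proof. exact: (measurableT_comp measurable_layer2 (pair2_measurable x)). Qed.

Lemma integral_unit_window (phi : mR -> \bar R) :
  (\int[mu]_t ((unit_window t)%:E * phi t) = \int[mu]_(t in `[0%R, 1%R]) phi t)%E.
Proof.
rewrite [RHS]integral_mkcond; apply: eq_integral => t _.
rewrite patchE /unit_window mem_setE in_itv/=.
by case: ifP => _; rewrite ?mul1e ?mul0e.
Qed.

Lemma integral_profile (K : R) : 0 <= K ->
  (\int[mu2]_w (unit_window w.2 * (K / oneDsqr w.1))%:E = (K * pi)%:E)%E.
Proof.
move=> K0.
have mo : measurable_fun setT (fun r : R => K / oneDsqr r).
  by apply: measurable_funM => //; apply: continuous_measurable_fun; exact: continuous_oneDsqrV.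
rewrite ge0_integral_plane; last 2 first.
- apply/measurable_EFinP/measurable_funM.
    exact: (measurableT_comp measurable_unit_window).
  exact: (measurableT_comp mo).
- by move=> w; rewrite lee_fin mulr_ge0// divr_ge0// ltW.
transitivity (\int[mu]_r (K / oneDsqr r)%:E)%E.
  apply: eq_integral => r _ /=.
  under eq_integral do rewrite EFinM.
  rewrite (integral_unit_window (fun=> (K / oneDsqr r)%:E)) integral_cst//=.
  by rewrite lebesgue_measure_itv/= lte_fin ltr01 -EFinB subr0 mule1.
under eq_integral do rewrite EFinM.
rewrite ge0_integralZl//; first last.
- by apply/measurable_EFinP; apply: continuous_measurable_fun; exact: continuous_oneDsqrV.
by rewrite integral_oneDsqrV -EFinM.
Qed.

Lemma integrable_profile (K : R) : 0 <= K ->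
  mu2.-integrable setT (fun w => (unit_window w.2 * (K / oneDsqr w.1))%:E).
Proof.
move=> K0; apply/integrableP; split.
  apply/measurable_EFinP/measurable_funM.
    exact: (measurableT_comp measurable_unit_window).
  have mo : measurable_fun setT (fun r : R => K / oneDsqr r).
    by apply: measurable_funM => //; apply: continuous_measurable_fun; exact: continuous_oneDsqrV.
  exact: (measurableT_comp mo).
under eq_integral.
  move=> w _; rewrite abse_EFin ger0_norm; last by rewrite mulr_ge0// divr_ge0// ltW.
  over.
by rewrite integral_profile// ltry.
Qed.

Lemma layer_profile w :
  (\int[leb]_x `|layer w x|%:E <= (unit_window w.2 * (C1 * Zn / oneDsqr w.1))%:E)%E.
Proof.
pose u := 2 * (w.1 ^+ 2 + 2 * d); have u0 : 0 < u by rewrite mulr_gt0// time_gt0.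
apply: (@le_trans _ _ (\int[leb]_x ((unit_window w.2 * (C1 / oneDsqr w.1))%:E *
    (gaussRn u (shiftRn j w.2 x))%:E))%E).
  apply: ge0_le_integralW => x; first by [].
  by rewrite -EFinM lee_fin layer_le.
have k0 : 0 <= unit_window w.2 * (C1 / oneDsqr w.1).
  by rewrite mulr_ge0// divr_ge0// ltW.
have mg : measurable_fun setT (fun x : Rn R n => (gaussRn u x)%:E).
  by apply/measurable_EFinP; exact: measurable_gaussRn.
rewrite ge0_integralZl//; last 2 first.
- apply: (measurableT_comp mg); exact: measurable_affineRn.
- by move=> x _; rewrite lee_fin gaussRn_ge0.
rewrite (integral_shiftRn j w.2 mg) integral_gaussRn// -EFinM lee_fin.
by rewrite le_eqVlt; apply/orP; left; apply/eqP; ring.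
Qed.

Lemma integrable_layer1 x : mu2.-integrable setT (fun w => (layer w x)%:E).
Proof.
have K0 : 0 <= C1 * Num.sqrt (2 * (2 * d)) ^- n.
  by rewrite mulr_ge0// invr_ge0 exprn_ge0// sqrtr_ge0.
apply: (le_integrable measurableT) (integrable_profile K0).
  by apply/measurable_EFinP; exact: measurable_layer1.
move=> w _; rewrite !abse_EFin lee_fin.
apply: le_trans (ler_norm _); apply: le_trans (layer_le _ _) _.
have -> : unit_window w.2 * (C1 * Num.sqrt (2 * (2 * d)) ^- n / oneDsqr w.1) =
  unit_window w.2 * (C1 / oneDsqr w.1) * Num.sqrt (2 * (2 * d)) ^- n by ring.
rewrite ler_wpM2l//; first by rewrite mulr_ge0// divr_ge0// ltW.
have u0 : 0 < 2 * (w.1 ^+ 2 + 2 * d) by rewrite mulr_gt0// time_gt0.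
apply: le_trans (gaussRn_le _ u0) _.
rewrite lef_pV2 ?posrE ?exprn_gt0 ?sqrtr_gt0 ?mulr_gt0//.
rewrite lerXn2r ?nnegrE ?sqrtr_ge0// ler_sqrt ?(ltW u0)//.
by rewrite ler_pM2l// lerDr sqr_ge0.
exact: time_gt0.
Qed.

Lemma integrable_extremal : leb.-integrable setT (EFin \o extremal).
Proof.
have K0 : 0 <= C1 * Zn by rewrite mulr_ge0// exprn_ge0// sqrtr_ge0.
exact: (integrable_superposition measurable_layer2 (integrable_profile K0)
  layer_profile integrable_layer1).
Qed.

Let root_le (r : R) : Num.sqrt (r ^+ 2 + d) ^- n.+1 <= Num.sqrt d ^- n.+1 / oneDsqr r.
Proof.
have u0 := time_gt0 r d0.
(* As n >= 1, two of the n + 1 square roots combine to r^2 + d, which supplies the decay in r; the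
   remaining ones are bounded by their value at r = 0. *)
have [m mE] : exists m, n = m.+1 by exists n.-1; rewrite prednK.
rewrite mE -[m.+2]addn2 !exprD !sqr_sqrtr ?(ltW u0) ?(ltW d0)// !invfM -mulrA.
rewrite ler_pM ?invr_ge0 ?exprn_ge0 ?sqrtr_ge0 ?(ltW u0)//.
  rewrite lef_pV2 ?posrE ?exprn_gt0 ?sqrtr_gt0//.
  by rewrite lerXn2r ?nnegrE ?sqrtr_ge0// ler_sqrt ?(ltW u0)// lerDr sqr_ge0.
by rewrite mulrC ler_pdivlMr// mulrC time_ratio.
Qed.

(* The bound that lets the odd kernel be integrated up to its singularity. *)
Lemma extremal_flip_le x y : `|extremal (subRn x y) - extremal (subRn x (flip j y))| <=
  8 * Num.sqrt d ^- n.+1 * pi * `|tnth y j|.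
Proof.
set z := subRn x y; set z' := subRn x (flip j y).
have zz' i : i != j -> tnth z i = tnth z' i.
  by move=> ij; rewrite !tnth_subRn tnth_flip (negbTE ij).
have zj : `|tnth z j - tnth z' j| = 2 * `|tnth y j|.
  rewrite !tnth_subRn tnth_flip eqxx -normrN -[2 in RHS]ger0_norm// -normrM.
  by congr `|_|; ring.
have K0 : 0 <= 8 * Num.sqrt d ^- n.+1 * `|tnth y j|.
  by rewrite !mulr_ge0 ?invr_ge0 ?exprn_ge0 ?sqrtr_ge0.
pose B (w : mR * mR) : R := unit_window w.2 * (8 * Num.sqrt d ^- n.+1 * `|tnth y j| / oneDsqr w.1).
have -> : 8 * Num.sqrt d ^- n.+1 * pi * `|tnth y j| =
   fine (\int[mu2]_w (B w)%:E)%E.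
  by rewrite integral_profile//=; ring.
have iB : mu2.-integrable setT (EFin \o B) := integrable_profile K0.
rewrite -lee_fin fineK; last exact: integrable_fin_num iB.
apply: (superposition_sub_le integrable_layer1 iB) => w.
rewrite /layer -mulrBr normrM (ger0_norm (unit_window_ge0 _)).
rewrite ler_wpM2l//.
have sz i : i != j -> tnth (shiftRn j w.2 z) i = tnth (shiftRn j w.2 z') i.
  by move=> ij; rewrite !tnth_shiftRn (negbTE ij) zz'.
have szj : `|tnth (shiftRn j w.2 z) j - tnth (shiftRn j w.2 z') j| = 2 * `|tnth y j|.
  by rewrite !tnth_shiftRn eqxx -zj; congr `|_|; ring.
have h1 := gaussRn_sub_le (time_gt0 w.1 d0) sz.
have h2 := gaussRn_sub_le (time_gt0 w.1 d20) sz.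
have h3 : Num.sqrt (w.1 ^+ 2 + 2 * d) ^- n.+1 <= Num.sqrt (w.1 ^+ 2 + d) ^- n.+1.
  rewrite lef_pV2 ?posrE ?exprn_gt0 ?sqrtr_gt0 ?time_gt0//.
  rewrite lerXn2r ?nnegrE ?sqrtr_ge0// ler_sqrt ?ltW ?time_gt0//.
  by move: d0; lra.
rewrite szj in h1 h2.
set g1 := gaussRn _ (shiftRn j w.2 z) in h1 *.
set g2 := gaussRn (_ + 2 * d) (shiftRn j w.2 z) in h2 *.
set g1' := gaussRn _ (shiftRn j w.2 z') in h1 *.
set g2' := gaussRn (_ + 2 * d) (shiftRn j w.2 z') in h2 *.
have -> : g1 - g2 - (g1' - g2') = (g1 - g1') - (g2 - g2') by ring.
apply: le_trans (ler_normB _ _) _.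
have h4 : 2 * Num.sqrt (w.1 ^+ 2 + 2 * d) ^- n.+1 * (2 * `|tnth y j|) <=
    2 * Num.sqrt (w.1 ^+ 2 + d) ^- n.+1 * (2 * `|tnth y j|).
  by rewrite ler_wpM2r ?mulr_ge0// ler_wpM2l.
have h5 : 2 * Num.sqrt (w.1 ^+ 2 + d) ^- n.+1 * (2 * `|tnth y j|) <=
    2 * (Num.sqrt d ^- n.+1 / oneDsqr w.1) * (2 * `|tnth y j|).
  by rewrite ler_wpM2r ?mulr_ge0// ler_wpM2l// root_le.
(* The 8 is 2 Gaussians times the Lipschitz factor 2 times the displacement 2 |y_j|. *)
have -> : 8 * Num.sqrt d ^- n.+1 * `|tnth y j| / oneDsqr w.1 =
  2 * (2 * (Num.sqrt d ^- n.+1 / oneDsqr w.1) * (2 * `|tnth y j|)) by ring.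
by move: (le_trans h2 h4) h1 h5; lra.
Qed.

Lemma integral_dgaussRn_layer (rho : R) w x : rho != 0 ->
  (\int[leb]_y (dgaussRn j (rho ^+ 2) y * layer w (subRn x y))%:E =
   (unit_window w.2)%:E * (Zn * dgaussRn j (rho ^+ 2 + (w.1 ^+ 2 + d)) (shiftRn j w.2 x) -
    Zn * dgaussRn j (rho ^+ 2 + (w.1 ^+ 2 + 2 * d)) (shiftRn j w.2 x))%:E)%E.
Proof.
move=> rho0; have u0 : 0 < rho ^+ 2 by rewrite exprn_even_gt0.
have [i1 e1] := dgaussRn_convolution j (shiftRn j w.2 x) u0 (time_gt0 w.1 d0).
have [i2 e2] := dgaussRn_convolution j (shiftRn j w.2 x) u0 (time_gt0 w.1 d20).
rewrite EFinB -e1 -e2 -integralB// -integralZl//; last exact: integrableB.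
apply: eq_integral => y _.
by rewrite -EFinB -EFinM /layer !shiftRn_subRn; congr EFin; ring.
Qed.

(* [\int_0^1 dgaussRn j u (x - t e_j) dt], see [dgaussRn_shiftRn_integral] *)
Definition bump (u : R) (x : Rn R n) : R := (gaussRn u (shiftRn j 1 x) - gaussRn u x) / 2.

Lemma measurable_dgaussRn_shiftRn u x :
  measurable_fun setT (fun t : mR => dgaussRn j u (shiftRn j t x)).
Proof.
apply: (measurableT_comp (@measurable_dgaussRn R n j u)).
exact: (measurable_shiftRn_comp (@measurable_id _ _ _) (@measurable_cst _ _ _ _ _ x)).
Qed.

Lemma integrable_dgaussRn_shiftRn u x : 0 < u ->
  mu.-integrable `[0%R, 1%R] (fun t => (dgaussRn j u (shiftRn j t x))%:E).
Proof.
move=> u0; have oo : (mu `[0%R, 1%R]%classic < +oo)%E.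
  by rewrite lebesgue_measure_itv/= lte_fin ltr01 -EFinB ltry.
apply: measurable_bounded_integrable => //.
- by apply: measurable_funTS; exact: measurable_dgaussRn_shiftRn.
- exists (Num.sqrt u ^- n.+1); split; first exact: num_real.
  move=> M /ltW hM t _ /=; apply: le_trans hM.
  exact: normr_dgaussRn_le.
Qed.

Lemma extremal_convolution (rho : R) x : rho != 0 ->
  (\int[leb]_y (dgaussRn j (rho ^+ 2) y * extremal (subRn x y))%:E =
   \int[mu]_r (Zn * (bump (rho ^+ 2 + (r ^+ 2 + d)) x -
                     bump (rho ^+ 2 + (r ^+ 2 + 2 * d)) x))%:E)%E.
Proof.
move=> rho0; have u0 : 0 < rho ^+ 2 by rewrite exprn_even_gt0.
have K0 : 0 <= C1 * Zn by rewrite mulr_ge0// exprn_ge0// sqrtr_ge0.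
have [iw ->] := superposition_convolution measurable_layer2 (integrable_profile K0)
  layer_profile integrable_layer1 x (@measurable_dgaussRn R n j (rho ^+ 2))
  (fun y => normr_dgaussRn_le j y u0).
rewrite (integral_plane iw); apply: eq_integral => r _.
under eq_integral do rewrite integral_dgaussRn_layer//=.
rewrite integral_unit_window.
have v0 := addr_gt0 u0 (time_gt0 r d0); have v20 := addr_gt0 u0 (time_gt0 r d20).
under eq_integral do rewrite EFinB !EFinM.
have i1 := integrable_dgaussRn_shiftRn x v0.
have i2 := integrable_dgaussRn_shiftRn x v20.
rewrite integralB//; [|exact: integrableZl..].
rewrite !integralZl// !dgaussRn_shiftRn_integral// -!EFinM -EFinB.
by congr EFin; rewrite /bump; ring.
Qed.

(** The power v^(-3/2). It is the decay in u of [bump u x] for n = 1, the slowest case, and it is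
    integrable over the plane when v = 1 + |w|^2. *)
Definition powN32 (v : R) : R := (v * Num.sqrt v)^-1.

Lemma powN32_ge0 v : 0 <= v -> 0 <= powN32 v.
Proof. by move=> v0; rewrite invr_ge0 mulr_ge0 ?sqrtr_ge0. Qed.

Lemma powN32M v w : 0 <= v -> powN32 (v * w) = powN32 v * powN32 w.
Proof. by move=> v0; rewrite /powN32 sqrtrM// -invfM; congr (_^-1); ring. Qed.

Lemma measurable_powN32 : measurable_fun setT powN32.
Proof.
apply: (measurableT_comp measurable_inv); apply: measurable_funM => //.
exact: measurable_sqrt.
Qed.

Lemma powN32_oneDsqr_le s : powN32 (oneDsqr s) <= (oneDsqr s)^-1.
Proof.
rewrite /powN32 invfM ler_piMr ?invr_ge0 ?(ltW (o0 s))//.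
rewrite invf_le1 ?sqrtr_gt0// -sqrtr1 ler_sqrt ?(ltW (o0 s))//.
Qed.

(** The substitution s -> sqrt(1 + r^2) s factors 1 + r^2 + s^2 into (1 + r^2)(1 + s^2), and the
    inner integral is then at most pi/(1 + r^2). *)
Lemma integral_powN32_lty : (\int[mu2]_w (powN32 (1 + sqnorm2 w))%:E < +oo)%E.
Proof.
have s0 w : 0 <= 1 + sqnorm2 w :> R by rewrite !addr_ge0// sqr_ge0.
rewrite ge0_integral_plane; last 2 first.
- apply/measurable_EFinP; apply: (measurableT_comp measurable_powN32).
  by apply: measurable_funD => //; exact: measurable_sqnorm2.
- by move=> w; rewrite lee_fin powN32_ge0.
apply: (@le_lt_trans _ _ (\int[mu]_r (pi / oneDsqr r)%:E)%E); last first.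
  exact: integrable_lty (integrable_oneDsqrV pi).
apply: ge0_le_integralW => r.
  by apply: integral_ge0 => s _; rewrite lee_fin powN32_ge0.
have sA : 0 < Num.sqrt (oneDsqr r) by rewrite sqrtr_gt0.
rewrite (@ge0_integral_affine _ (Num.sqrt (oneDsqr r)) 0); last 3 first.
- by rewrite gt_eqF.
- apply/measurable_EFinP; apply: (measurableT_comp measurable_powN32).
  apply: measurable_funD => //; apply: (measurableT_comp measurable_sqnorm2).
  exact: pair1_measurable.
- by move=> s; rewrite lee_fin powN32_ge0.
rewrite (gtr0_norm sA).
apply: (@le_trans _ _ ((Num.sqrt (oneDsqr r))%:E *
    \int[mu]_s (powN32 (oneDsqr r) / oneDsqr s)%:E)%E).
  rewrite lee_wpmul2l ?lee_fin ?(ltW sA)//.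
  apply: ge0_le_integralW => s; rewrite lee_fin ?powN32_ge0//.
  have -> : 1 + sqnorm2 (r, affine (Num.sqrt (oneDsqr r)) 0 s) = oneDsqr r * oneDsqr s.
    rewrite /sqnorm2/= /affine addr0 exprMn sqr_sqrtr ?(ltW (o0 r))//.
    by rewrite /oneDsqr; ring.
  rewrite powN32M ?(ltW (o0 r))// ler_wpM2l ?powN32_ge0 ?(ltW (o0 r))//.
  exact: powN32_oneDsqr_le.
under eq_integral do rewrite EFinM.
rewrite ge0_integralZl//; last 2 first.
- by apply/measurable_EFinP; apply: continuous_measurable_fun; exact: continuous_oneDsqrV.
- by rewrite lee_fin powN32_ge0// (ltW (o0 r)).
rewrite integral_oneDsqrV -!EFinM lee_fin le_eqVlt; apply/orP; left; apply/eqP.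
by rewrite /powN32; field; rewrite !gt_eqF.
Qed.

Lemma measurable_bump x : measurable_fun setT (fun u : mR => bump u x).
Proof.
apply: measurable_funM => //; apply: measurable_funB;
  by apply: measurable_gaussRn_comp => //; exact: measurable_cst.
Qed.

(** Both Gaussians have the same prefactor, so the difference gains 1/u times a difference of
    squared norms that is independent of u. Without this gain the planar integral would diverge in
    low dimension. *)
Lemma bump_le u x : 0 < u ->
  `|bump u x| <= Num.sqrt u ^- n / u * `|sqnorm (shiftRn j 1 x) - sqnorm x|.
Proof.
move=> u0; rewrite /bump /gaussRn -mulrBr normrM normrM.
rewrite (ger0_norm (_ : 0 <= Num.sqrt u ^- n)); last first.
  by rewrite invr_ge0 exprn_ge0// sqrtr_ge0.
rewrite -mulrA -[leRHS]mulrA ler_wpM2l ?invr_ge0 ?exprn_ge0 ?sqrtr_ge0//.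
rewrite (@ger0_norm _ 2^-1)//.
have h := @expN_sub_le R (sqnorm (shiftRn j 1 x) / u) (sqnorm x / u) _ _.
have {}h := h (divr_ge0 (sqnorm_ge0 _) (ltW u0)) (divr_ge0 (sqnorm_ge0 _) (ltW u0)).
apply: (@le_trans _ _ `|sqnorm (shiftRn j 1 x) / u - sqnorm x / u|).
  by apply: le_trans h; rewrite ler_piMr//; lra.
by rewrite -mulrBl normrM mulrC (@ger0_norm _ u^-1)// invr_ge0 ltW.
Qed.

Lemma integrable_bump e x : d <= e ->
  mu2.-integrable setT (fun w => (bump (sqnorm2 w + e) x)%:E).
Proof.
move=> de.
have s0 w : 0 <= sqnorm2 w :> R by rewrite !addr_ge0// sqr_ge0.
pose B : R := Num.sqrt d ^- n.-1 * powN32 d * `|sqnorm (shiftRn j 1 x) - sqnorm x|.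
have ms : measurable_fun setT (@sqnorm2 R) := @measurable_sqnorm2 R.
have ipow : mu2.-integrable setT (fun w => (powN32 (1 + sqnorm2 w))%:E).
  apply/integrableP; split.
    apply/measurable_EFinP; apply: (measurableT_comp measurable_powN32).
    exact: measurable_funD.
  under eq_integral.
    move=> w _; rewrite abse_EFin ger0_norm; last by rewrite powN32_ge0// addr_ge0.
    over.
  exact: integral_powN32_lty.
apply: (le_integrable measurableT) (integrableZl measurableT B ipow).
  apply/measurable_EFinP; apply: (measurableT_comp (measurable_bump x)).
  exact: measurable_funD.
move=> w _; rewrite -EFinM !abse_EFin lee_fin; apply: le_trans (ler_norm _).
have u0 : 0 < sqnorm2 w + e by rewrite ltr_wpDl// (lt_le_trans d0).
apply: le_trans (bump_le x u0) _.
rewrite /B [leRHS]mulrAC ler_wpM2r//.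
(* As d <= 1 and d <= e, this lies between d and |w|^2 + e. Of u^(-n/2-1), the n - 1 spare square
   roots are estimated by d, and the remaining u^(-3/2) by v^(-3/2), which splits into a constant
   times the integrable profile. *)
pose v := d * (1 + sqnorm2 w).
have dv : d <= v by rewrite /v ler_peMr ?(ltW d0)// lerDl.
have v0 : 0 < v := lt_le_trans d0 dv.
have vu : v <= sqnorm2 w + e.
  rewrite /v mulrDr mulr1 addrC lerD//.
  by rewrite ler_piMl.
rewrite -mulrA -powN32M ?(ltW d0)// -/v.
have nE : n = n.-1.+1 by rewrite prednK.
rewrite {1}nE exprS invfM mulrAC -invfM mulrC.
rewrite (mulrC (Num.sqrt _) (_ + _)) -/(powN32 _).
have sq (a b : R) : 0 < a -> a <= b -> 0 < Num.sqrt a <= Num.sqrt b.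
  by move=> a0 ab; rewrite sqrtr_gt0 a0 ler_sqrt// (le_trans (ltW a0)).
rewrite ler_pM ?powN32_ge0 ?invr_ge0 ?exprn_ge0 ?sqrtr_ge0 ?(ltW u0)//.
  have /andP[h1 h2] := sq _ _ d0 (le_trans dv vu).
  rewrite lef_pV2 ?posrE ?exprn_gt0//; last exact: lt_le_trans h2.
  by rewrite lerXn2r ?nnegrE ?sqrtr_ge0.
have /andP[h1 h2] := sq _ _ v0 vu.
have h3 := lt_le_trans h1 h2.
rewrite lef_pV2 ?posrE ?mulr_gt0//.
by rewrite ler_pM ?sqrtr_ge0 ?(ltW v0)//.
by rewrite ltr_pwDl.
Qed.

Lemma integral_bump_polar e x :
  (\int[mu2]_w `|bump (sqnorm2 w + e) x|%:E =
   (@disc_area R)%:E * \int[mu]_(u in `[e, +oo[) `|bump u x|%:E)%E.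
Proof.
have mb : measurable_fun setT (fun u : mR => `|bump u x|%:E).
  by apply/measurable_EFinP; apply: measurableT_comp => //; exact: measurable_bump.
rewrite integral_planeE.
have mbe : measurable_fun setT (fun u : mR => `|bump (u + e) x|%:E).
  by apply: (measurableT_comp mb); exact: measurable_funD.
rewrite (ge0_integral_polar mbe (fun u => normr_ge0 _)).
congr (_ * _)%E; rewrite integral_mkcond [in RHS]integral_mkcond.
rewrite [RHS](@ge0_integral_affine _ 1 e)//; last 2 first.
- apply/(measurable_restrictT _ _).1 => //; exact: measurable_funTS.
- by move=> u; rewrite patchE; case: ifP.
rewrite normr1 mul1e; apply: eq_integral => u _.
rewrite !patchE /affine mul1r !mem_setE !in_itv/= !andbT.
by rewrite -{2}[e]add0r lerD2r.
Qed.

(* The sign of [bump u x] does not depend on [u], so that the absolute value of the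
   telescoping integral is the integral of absolute values. *)
Lemma bump_sign x : exists2 s : R, `|s| = 1 & forall u, 0 < u -> bump u x = s * `|bump u x|.
Proof.
have [h|h] := leP (sqnorm (shiftRn j 1 x)) (sqnorm x).
  exists 1; rewrite ?normr1// => u u0; rewrite mul1r ger0_norm// /bump divr_ge0// subr_ge0.
  rewrite /gaussRn ler_wpM2l ?invr_ge0 ?exprn_ge0 ?sqrtr_ge0//.
  by rewrite ler_expR lerN2 ler_pM2r ?invr_gt0.
exists (-1); rewrite ?normrN1// => u u0; rewrite mulN1r ler0_norm ?opprK//.
rewrite /bump pmulr_lle0 ?invr_gt0// subr_le0.
rewrite /gaussRn ler_wpM2l ?invr_ge0 ?exprn_ge0 ?sqrtr_ge0//.
by rewrite ler_expR lerN2 ler_pM2r ?invr_gt0// ltW.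
Qed.

Let c0 : R := (radial_mass n)^-1 * Zn * @disc_area R.

Let c00 : 0 <= c0.
Proof.
rewrite !mulr_ge0 ?exprn_ge0 ?sqrtr_ge0 ?invr_ge0 ?(ltW (radial_mass_gt0 _))//.
exact: ltW disc_area_gt0.
Qed.

(** Read backwards, polar coordinates transfer the integrability on the plane to the half-line. *)
Lemma tail_lty e x : d <= e -> (\int[mu]_(u in `[e, +oo[) `|bump u x|%:E < +oo)%E.
Proof.
move=> de; have := integrable_lty measurableT (integrable_abse (integrable_bump x de)).
rewrite -[X in (X < _)%E]/(\int[mu2]_w `|bump (sqnorm2 w + e) x|%:E)%E.
rewrite integral_bump_polar; have [//|] := ltP (\int[mu]_(u in `[e, +oo[) `|bump u x|%:E)%E +oo%E.
by rewrite leye_eq => /eqP ->; rewrite gt0_muley// lte_fin disc_area_gt0.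
Qed.

Lemma measurable_bump_abs x : measurable_fun setT (fun u : mR => `|bump u x|%:E).
Proof.
by apply/measurable_EFinP; apply: measurableT_comp => //; exact: measurable_bump.
Qed.

Lemma tail_split x :
  (\int[mu]_(u in `[d, +oo[) `|bump u x|%:E =
   \int[mu]_(u in `[d, (2 * d)%R[) `|bump u x|%:E +
   \int[mu]_(u in `[(2 * d)%R, +oo[) `|bump u x|%:E)%E.
Proof.
have d2d : d <= 2 * d by move: d0; lra.
rewrite -ge0_integral_setU//=.
- congr (integral _ _ _); apply/seteqP; split => u /=; rewrite !in_itv/= !andbT.
    by move=> du; case: (ltP u (2 * d)) => h; [left; rewrite du|right].
  by move=> [/andP[]|/(le_trans d2d)].
- by apply: measurable_funTS; exact: measurable_bump_abs.
- apply/disj_setPS => u [] /=; rewrite !in_itv/= andbT => /andP[_ h1] h2.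
  by move: h1; rewrite ltNge h2.
Qed.

Lemma integral_bump e x s : d <= e -> (forall u, 0 < u -> bump u x = s * `|bump u x|) ->
  (\int[mu2]_w (bump (sqnorm2 w + e) x)%:E =
   s%:E * ((@disc_area R)%:E * \int[mu]_(u in `[e, +oo[) `|bump u x|%:E))%E.
Proof.
move=> de hs; rewrite -integral_bump_polar -integralZl//; last first.
  exact: (integrable_abse (integrable_bump x de)).
apply: eq_integral => w _; rewrite -EFinM; congr EFin; apply: hs.
by rewrite ltr_wpDl ?addr_ge0 ?sqr_ge0// (lt_le_trans d0).
Qed.

Lemma normr_riesz_extremal x : 
  (`|riesz j extremal x|%:E = c0%:E * \int[mu]_(u in `[d, (2 * d)%R[) `|bump u x|%:E)%E.
Proof.
have d2d : d <= 2 * d by move: d0; lra.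
have L0 : 0 <= 8 * Num.sqrt d ^- n.+1 * pi :> R.
  by rewrite !mulr_ge0 ?invr_ge0 ?exprn_ge0 ?sqrtr_ge0 ?pi_ge0.
have cvgR := riesz_truncation_cvg integrable_extremal L0 (extremal_flip_le x) n0.
have i1 := integrable_bump x (lexx d); have i2 := integrable_bump x d2d.
have i12 := integrableB measurableT i1 i2.
have m12 := measurable_int _ i12.
pose F (rho r : R) := Zn * (bump (rho ^+ 2 + (r ^+ 2 + d)) x - bump (rho ^+ 2 + (r ^+ 2 + 2 * d)) x).
have FE w : (F w.1 w.2)%:E = (Zn%:E * ((bump (sqnorm2 w + d) x)%:E -
    (bump (sqnorm2 w + 2 * d) x)%:E))%E.
  by rewrite -EFinB -EFinM /F /sqnorm2/= !addrA.
have iF : mu2.-integrable setT (fun w => (F w.1 w.2)%:E).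
  by apply: eq_integrable (integrableZl measurableT Zn i12) => // w _ /=; rewrite FE.
have [s s1 hs] := bump_sign x.
pose I0 := (\int[mu]_(u in `[d, (2 * d)%R[) `|bump u x|%:E)%E.
have [I fI] : exists I, I0 = I%:E.
  exists (fine I0); rewrite fineK// ge0_fin_numE; last exact: integral_ge0.
  apply: le_lt_trans (tail_lty x (lexx d)); rewrite tail_split leeDl//.
  exact: integral_ge0.
(* The tail beyond 2d is common to both Gaussians; its finiteness is what permits cancelling it in
   the extended reals. *)
have [T fT] : exists T, (\int[mu]_(u in `[(2 * d)%R, +oo[) `|bump u x|%:E)%E = T%:E.
  eexists; apply/esym/fineK; rewrite ge0_fin_numE; last exact: integral_ge0.
  exact: tail_lty d2d.
have intF : (\int[mu2]_w (F w.1 w.2)%:E = (Zn * (s * (@disc_area R * I)))%:E)%E.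
  under eq_integral do rewrite FE.
  rewrite integralZl// integralB// !(integral_bump _ hs)// tail_split -/I0 fI fT.
  by rewrite -EFinD -!EFinM -?EFinB -?EFinM; congr EFin; ring.
pose Gx (rho : R) := (\int[leb]_y (dgaussRn j (rho ^+ 2) y * extremal (subRn x y))%:E)%E.
(* The convolution formula is available for rho != 0 only; at 0 the kernel is 0 by convention, and a
   single point does not affect the integral over rho. *)
have GxE : Gx = fun rho => if rho == 0%R then 0%E else (\int[mu]_r (F rho r)%:E)%E.
  apply/funext => rho; rewrite /Gx; case: ifPn => [/eqP ->|rho0]; last exact: extremal_convolution.
  under eq_integral do rewrite expr0n/= /dgaussRn invr0 mulr0 !mul0r.
  exact: integral0.
have mF : measurable_fun setT (fun rho : mR => \int[mu]_r (F rho r)%:E)%E.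
  exact: (@measurable_fubini_F _ _ _ _ _ mu mu _ iF).
have intG : (\int[mu]_rho Gx rho = (Zn * (s * (@disc_area R * I)))%:E)%E.
  rewrite -intF (integral_plane iF); apply: ae_eq_integral => //.
    rewrite GxE; apply: measurable_fun_ifT => //.
    exact: measurable_fun_eqr.
  exists [set 0%R]; split => //; first exact: lebesgue_measure_set1.
  move=> rho /= h; apply: contrapT => /eqP rho0; apply: h => _.
  by rewrite GxE (negbTE rho0).
have -> : riesz j extremal x = (radial_mass n)^-1 * (Zn * (s * (@disc_area R * I))).
  by rewrite /riesz (cvg_lim _ cvgR)// -/Gx intG.
rewrite -/I0 fI -EFinM; congr EFin.
have I0' : 0 <= I by rewrite -lee_fin -fI; exact: integral_ge0.
rewrite !normrM s1 mul1r (ger0_norm I0') (ger0_norm (ltW (@disc_area_gt0 R))).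
rewrite (ger0_norm (_ : 0 <= Zn)) ?exprn_ge0 ?sqrtr_ge0//.
rewrite (ger0_norm (_ : 0 <= (radial_mass n)^-1)) ?invr_ge0 ?(ltW (radial_mass_gt0 _))//.
by rewrite /c0; ring.
Qed.

Lemma measurable_bump2 : measurable_fun setT (fun ux : mR * Rn R n => bump ux.1 ux.2).
Proof.
apply: measurable_funM => //; apply: measurable_funB; apply: measurable_gaussRn_comp => //.
exact: (measurableT_comp (@measurable_affineRn R n _ _) measurable_snd).
Qed.

(** The triangle inequality suffices: all smallness of the final bound comes from the length d of
    the window of u. *)
Lemma integral_normr_bump u : 0 < u -> (\int[leb]_x `|bump u x|%:E <= Zn%:E)%E.
Proof.
move=> u0.
have mg : measurable_fun setT (fun x : Rn R n => (gaussRn u x)%:E).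
  by apply/measurable_EFinP; exact: measurable_gaussRn.
have mgs : measurable_fun setT (fun x : Rn R n => (gaussRn u (shiftRn j 1 x))%:E).
  by apply: (measurableT_comp mg); exact: measurable_affineRn.
apply: (@le_trans _ _ (\int[leb]_x ((2^-1)%:E * ((gaussRn u (shiftRn j 1 x))%:E + (gaussRn u x)%:E)))%E).
  apply: ge0_le_integralW => x //.
  rewrite -EFinD -EFinM lee_fin /bump normrM (@ger0_norm _ 2^-1)// mulrC ler_wpM2l//.
  by apply: le_trans (ler_normB _ _) _; rewrite !ger0_norm ?gaussRn_ge0.
rewrite ge0_integralZl//; last 2 first.
- exact: emeasurable_funD.
- by move=> x _; rewrite -EFinD lee_fin addr_ge0 ?gaussRn_ge0.
rewrite ge0_integralD//; last 2 first.
- by move=> x _; rewrite lee_fin gaussRn_ge0.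
- by move=> x _; rewrite lee_fin gaussRn_ge0.
rewrite (integral_shiftRn j 1 mg) integral_gaussRn// -EFinD -EFinM lee_fin.
by rewrite le_eqVlt; apply/orP; left; apply/eqP; field.
Qed.

Lemma Lnorm_riesz_extremal :
  ('N[leb]_1[EFin \o riesz j extremal] <= (c0 * Zn * d)%:E)%E.
Proof.
have d2d : d <= 2 * d by move: d0; lra.
have Zn0 : 0 <= Zn by rewrite exprn_ge0// sqrtr_ge0.
rewrite Lnorm1.
pose D : set mR := `[d, (2 * d)%R[%classic.
pose H (ux : mR * Rn R n) : \bar R := (\1_D ux.1 * `|bump ux.1 ux.2|)%:E.
have mD : measurable D by exact: measurable_itv.
have mD1 : measurable_fun setT (\1_D : mR -> mR) by apply: measurable_indic; exact: mD.
have mH : measurable_fun setT H.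
  apply/measurable_EFinP; apply: measurable_funM.
    exact: (measurableT_comp mD1 measurable_fst).
  by apply: measurableT_comp => //; exact: measurable_bump2.
have H0 ux : (0 <= H ux)%E by rewrite lee_fin mulr_ge0.
have HE x : (\int[mu]_(u in `[d, (2 * d)%R[) `|bump u x|%:E = \int[mu]_u H (u, x))%E.
  rewrite integral_mkcond; apply: eq_integral => u _.
  by rewrite patchE /H/= indicE -/D; case: ifP => _; rewrite ?mul1r ?mul0r.
under eq_integral do rewrite /= normr_riesz_extremal HE.
rewrite ge0_integralZl//; last 2 first.
- exact: (measurable_fun_fubini_tonelli_G H).
- by move=> x _; exact: integral_ge0.
rewrite -(mulrA c0) (EFinM c0) lee_wpmul2l ?lee_fin//.
rewrite -(fubini_tonelli H)//.
apply: (@le_trans _ _ (\int[mu]_u (\1_D u * Zn)%:E)%E).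
  apply: ge0_le_integralW => u; first exact: integral_ge0.
  rewrite /H/= indicE; have [uD|uD] := boolP (u \in D); last first.
    by under eq_integral do rewrite mul0r; rewrite integral0 mul0r.
  under eq_integral do rewrite mul1r.
  rewrite mul1r; apply: integral_normr_bump.
  by move: uD; rewrite /D mem_setE in_itv/= => /andP[/(lt_le_trans d0)].
under eq_integral do rewrite mulrC EFinM.
rewrite ge0_integralZl//; last first.
  by apply/measurable_EFinP; exact: measurable_indic.
have muD : mu `[d, (2 * d)%R[%classic = d%:E.
  rewrite lebesgue_measure_itv/= lte_fin ifT; last by move: d0; lra.
  by rewrite -EFinB; congr EFin; ring.
rewrite [leRHS]EFinM lee_wpmul2l ?lee_fin//.
rewrite -muD -[X in (_ <= mu X)%E](setIT D) -(integral_indic mu measurableT mD).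
exact: lexx.
Qed.

End Example.

(** * Truncated Riesz transforms far from the origin *)

Section FarField.
Set Implicit Arguments.
Unset Strict Implicit.
Context {R : realType} {n : nat}.
Local Notation leb := (@lebesgueRn R n).
Local Notation mR := (measurableTypeR R).
Implicit Types (x y z : Rn R n) (j : 'I_n) (f : Rn R n -> R).

Definition scaleRn (c : R) : Rn R n -> Rn R n := affineRn (fun=> c) (fun=> 0).

Definition dotRn x z : R := \sum_(i < n) tnth x i * tnth z i.

Lemma tnth_scaleRn c x i : tnth (scaleRn c x) i = c * tnth x i.
Proof. by rewrite tnth_affineRn addr0. Qed.

Lemma scaleRnK c : c != 0 -> cancel (scaleRn c) (scaleRn c^-1).
Proof.
by move=> c0 x; apply/eq_from_tnth => i; rewrite !tnth_scaleRn mulKf.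
Qed.

Lemma sqnorm_scaleRn c x : sqnorm (scaleRn c x) = c ^+ 2 * sqnorm x.
Proof.
by rewrite /sqnorm mulr_sumr; apply: eq_bigr => i _; rewrite tnth_scaleRn exprMn.
Qed.

Lemma normRn_scaleRn c x : 0 <= c -> normRn (scaleRn c x) = c * normRn x.
Proof.
move=> c0; rewrite -[LHS]/(Num.sqrt (sqnorm _)) sqnorm_scaleRn.
by rewrite sqrtrM ?sqr_ge0// sqrtr_sqr ger0_norm.
Qed.

Lemma sqnorm_subRn x z : sqnorm (subRn x z) = sqnorm x - 2 * dotRn x z + sqnorm z.
Proof.
rewrite /sqnorm /dotRn mulr_sumr -sumrB -big_split/=.
by apply: eq_bigr => i _; rewrite tnth_subRn; ring.
Qed.

Lemma dotRn_scaleRnl c x z : dotRn (scaleRn c x) z = c * dotRn x z.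
Proof.
by rewrite /dotRn mulr_sumr; apply: eq_bigr => i _; rewrite tnth_scaleRn mulrA.
Qed.

Lemma dotRn_scaleRnr c x z : dotRn x (scaleRn c z) = c * dotRn x z.
Proof.
by rewrite /dotRn mulr_sumr; apply: eq_bigr => i _; rewrite tnth_scaleRn mulrCA.
Qed.

Lemma riesz_kernel_scaleRn j c y : 0 < c ->
  riesz_kernel j (scaleRn c y) = c ^- n * riesz_kernel j y.
Proof.
move=> c0; rewrite /riesz_kernel tnth_scaleRn normRn_scaleRn ?ltW// exprMn invfM mulrACA.
by congr (_ * _); rewrite [c ^+ n.+1]exprS invfM mulrA mulfV ?mul1r// gt_eqF.
Qed.

Lemma subRn_scaleRn c x z : c != 0 ->
  subRn (scaleRn c x) z = scaleRn c (subRn x (scaleRn c^-1 z)).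
Proof.
move=> c0; apply/eq_from_tnth => i.
by rewrite tnth_scaleRn !tnth_subRn !tnth_scaleRn mulrBr mulrA divff// mul1r.
Qed.

(** The positive and negative parts are treated separately by Tonelli, since integrability is not
    assumed for every parameter. *)
Lemma measurable_integral_fine (d1 : measure_display) (T : measurableType d1)
    (F : T * Rn R n -> R) : measurable_fun setT F ->
  measurable_fun setT (fun t => fine (\int[leb]_z (F (t, z))%:E)).
Proof.
move=> mF.
have mFE : measurable_fun setT (EFin \o F) by exact/measurable_EFinP.
apply: (measurableT_comp (@fine_measurable R setT measurableT)).
rewrite (_ : (fun t => _) = fun t => (\int[leb]_z ((EFin \o F)^\+ (t, z)) -
    \int[leb]_z ((EFin \o F)^\- (t, z)))%E).
  apply: emeasurable_funB.
    apply: (measurable_fun_fubini_tonelli_F ((EFin \o F)^\+)%E) => //.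
    exact: measurable_funepos.
  apply: (measurable_fun_fubini_tonelli_F ((EFin \o F)^\-)%E) => //.
  exact: measurable_funeneg.
apply/funext => t; rewrite integralE; congr (_ - _)%E; apply: eq_integral => z _.
  exact: (congr1 (@^~ z) (funepos_comp (EFin \o F) (pair t))).
exact: (congr1 (@^~ z) (funeneg_comp (EFin \o F) (pair t))).
Qed.

Variables (j : 'I_n) (f : Rn R n -> R).
Hypothesis intf : leb.-integrable setT (EFin \o f).

Let mf : measurable_fun setT f.
Proof. by apply/measurable_EFinP; exact: measurable_int intf. Qed.

(** The factor compensates the homogeneity of degree -n of the kernel, and the successor keeps the
    scale away from 0. *)
Definition far_trunc (k : nat) x : R :=
  k.+1%:R ^+ n * riesz_trunc j (k.+1%:R * normRn x) f (scaleRn k.+1%:R x).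

(** The truncated kernel in the source variable z = X - y, so that [f z] no longer depends on the
    scale and dominated convergence applies to the kernel alone. *)
Definition far_kernel (k : R) x z : R :=
  if k * normRn x < normRn (subRn (scaleRn k x) z)
  then riesz_kernel j (subRn (scaleRn k x) z) else 0.

Lemma measurable_far_kernel k :
  measurable_fun setT (fun xz : Rn R n * Rn R n => far_kernel k xz.1 xz.2).
Proof.
have msub : measurable_fun setT (fun xz : Rn R n * Rn R n => subRn (scaleRn k xz.1) xz.2).
  have mp : measurable_fun setT (fun xz : Rn R n * Rn R n => (scaleRn k xz.1, xz.2)).
    apply: measurable_fun_pair => //.
    exact: (measurableT_comp (@measurable_affineRn R n _ _) measurable_fst).
  exact: (measurableT_comp (@measurable_subRn R n) mp).
apply: measurable_fun_ifT => //.
  apply: measurable_fun_ltr; last exact: (measurableT_comp (@measurable_normRn R n)).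
  apply: measurable_funM => //.
  exact: (measurableT_comp (@measurable_normRn R n) measurable_fst).
exact: (measurableT_comp (@measurable_riesz_kernel R n j)).
Qed.

Lemma far_truncE k x : far_trunc k x =
  k.+1%:R ^+ n * fine (\int[leb]_z (f z * far_kernel k.+1%:R x z)%:E).
Proof.
congr (_ * _); rewrite /riesz_trunc /Rintegral integral_mkcond; congr fine.
set X := scaleRn _ _.
have mk : measurable_fun setT (fun z => f z * far_kernel k.+1%:R x z).
  apply: measurable_funM => //.
  exact: (measurableT_comp (@measurable_far_kernel _) (pair1_measurable x)).
have mkE : measurable_fun setT (fun z => (f z * far_kernel k.+1%:R x z)%:E).
  exact/measurable_EFinP.
rewrite [RHS](integral_isoRn (a := fun=> -1) (tnth X))//; last first.
  by move=> i; rewrite normrN1.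
apply: eq_integral => y _; rewrite -subRn_affineRn patchE /far_kernel -/X subRnK.
case: ifPn => h; first by move: h; rewrite inE/= => ->.
by move: h; rewrite notin_setE/= => /negP/negbTE ->; rewrite mulr0.
Qed.

Lemma measurable_far_trunc k : measurable_fun setT (far_trunc k).
Proof.
rewrite (_ : far_trunc k = fun x => k.+1%:R ^+ n *
    fine (\int[leb]_z (f z * far_kernel k.+1%:R x z)%:E)); last first.
  by apply/funext => x; rewrite far_truncE.
apply: measurable_funM => //.
apply: (@measurable_integral_fine _ _
  (fun xz : Rn R n * Rn R n => f xz.2 * far_kernel k.+1%:R xz.1 xz.2)).
apply: measurable_funM; last exact: measurable_far_kernel.
exact: (measurableT_comp mf measurable_snd).
Qed.

(** Beyond the radius k|x| the kernel is at most (k|x|)^(-n). The bound is free of k, which gives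
    the dominating function |x|^(-n) |f|. *)
Lemma far_kernel_le k x z : 0 < k -> 0 < normRn x ->
  `|k ^+ n * far_kernel k x z| <= normRn x ^- n.
Proof.
move=> k0 N0; rewrite normrM (ger0_norm (exprn_ge0 _ (ltW k0))) /far_kernel.
case: ifPn => h; last first.
  by rewrite normr0 mulr0 invr_ge0 exprn_ge0// ltW.
apply: (@le_trans _ _ (k ^+ n * (k * normRn x) ^- n)).
  rewrite ler_wpM2l ?exprn_ge0 ?(ltW k0)//.
  apply: le_trans (normr_riesz_kernel_le _ _) _.
  have kN : 0 < k * normRn x by rewrite mulr_gt0.
  rewrite lef_pV2 ?posrE ?exprn_gt0//; last exact: lt_trans h.
  by rewrite lerXn2r ?nnegrE ?(ltW kN) ?normRn_ge0// ltW.
by rewrite exprMn invfM mulrA mulfV ?mul1r// gt_eqF// exprn_gt0.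
Qed.

(* The origin is excluded: it lies on the boundary of every ball of radius
   k|x| centred at k x. *)
Definition half_space x z : bool := (0 < sqnorm z) && (dotRn x z <= 0).

(** Squaring the comparison of norms removes k^2 |x|^2 from both sides, and what remains of the ball
    is an inequality tending to the sign condition of [half_space]. *)
Lemma far_kernelE k x z : 0 < k -> k ^+ n * far_kernel k x z =
  if 2 * k * dotRn x z < sqnorm z then riesz_kernel j (subRn x (scaleRn k^-1 z)) else 0.
Proof.
move=> k0; rewrite /far_kernel -normRn_scaleRn ?(ltW k0)//.
have -> : (normRn (scaleRn k x) < normRn (subRn (scaleRn k x) z)) =
    (2 * k * dotRn x z < sqnorm z).
  have [h|h] := leP (sqnorm (subRn (scaleRn k x) z)) (sqnorm (scaleRn k x)).
    rewrite [LHS]ltNge /normRn ler_sqrt ?sqnorm_ge0// [X in ~~ X]h/=.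
    move: h; rewrite sqnorm_subRn dotRn_scaleRnl => h; apply/esym/negbTE.
    by rewrite -leNgt; lra.
  rewrite /normRn ltr_sqrt ?[LHS]h; last first.
    exact: le_lt_trans (sqnorm_ge0 _) h.
  move: h; rewrite sqnorm_subRn dotRn_scaleRnl => h; apply/esym.
  by lra.
case: ifP => _; last by rewrite mulr0.
rewrite subRn_scaleRn ?gt_eqF// riesz_kernel_scaleRn// mulrA mulfV ?mul1r//.
by rewrite gt_eqF// exprn_gt0.
Qed.

Lemma riesz_kernel_cvg x z : 0 < normRn x ->
  riesz_kernel j (subRn x (scaleRn (@harmonic R k) z)) @[k --> \oo] --> riesz_kernel j x.
Proof.
move=> N0; have h0 := @cvg_harmonic R.
rewrite /riesz_kernel.
apply: cvgM.
  under eq_fun do rewrite tnth_subRn tnth_scaleRn.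
  suff : tnth x j - @harmonic R k * tnth z j @[k --> \oo] --> tnth x j - 0 * tnth z j.
    by rewrite mul0r subr0.
  by apply: cvgB; [exact: cvg_cst|apply: cvgMr_tmp].
have hs : sqnorm (subRn x (scaleRn (@harmonic R k) z)) @[k --> \oo] --> sqnorm x.
  under eq_fun do rewrite sqnorm_subRn dotRn_scaleRnr sqnorm_scaleRn.
  suff : sqnorm x - 2 * (@harmonic R k * dotRn x z) + @harmonic R k ^+ 2 * sqnorm z
      @[k --> \oo] --> sqnorm x - 2 * (0 * dotRn x z) + 0 ^+ 2 * sqnorm z.
    by rewrite expr0n/= !mul0r mulr0 subr0 addr0.
  apply: cvgD.
    apply: cvgB; first exact: cvg_cst.
    by apply: cvgM; [exact: cvg_cst|apply: cvgM => //; exact: cvg_cst].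
  by apply: cvgM; [exact: cvgM|exact: cvg_cst].
have hN := cvg_comp _ _ hs (@sqrt_continuous R (sqnorm x)).
apply: cvgV; first by rewrite expf_neq0// gt_eqF.
exact: (cvg_comp _ _ hN (@exprn_continuous R n.+1 (normRn x))).
Qed.

Lemma far_kernel_cvg x z : 0 < normRn x ->
  k.+1%:R ^+ n * far_kernel k.+1%:R x z @[k --> \oo] -->
  (if half_space x z then riesz_kernel j x else 0).
Proof.
move=> N0; under eq_fun do rewrite far_kernelE//.
have [h|h] := boolP (half_space x z).
  under eq_fun.
    move=> k; rewrite ifT; last first.
      case/andP: h => s0 d0; apply: le_lt_trans s0.
      by rewrite pmulr_rle0// mulr_gt0.
    over.
  exact: riesz_kernel_cvg.
apply: cvg_near_cst.
have [s0|s0] := ltP 0 (sqnorm z); last first.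
  apply: nearW => k; rewrite ifF//; apply/negbTE; rewrite -leNgt (le_trans s0)//.
  rewrite /dotRn big1 ?mulr0// => i _.
  have zi : tnth z i ^+ 2 <= 0 := le_trans (sqr_tnth_le z i) s0.
  have /eqP : tnth z i ^+ 2 = 0 by apply/le_anti; rewrite zi sqr_ge0.
  by rewrite sqrf_eq0 => /eqP ->; rewrite mulr0.
move: h; rewrite /half_space s0/= -ltNge => d0.
(* When x.z > 0 the cut-off condition fails as soon as k exceeds |z|^2/(2 x.z). *)
near=> k; rewrite ifF//; apply/negbTE; rewrite -leNgt mulrAC mulrC.
rewrite -ler_pdivrMr ?mulr_gt0//.
apply: (@le_trans _ _ k%:R); last by rewrite ler_nat.
by near: k; exact: nbhs_infty_ger.
Unshelve. all: by end_near. Qed.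

Definition half_integral x : R := fine (\int[leb]_z (if half_space x z then f z else 0)%:E).

Lemma measurable_half_space x : measurable_fun setT (half_space x).
Proof.
apply: measurable_and.
  by apply: measurable_fun_ltr => //; exact: measurable_sqnorm.
apply: measurable_fun_ler => //; apply: measurable_sum => i.
by apply: measurable_funM => //; exact: measurable_tnth.
Qed.

Lemma integrable_half_integral x :
  leb.-integrable setT (fun z => (if half_space x z then f z else 0)%:E).
Proof.
apply: (le_integrable measurableT) intf.
  apply/measurable_EFinP; apply: measurable_fun_ifT => //; exact: measurable_half_space.
by move=> z _; rewrite !abse_EFin lee_fin; case: ifP => // _; rewrite normr0.
Qed.

Lemma far_trunc_cvg x : 0 < normRn x ->
  far_trunc k x @[k --> \oo] --> riesz_kernel j x * half_integral x.
Proof.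
move=> N0.
pose g (k : nat) z : R := f z * (k.+1%:R ^+ n * far_kernel k.+1%:R x z).
pose G z : R := riesz_kernel j x * (if half_space x z then f z else 0).
have mfk k : measurable_fun setT (far_kernel k x).
  exact: (measurableT_comp (@measurable_far_kernel _) (pair1_measurable x)).
have mg k : measurable_fun setT (EFin \o g k).
  by apply/measurable_EFinP; apply: measurable_funM => //; exact: measurable_funM.
have gle k z : `|g k z| <= normRn x ^- n * `|f z|.
  rewrite /g normrM mulrC ler_wpM2r//; exact: far_kernel_le.
have iG := integrableZl measurableT (riesz_kernel j x) (integrable_half_integral x).
have ib := integrableZl measurableT (normRn x ^- n) (integrable_abse intf).
have gE k : far_trunc k x = fine (\int[leb]_z (g k z)%:E).
  rewrite far_truncE.
  under [in RHS]eq_integral do rewrite /g mulrCA EFinM.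
  have ik : leb.-integrable setT (fun z => (f z * far_kernel k.+1%:R x z)%:E).
    have ib' := integrableZl measurableT ((k.+1%:R * normRn x) ^- n) (integrable_abse intf).
    apply: (le_integrable measurableT) ib'.
      by apply/measurable_EFinP; exact: measurable_funM.
    move=> z _; rewrite [X in (_ <= `|_ * X|)%E]/= -EFinM !abse_EFin lee_fin.
    apply: le_trans (ler_norm _); rewrite exprMn invfM -mulrA ler_pdivlMl ?exprn_gt0//.
    apply: le_trans (gle k z); rewrite /g !normrM (@ger0_norm _ (_ ^+ _)) ?exprn_ge0//.
    by rewrite mulrCA.
  by rewrite integralZl// fineM// (integrable_fin_num _ ik).
under eq_fun do rewrite gE.
have -> : riesz_kernel j x * half_integral x = fine (\int[leb]_z (G z)%:E).
  rewrite /half_integral; under [in RHS]eq_integral do rewrite /G EFinM.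
  rewrite integralZl ?fineM//; last exact: integrable_half_integral.
  exact: integrable_fin_num (integrable_half_integral x).
apply: fine_cvg; rewrite fineK; last exact: integrable_fin_num iG.
have gG : {ae leb, forall z, setT z -> EFin (g k z) @[k --> \oo] --> (G z)%:E}.
  apply: aeW => z _; apply: cvg_EFin; first by apply: nearW.
  have -> : G z = f z * (if half_space x z then riesz_kernel j x else 0).
    by rewrite /G; case: ifP => _; rewrite ?mulr0// mulrC.
  by apply: cvgM; [exact: cvg_cst|exact: far_kernel_cvg].
have gle' : {ae leb, forall z k, setT z -> (`|(EFin \o g k) z| <= (normRn x ^- n)%:E * `|(f z)%:E|)%E}.
  by apply: aeW => z k _; rewrite !abse_EFin -EFinM lee_fin.
by have [] := dominated_convergence measurableT mg (measurable_int _ iG) gG ib gle'.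
Qed.

(** At scale k, the points k x with x in a subset of [B] form a set with k^n times its measure, on
    which the maximal function exceeds m/k^n. The two powers cancel, so each scale gives a bound
    with the same constant [m], and the limit exhausts [B]. *)
Lemma weakL1_norm_riesz_max_ge (B : set (Rn R n)) (m : R) :
  measurable B -> 0 < m ->
  (forall x, B x -> 0 < normRn x /\ m < `|riesz_kernel j x * half_integral x|) ->
  (m%:E * leb B <= weakL1_norm leb (riesz_max j f))%E.
Proof.
move=> mB m0 HB.
(* The points where the bound holds from scale N on. Only scale N is used below; asking for all
   later ones makes the sets increase to [B], so that continuity from below applies. *)
pose D N : set (Rn R n) := B `&` \bigcap_(k in [set k | (N <= k)%N]) [set x | m < `|far_trunc k x|].
have mD N : measurable (D N).
  apply: measurableI => //; apply: bigcap_measurable => [|k _]; first by exists N => /=.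
  rewrite -[X in measurable X]setTI.
  have mlt : measurable_fun setT (fun x => m < `|far_trunc k x|).
    apply: measurable_fun_ltr => //; apply: measurableT_comp => //.
    exact: measurable_far_trunc.
  by have := mlt measurableT [set true] I; congr measurable; apply/seteqP; split => x [_].
have ndD : nondecreasing_seq D.
  move=> N M NM; apply/subsetPset => x [Bx h]; split => // k /= Mk.
  by apply: h => /=; exact: leq_trans Mk.
have DB : \bigcup_N D N = B.
  apply/seteqP; split => [x [N _ []]//|x Bx].
  have [N0 lm] := HB x Bx.
  have [N _ hN] : \forall k \near \oo, m < `|far_trunc k x|.
    exact: (cvgr_gt _ (cvg_norm (far_trunc_cvg N0)) _ lm).
  by exists N.
have DW N : (m%:E * leb (D N) <= weakL1_norm leb (riesz_max j f))%E.
  pose k : R := N.+1%:R; have k0 : 0 < k by [].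
  have kn0 : 0 < k ^+ n by rewrite exprn_gt0.
  rewrite (@lebesgueRn_affine _ _ (fun=> k^-1) (fun=> 0) (D N))//; last first.
    by move=> i; rewrite invr_eq0 gt_eqF.
  rewrite prodr_norm_cst ?invr_ge0 ?(ltW k0)// muleA -EFinM exprVn.
  apply: (@le_trans _ _ ((m / k ^+ n)%:E *
      leb [set x | (m / k ^+ n)%:E < `|riesz_max j f x|])%E); last first.
    by apply: ereal_sup_ubound; exists (m / k ^+ n) => //=; rewrite divr_gt0.
  rewrite lee_wpmul2l ?lee_fin ?divr_ge0 ?(ltW m0) ?(ltW kn0)//.
  apply: lebesgueRn_le => X [BX /(_ N (leqnn N))/=]; rewrite -/(scaleRn k^-1).
  move: BX; rewrite -/(scaleRn k^-1) => BX h.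
  have [N0 _] := HB _ BX.
  apply: (@lt_le_trans _ _ (riesz_max j f X)); last exact: lee_abs.
  have kX : scaleRn k (scaleRn k^-1 X) = X.
    by rewrite -{1}[k]invrK scaleRnK// invr_eq0 gt_eqF.
  apply: (@lt_le_trans _ _ `|riesz_trunc j (k * normRn (scaleRn k^-1 X)) f X|%:E).
    rewrite lte_fin ltr_pdivrMr// mulrC -[X in X * _](gtr0_norm kn0) -normrM.
    by move: h; rewrite /far_trunc -/k kX.
  by apply: ereal_sup_ubound; exists (k * normRn (scaleRn k^-1 X)) => //=; rewrite mulr_gt0.
have cD : leb (D N) @[N --> \oo] --> leb B.
  rewrite -DB; apply: nondecreasing_cvg_mu => //.
  by rewrite DB.
have cmD : (m%:E * leb (D N))%E @[N --> \oo] --> (m%:E * leb B)%E.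
  exact: cvgeZl.
rewrite -(cvg_lim _ cmD)//; apply: lime_le; first by apply/cvg_ex; exists (m%:E * leb B)%E.
by apply: nearW => N; exact: DW.
Qed.

End FarField.

(** * Integrals over half-spaces *)

Section HalfSpace.
Set Implicit Arguments.
Unset Strict Implicit.
Context {R : realType} {n : nat}.
Variables (j : 'I_n) (d : R).
Hypotheses (n0 : (0 < n)%N) (d0 : 0 < d) (d1 : d <= 1).
Local Notation mu := (@lebesgue_measure R).
Local Notation mR := (measurableTypeR R).
Local Notation mu2 := (@plane R).
Local Notation leb := (@lebesgueRn R n).
Local Notation Zn := (Num.sqrt pi ^+ n : R).
Implicit Types (x z : Rn R n) (u t : R).

Lemma lebesgueRn_point (p : 'I_n -> R) : leb [set z | forall i, [set p i] (tnth z i)] = 0%E.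
Proof.
rewrite (@lebesgueRn_box R n (fun i => [set p i : mR])) => [|i]; last exact: measurable_set1.
by rewrite (bigD1 j)//= lebesgue_measure_set1 mul0e.
Qed.

Lemma measurable_dotRn x : measurable_fun setT (dotRn x).
Proof.
apply: measurable_sum => i; apply: measurable_funM => //; exact: measurable_tnth.
Qed.

(* The half-space [dotRn x z <= 0] in the coordinate in which [gaussRn u] centred
   at t e_j is the standard Gaussian. *)
Definition half_cut u t x z : bool := Num.sqrt u * dotRn x z + t * tnth x j <= 0.

Lemma measurable_half_cut u t x : measurable_fun setT (half_cut u t x).
Proof.
apply: measurable_fun_ler => //; apply: measurable_funD => //.
by apply: measurable_funM => //; exact: measurable_dotRn.
Qed.

Let dilate u t : Rn R n -> Rn R n :=
  affineRn (fun=> Num.sqrt u) (fun i => if i == j then t else 0).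

Let tnth_dilate u t z i :
  tnth (dilate u t z) i = Num.sqrt u * tnth z i + (if i == j then t else 0).
Proof. by rewrite tnth_affineRn. Qed.

Lemma dotRn_dilate u t x z :
  dotRn x (dilate u t z) = Num.sqrt u * dotRn x z + t * tnth x j.
Proof.
rewrite /dotRn; under eq_bigr do rewrite tnth_dilate mulrDr mulrCA.
rewrite big_split/= -mulr_sumr; congr (_ + _).
rewrite (bigD1 j)//= eqxx big1 ?addr0 1?mulrC// => i /negbTE ->.
by rewrite mulr0.
Qed.

(** Rescaling makes the Gaussian the same for every u, and only the position of the half-space still
    depends on u. Two widths can then be compared by comparing two half-spaces. *)
Lemma integral_half_gaussRn u t x : 0 < u ->
  (\int[leb]_z (if half_space x z then gaussRn u (shiftRn j t z) else 0)%:E =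
   \int[leb]_z (if half_cut u t x z then expR (- sqnorm z) else 0)%:E)%E.
Proof.
move=> u0; have su0 : 0 < Num.sqrt u by rewrite sqrtr_gt0.
have su : forall i : 'I_n, Num.sqrt u != 0 by move=> i; rewrite gt_eqF.
have mh : measurable_fun setT
    (fun z => (if half_space x z then gaussRn u (shiftRn j t z) else 0)%:E).
  apply/measurable_EFinP; apply: measurable_fun_ifT => //.
    exact: measurable_half_space.
  exact: (measurableT_comp (@measurable_gaussRn R n u) (@measurable_affineRn R n _ _)).
rewrite (ge0_integral_affineRn (fun i => if i == j then t else 0) su mh); last first.
  by move=> z; rewrite lee_fin; case: ifP => // _; exact: gaussRn_ge0.
rewrite prodr_norm_cst ?(ltW su0)// -/(dilate u t) -ge0_integralZl//; last 2 first.
- by apply: (measurableT_comp mh); exact: measurable_affineRn.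
- by move=> z _; rewrite lee_fin; case: ifP => // _; exact: gaussRn_ge0.
have mc : measurable_fun setT (fun z => (if half_cut u t x z then expR (- sqnorm z) else 0)%:E).
  apply/measurable_EFinP; apply: measurable_fun_ifT => //.
    exact: measurable_half_cut.
  apply: (measurableT_comp (@measurable_expR R)).
  by apply: measurable_funN; exact: measurable_sqnorm.
apply: ae_eq_integral => //.
  apply: emeasurable_funM => //.
  by apply: (measurableT_comp mh); exact: measurable_affineRn.
(* The one point that the dilation sends to the origin, where [half_space] is false but [half_cut]
   is true; it is null since there is at least one coordinate. *)
pose p i : R := - (if i == j then t else 0) / Num.sqrt u.
exists [set z | forall i, [set p i] (tnth z i)]; split.
- rewrite (_ : mkset _ = \bigcap_(i in [set: 'I_n])
      ((@tnth n mR ^~ i) @^-1` [set p i])).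
    apply: fin_bigcap_measurable => // i _; rewrite -[X in measurable X]setTI.
    exact: measurable_tnth.
  by apply/seteqP; split => [z Sz i _|z Sz i]; exact: Sz.
- exact: lebesgueRn_point.
move=> z /= h i; apply: contrapT => zi; apply: h => _.
have -> : shiftRn j t (dilate u t z) = affineRn (fun=> Num.sqrt u) (fun=> 0) z.
  apply/eq_from_tnth => k; rewrite tnth_shiftRn tnth_dilate tnth_affineRn addr0.
  by case: (k == j); rewrite ?addrK ?addr0.
have s0 : 0 < sqnorm (dilate u t z).
  rewrite lt_neqAle sqnorm_ge0 andbT; apply/eqP => s0; apply: zi.
  have h0 : tnth (dilate u t z) i ^+ 2 <= 0 by rewrite s0; exact: sqr_tnth_le.
  have /eqP : tnth (dilate u t z) i ^+ 2 = 0 by apply/le_anti; rewrite h0 sqr_ge0.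
  rewrite sqrf_eq0 tnth_dilate addr_eq0 => /eqP h1.
  by rewrite /p -h1 mulrAC mulfV ?gt_eqF// mul1r.
rewrite /half_space s0 dotRn_dilate -EFinM; congr EFin.
rewrite /half_cut/=; case: ifP => _; last by rewrite mulr0.
by rewrite gaussRn_scale// mulrA mulfV ?mul1r// gt_eqF// exprn_gt0.
Qed.

Lemma integrable_expNsqnorm (c : Rn R n -> bool) : measurable_fun setT c ->
  leb.-integrable setT (fun z => (if c z then expR (- sqnorm z) else 0)%:E).
Proof.
move=> mc; apply/integrableP; split.
  apply/measurable_EFinP; apply: measurable_fun_ifT => //.
  apply: (measurableT_comp (@measurable_expR R)).
  by apply: measurable_funN; exact: measurable_sqnorm.
apply: (@le_lt_trans _ _ (\int[leb]_z (expR (- sqnorm z))%:E)%E).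
  apply: ge0_le_integralW => z //.
  by rewrite abse_EFin lee_fin; case: ifP => _; rewrite ?normr0 ?expR_ge0// ger0_norm ?expR_ge0.
by rewrite integral_expNsqnorm ltry.
Qed.

(** For t >= 0 and x_j > 0 the two half-spaces are nested, so the difference is, up to sign, the
    Gaussian mass of the gap between them. In particular no layer can compensate another. *)
Lemma integral_half_layer x w : 0 < tnth x j ->
  (- (\int[leb]_z (if half_space x z then layer j d w z else 0)%:E) =
   (unit_window w.2)%:E * \int[leb]_z
     (if half_cut (w.1 ^+ 2 + 2 * d) w.2 x z && ~~ half_cut (w.1 ^+ 2 + d) w.2 x z
      then expR (- sqnorm z) else 0)%:E)%E.
Proof.
move=> xj.
set u0 := w.1 ^+ 2 + d; set u1 := w.1 ^+ 2 + 2 * d.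
have u00 : 0 < u0 by rewrite ltr_wpDl// sqr_ge0.
have u01 : u0 < u1 by rewrite ltrD2l; move: d0; lra.
have u10 : 0 < u1 := lt_trans u00 u01.
have ig u : 0 < u -> leb.-integrable setT
    (fun z => (if half_space x z then gaussRn u (shiftRn j w.2 z) else 0)%:E).
  move=> u_gt0; apply: (@integrable_half_integral _ _ (fun z => gaussRn u (shiftRn j w.2 z))).
  rewrite (_ : EFin \o _ = (fun z => (gaussRn u z)%:E) \o affineRn (fun=> 1)
    (fun i => if i == j then - w.2 else 0))//.
  by apply: integrable_affineRn => [i|]; [exact: oner_neq0|exact: integrable_gaussRn].
have -> : (\int[leb]_z (if half_space x z then layer j d w z else 0)%:E =
    (unit_window w.2)%:E *
    (\int[leb]_z (if half_space x z then gaussRn u0 (shiftRn j w.2 z) else 0)%:E -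
     \int[leb]_z (if half_space x z then gaussRn u1 (shiftRn j w.2 z) else 0)%:E))%E.
  rewrite -integralB ?ig// -integralZl//; last by apply: integrableB => //; exact: ig.
  apply: eq_integral => z _; rewrite -EFinB -EFinM /layer; congr EFin.
  by case: ifP => _; rewrite ?subrr ?mulr0.
rewrite !integral_half_gaussRn// -integralB//; last 2 first.
- by apply: integrable_expNsqnorm; exact: measurable_half_cut.
- by apply: integrable_expNsqnorm; exact: measurable_half_cut.
rewrite /unit_window; case: ifPn => [/andP[t0 _]|_]; last by rewrite !mul0e oppe0.
rewrite !mul1e.
pose S z : bool := half_cut u1 w.2 x z && ~~ half_cut u0 w.2 x z.
have mS : measurable_fun setT S.
  apply: measurable_and; first exact: measurable_half_cut.
  by apply: measurable_neg; exact: measurable_half_cut.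
(* The cut forces x.z <= 0, because t x_j >= 0; enlarging u then only lowers its left side. *)
have imp z : half_cut u0 w.2 x z -> half_cut u1 w.2 x z.
  rewrite /half_cut => h.
  have z0 : dotRn x z <= 0.
    rewrite leNgt; apply/negP => z0; move: h; apply/negP; rewrite -ltNge.
    by rewrite ltr_pwDl// ?mulr_gt0 ?sqrtr_gt0// mulr_ge0// ltW.
  apply: le_trans h; rewrite lerD2r ler_wnM2r// ler_sqrt ?(ltW u10)// ltW//.
rewrite -[RHS]oppeK; congr (- _)%E.
rewrite -[RHS]mulN1e -[RHS](integralZl measurableT (integrable_expNsqnorm mS)).
apply: eq_integral => z _; rewrite -EFinB -EFinM; congr EFin.
rewrite /S; have := imp z; case: (half_cut u0 _ _ _) => [/(_ isT) ->|_]/=.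
  by rewrite subrr mulr0.
by case: (half_cut u1 _ _ _); rewrite ?subr0 ?sub0r ?mulr0// mulN1r.
Qed.

Lemma half_integral_extremal x :
  mu2.-integrable setT (fun w => \int[leb]_z (if half_space x z then layer j d w z else 0)%:E)%E /\
  (half_integral (extremal j d) x)%:E =
  (\int[mu2]_w \int[leb]_z (if half_space x z then layer j d w z else 0)%:E)%E.
Proof.
have K0 : 0 <= ((2 ^+ n + 2) * Num.sqrt 2 ^+ n) * Zn :> R.
  by rewrite !mulr_ge0 ?addr_ge0 ?exprn_ge0 ?sqrtr_ge0.
have i2 := integrable_superposition2 (measurable_layer2 j d) (integrable_profile K0)
  (layer_profile j d0 d1).
pose F (wz : (mR * mR) * Rn R n) : \bar R := (if half_space x wz.2 then layer j d wz.1 wz.2 else 0)%:E.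
have iF : (mu2 \x leb)%E.-integrable setT F.
  apply: (le_integrable measurableT) i2.
    apply/measurable_EFinP; apply: measurable_fun_ifT => //.
      exact: (measurableT_comp (measurable_half_space x) measurable_snd).
    exact: measurable_layer2.
  by move=> wz _; rewrite !abse_EFin lee_fin; case: ifP => // _; rewrite normr0.
split; first exact: (integrable_fubini_F iF).
rewrite -[RHS]/(\int[mu2]_w \int[leb]_z F (w, z))%E (Fubini iF) fineK; last first.
  exact: integrable_fin_num (integrable_half_integral (integrable_extremal j d0 d1) x).
apply: eq_integral => z _; rewrite /F/=; case: ifP => _; last by rewrite integral0.
by rewrite superpositionE//; exact: integrable_layer1.
Qed.
End HalfSpace.

(** * Lower bound on the weak norm *)

Section LowerBound.
Set Implicit Arguments.
Unset Strict Implicit.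
Context {R : realType} {n : nat}.
Variable (j : 'I_n).
Local Notation mu := (@lebesgue_measure R).
Local Notation mR := (measurableTypeR R).
Local Notation mu2 := (@plane R).
Local Notation leb := (@lebesgueRn R n).
Implicit Types (x z : Rn R n) (u t : R).

Lemma integral_inv (a b : R) : 0 < a -> a < b ->
  (\int[mu]_(r in `[a, b]) (r^-1)%:E = (ln b - ln a)%:E)%E.
Proof.
move=> a0 ab; have pos r : r \in `[a, b] -> 0 < r.
  by rewrite in_itv/= => /andP[/(lt_le_trans a0)].
rewrite (@continuous_FTC2 _ _ (@ln R))// -?EFinB//.
- apply: derivable_within_continuous => r /pos r0.
  by apply/derivable1_diffP; apply: differentiableV; rewrite ?gt_eqF.
- split=> [r /subset_itv_oo_cc/pos r0| |].
  + by apply: ex_derive; exact: is_derive1_ln.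
  + by apply: cvg_at_right_filter; exact: continuous_ln.
  + by apply: cvg_at_left_filter; apply: continuous_ln; exact: lt_trans ab.
- move=> r /subset_itv_oo_cc/pos r0; rewrite derive1E.
  by apply: derive_val; exact: is_derive1_ln.
Qed.

Definition cube (c : 'I_n -> R) (h : R) : set (Rn R n) :=
  [set z | forall i, `[c i - h, c i + h]%classic (tnth z i)].

Lemma cubeP c h z : cube c h z -> forall i, `|tnth z i - c i| <= h.
Proof.
move=> hz i; have := hz i; rewrite /= in_itv/= => /andP[h1 h2].
by rewrite ler_norml; lra.
Qed.

Lemma cube_center c h : 0 <= h -> cube c h [tuple c i | i < n].
Proof. by move=> h0 i; rewrite /= in_itv/= tnth_mktuple; lra. Qed.

Lemma measurable_cube c h : measurable (cube c h).
Proof.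
rewrite (_ : cube c h = \bigcap_(i in [set: 'I_n])
    ((@tnth n mR ^~ i) @^-1` `[c i - h, c i + h]%classic)).
  apply: fin_bigcap_measurable => // i _; rewrite -[X in measurable X]setTI.
  exact: measurable_tnth.
by apply/seteqP; split => [z Sz i _|z Sz i]; exact: Sz.
Qed.

Lemma lebesgueRn_cube c h : 0 < h -> leb (cube c h) = ((2 * h) ^+ n)%:E.
Proof.
move=> h0.
rewrite (@lebesgueRn_box R n (fun i => `[c i - h, c i + h]%classic)) => [|i]; last exact: measurable_itv.
have itv (i : 'I_n) : mu `[c i - h, c i + h]%classic = (2 * h)%:E.
  rewrite lebesgue_measure_itv/= lte_fin ifT; last by lra.
  by rewrite -EFinB; congr EFin; ring.
under eq_bigr do rewrite itv.
by rewrite prodEFin prodr_const card_ord.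
Qed.

(** The points x range over a cube around (3/2) e_j, the Gaussian variable z over the cube [Q]
    around -(3/2) e_j. The half-side 1/(2n) of the first keeps the terms of x.z off the j-th axis
    below 1/8 in total. [kQ] bounds exp(-|z|^2) from below on [Q]; [lQ] and [lB] are the two
    volumes. *)
Let cQ (i : 'I_n) : R := if i == j then - (3 / 2) else 0.
Let cB (i : 'I_n) : R := if i == j then 3 / 2 else 0.
Let hB : R := (2 * n%:R)^-1.
Let Q := cube cQ 4^-1.
Let kQ : R := expR (- (4 * n%:R)).
Let lQ : R := (2 * 4^-1) ^+ n.
Let lB : R := (2 * hB) ^+ n.

Let n0 : (0 < n)%N. Proof. by apply: leq_ltn_trans (ltn_ord j). Qed.

Let nR0 : 0 < n%:R :> R. Proof. by rewrite ltr0n. Qed.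

Let nR1 : 1 <= n%:R :> R. Proof. by rewrite ler1n. Qed.

Let hB0 : 0 < hB. Proof. by rewrite invr_gt0 mulr_gt0. Qed.

Let hB1 : hB <= 2^-1.
Proof. by rewrite lef_pV2 ?posrE ?mulr_gt0// ler_peMr. Qed.

Lemma sqnorm_le4 x : (forall i, `|tnth x i| <= 2) -> sqnorm x <= 4 * n%:R.
Proof.
move=> h; apply: (@le_trans _ _ (\sum_(i < n) (4 : R))).
  apply: ler_sum => i _; rewrite -(@real_normK _ (tnth x i)) ?num_real//.
  have := h i; have := normr_ge0 (tnth x i); nra.
by rewrite sumr_const card_ord mulr_natr.
Qed.

Let Q_sqnorm z : Q z -> sqnorm z <= 4 * n%:R.
Proof.
move=> /cubeP hz; apply: sqnorm_le4 => i; have := hz i; rewrite /cQ.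
by case: ifP => _; rewrite !ler_norml; lra.
Qed.

Let B_sqnorm x : cube cB hB x -> sqnorm x <= 4 * n%:R.
Proof.
move=> /cubeP hx; apply: sqnorm_le4 => i; have := hx i; rewrite /cB.
by case: ifP => _; rewrite !ler_norml; move: hB1; lra.
Qed.

Let B_coord x : cube cB hB x -> 1 <= tnth x j <= 2.
Proof.
move=> /cubeP/(_ j); rewrite /cB eqxx ler_norml; move: hB1; lra.
Qed.

(** The term of index j contributes between 5/4 and 7/4 of x_j, and the others at most 1/8 <= x_j/8
    in absolute value. *)
Let BQ_dotRn x z : cube cB hB x -> Q z -> tnth x j <= - dotRn x z <= 2 * tnth x j.
Proof.
move=> Bx Qz; have /andP[x1 x2] := B_coord Bx.
have hx := cubeP Bx; have hz := cubeP Qz.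
rewrite /dotRn (bigD1 j)//=; set S := \sum_(i < n | _) _.
have S8 : `|S| <= 8^-1.
  apply: le_trans (ler_norm_sum _ _ _) _.
  apply: (@le_trans _ _ (\sum_(i < n) hB * 4^-1)).
    rewrite big_mkcond; apply: ler_sum => i _; case: ifPn => [ij|_]; last first.
      by rewrite mulr_ge0// ltW.
    have := hx i; have := hz i; rewrite /cB /cQ (negbTE ij) !subr0 normrM => h1 h2.
    by rewrite ler_pM.
  rewrite sumr_const card_ord -mulr_natr /hB le_eqVlt; apply/orP; left; apply/eqP.
  by field; rewrite gt_eqF.
have := hz j; rewrite /cQ eqxx => hzj.
move: S8 hzj; rewrite !ler_norml => S8 hzj.
have : (tnth z j + 3 / 2) * tnth x j <= 4^-1 * tnth x j.
  by rewrite ler_pM2r; lra.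
have : - 4^-1 * tnth x j <= (tnth z j + 3 / 2) * tnth x j.
  by rewrite ler_pM2r; lra.
by move=> h1 h2; lra.
Qed.

Variable T : R.
Hypothesis T0 : 0 < T.
(* [a = sqrt (2 d)], and the integral of 1/r over [a, 1/4] is [T]. *)
Let a : R := expR (- T) / 4.
Let d : R := a ^+ 2 / 2.

Let a0 : 0 < a. Proof. by rewrite divr_gt0 ?expR_gt0. Qed.

Let a4 : a < 4^-1.
Proof. by rewrite /a -[ltRHS]mul1r ltr_pM2r// expR_lt1 oppr_lt0. Qed.

Let d0 : 0 < d. Proof. by rewrite divr_gt0// exprn_gt0. Qed.

Let d1 : d <= 1.
Proof. by rewrite /d; move: a0 a4; nra. Qed.

Let ad : a ^+ 2 = 2 * d. Proof. by rewrite /d mulrC divfK. Qed.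

(** The difference of the roots is d divided by their sum. For r >= a one has 2d <= r^2, so each
    root is at most 2r. The bound 1/2, from r <= 1/4, will keep the relevant t in [0, 1]. *)
Let root_gap (r : R) : a <= r -> r <= 4^-1 ->
  [/\ Num.sqrt (r ^+ 2 + 2 * d) <= 2^-1, 0 <= Num.sqrt (r ^+ 2 + d) &
  d / (4 * r) <= Num.sqrt (r ^+ 2 + 2 * d) - Num.sqrt (r ^+ 2 + d)].
Proof.
move=> ar r4; have r0 : 0 < r := lt_le_trans a0 ar.
have r2 : 2 * d <= r ^+ 2 by rewrite -ad lerXn2r// nnegrE ltW.
set s1 := Num.sqrt (_ + 2 * d); set s0 := Num.sqrt (_ + d).
have s00 : 0 <= s0 by exact: sqrtr_ge0.
have s01 : s0 <= s1.
  by rewrite ler_sqrt ?lerD2l; [move: d0; lra|rewrite addr_ge0 ?sqr_ge0// mulr_ge0// ltW].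
have s12 : s1 <= 2 * r.
  rewrite -[leRHS]ger0_norm ?mulr_ge0 ?(ltW r0)// -sqrtr_sqr ler_sqrt ?sqr_ge0//.
  by rewrite exprMn; move: (sqr_ge0 r); lra.
have e1 : s1 ^+ 2 = r ^+ 2 + 2 * d by rewrite sqr_sqrtr// addr_ge0 ?sqr_ge0// mulr_ge0// ltW.
have e0 : s0 ^+ 2 = r ^+ 2 + d by rewrite sqr_sqrtr// addr_ge0 ?sqr_ge0// ltW.
split => //; first by lra.
rewrite ler_pdivrMr ?mulr_gt0//.
have -> : d = (s1 - s0) * (s1 + s0) by rewrite -subr_sqr e1 e0; ring.
by rewrite ler_wpM2l ?subr_ge0//; lra.
Qed.

Let V : set mR := `[a, 4^-1]%classic.

(** A minorant of the integrand: the Gaussian is replaced by its lower bound on [Q], and r is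
    confined to [V]. Being nonnegative, it can be integrated in any order by Tonelli. *)
Let Phi x (wz : (mR * mR) * Rn R n) : \bar R :=
  (kQ * \1_Q wz.2 * (\1_V wz.1.1 * unit_window wz.1.2 *
   (if half_cut j (wz.1.1 ^+ 2 + 2 * d) wz.1.2 x wz.2 && ~~ half_cut j (wz.1.1 ^+ 2 + d) wz.1.2 x wz.2
    then 1 else 0)))%:E.

Let Phi_ge0 x wz : (0 <= Phi x wz)%E.
Proof.
rewrite lee_fin mulr_ge0 ?mulr_ge0 ?expR_ge0 ?unit_window_ge0//.
by case: ifP.
Qed.

Let measurable_Phi x : measurable_fun setT (Phi x).
Proof.
have m1 : measurable_fun setT (fun wz : (mR * mR) * Rn R n => wz.1.1).
  exact: (measurableT_comp measurable_fst measurable_fst).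
have m2 : measurable_fun setT (fun wz : (mR * mR) * Rn R n => wz.1.2).
  exact: (measurableT_comp measurable_snd measurable_fst).
have mQ : measurable_fun setT (\1_Q : Rn R n -> mR).
  by apply: measurable_indic; exact: measurable_cube.
have mV : measurable_fun setT (\1_V : mR -> mR).
  by apply: measurable_indic; exact: measurable_itv.
have mcut e : measurable_fun setT (fun wz : (mR * mR) * Rn R n =>
    half_cut j (wz.1.1 ^+ 2 + e) wz.1.2 x wz.2).
  apply: measurable_fun_ler => //; apply: measurable_funD.
    apply: measurable_funM; last exact: (measurableT_comp (measurable_dotRn x) measurable_snd).
    apply: (measurableT_comp (@measurable_sqrt R)).
    by apply: measurable_funD => //; exact: measurable_funX.
  exact: measurable_funM.
apply/measurable_EFinP; apply: measurable_funM.
  by apply: measurable_funM => //; exact: (measurableT_comp mQ measurable_snd).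
apply: measurable_funM.
  apply: measurable_funM; first exact: (measurableT_comp mV m1).
  exact: (measurableT_comp measurable_unit_window m2).
apply: measurable_fun_ifT => //; apply: measurable_and; first exact: mcut.
by apply: measurable_neg; exact: mcut.
Qed.

Let Phi_le x w : (\int[leb]_z Phi x (w, z) <= (unit_window w.2)%:E * \int[leb]_z
     (if half_cut j (w.1 ^+ 2 + 2 * d) w.2 x z && ~~ half_cut j (w.1 ^+ 2 + d) w.2 x z
      then expR (- sqnorm z) else 0)%:E)%E.
Proof.
have mS : measurable_fun setT (fun z =>
    half_cut j (w.1 ^+ 2 + 2 * d) w.2 x z && ~~ half_cut j (w.1 ^+ 2 + d) w.2 x z).
  apply: measurable_and; first exact: measurable_half_cut.
  by apply: measurable_neg; exact: measurable_half_cut.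
rewrite -(integralZl measurableT (integrable_expNsqnorm mS)).
apply: ge0_le_integralW => z //; rewrite -EFinM lee_fin /=.
case: ifP => _; last by rewrite !mulr0.
rewrite mulr1 mulrA [leLHS]mulrC ler_wpM2l ?unit_window_ge0//.
rewrite !indicE; have [zQ|_] := boolP (z \in Q); last first.
  by rewrite mulr0 mul0r expR_ge0.
rewrite mulr1; apply: (@le_trans _ _ kQ).
  by case: (_ \in V); rewrite ?mulr1 ?mulr0 ?expR_ge0.
by rewrite ler_expR lerN2; apply: Q_sqnorm; rewrite -in_setE.
Qed.

(** For fixed r and z both cuts are conditions on t, and the gap between them is the interval
    between q0 zeta and q1 zeta, with zeta = -x.z/x_j in [1, 2]. Its length is at least the gap of
    the roots, and it lies in [0, 1] because q1 <= 1/2. *)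
Let Phi_slice x r z : cube cB hB x -> V r -> Q z ->
  ((kQ * (d / (4 * r)))%:E <= \int[mu]_t Phi x ((r, t), z))%E.
Proof.
move=> Bx Vr Qz; have /andP[h1 h2] := BQ_dotRn Bx Qz.
have /andP[x1 x2] := B_coord Bx; have x0 : 0 < tnth x j by lra.
have /andP[ar r4] : a <= r <= 4^-1 by move: Vr; rewrite /V/= in_itv.
have [s1 s0 gap] := root_gap ar r4.
set q1 := Num.sqrt _ in s1 gap; set q0 := Num.sqrt (_ + d) in s0 gap.
have r0 : 0 < r := lt_le_trans a0 ar.
have gap0 : 0 < d / (4 * r) by rewrite divr_gt0// mulr_gt0.
pose zeta := - dotRn x z / tnth x j.
have z1 : 1 <= zeta by rewrite ler_pdivlMr// mul1r.
have z2 : zeta <= 2 by rewrite ler_pdivrMr.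
pose I : set mR := `]q0 * zeta, q1 * zeta]%classic.
have cutE (q t : R) : (q * dotRn x z + t * tnth x j <= 0) = (t <= q * zeta).
  rewrite /zeta mulrA ler_pdivlMr// mulrN -subr_ge0 -[RHS]subr_ge0 sub0r opprD addrC.
  by congr (0 <= _); ring.
have mI : measurable I by exact: measurable_itv.
apply: (@le_trans _ _ (\int[mu]_t (kQ%:E * (\1_I t)%:E))%E).
  rewrite ge0_integralZl//; last 2 first.
  - by apply/measurable_EFinP; apply: measurable_indic.
  - by rewrite lee_fin expR_ge0.
  rewrite EFinM lee_wpmul2l ?lee_fin ?expR_ge0//.
  have muI : mu `]q0 * zeta, q1 * zeta]%classic = ((q1 - q0) * zeta)%:E.
    rewrite lebesgue_measure_itv/= lte_fin ifT; last by rewrite ltr_pM2r; lra.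
    by rewrite -EFinB; congr EFin; ring.
  rewrite (integral_indic mu measurableT mI) setIT.
  apply: (@le_trans _ _ ((q1 - q0) * zeta)%:E); last by rewrite -muI.
  by rewrite lee_fin; nra.
apply: ge0_le_integralW => t; first by rewrite -EFinM lee_fin mulr_ge0// expR_ge0.
rewrite -EFinM lee_fin /= !indicE (mem_set Qz) (mem_set Vr) mulr1 mul1r.
have [|_] := boolP (t \in I); last first.
  by rewrite mulr0 !mulr_ge0 ?expR_ge0 ?unit_window_ge0//; case: ifP.
rewrite inE /I/= in_itv/= => /andP[t0 t1].
rewrite ler_pM2l ?expR_gt0// /half_cut -/q0 -/q1 !cutE t1 -ltNge t0/= mulr1 /unit_window.
rewrite ifT//; apply/andP; split; first by nra.
by nra.
Qed.

Lemma half_integral_extremal_ge x : cube cB hB x ->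
  kQ * lQ * (d / 4) * T <= - half_integral (extremal j d) x.
Proof.
move=> Bx; have /andP[x1 x2] := B_coord Bx; have x0 : 0 < tnth x j by lra.
have [iJ eJ] := half_integral_extremal j d0 d1 x.
rewrite -lee_fin EFinN eJ -mulN1e -(integralZl measurableT iJ).
apply: (@le_trans _ _ (\int[mu2]_w \int[leb]_z Phi x (w, z))%E); last first.
  apply: ge0_le_integralW => w; first exact: integral_ge0.
  rewrite mulN1e (integral_half_layer d0 w x0); exact: Phi_le.
rewrite ge0_integral_plane; last 2 first.
- exact: (measurable_fun_fubini_tonelli_F (Phi x)).
- by move=> w; exact: integral_ge0.
have swap r : (\int[mu]_t \int[leb]_z Phi x ((r, t), z) =
    \int[leb]_z \int[mu]_t Phi x ((r, t), z))%E.
  apply: (@fubini_tonelli _ _ _ _ _ mu leb (fun tz : mR * Rn R n => Phi x ((r, tz.1), tz.2))) => //.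
  have mp : measurable_fun setT (fun tz : mR * Rn R n => ((r, tz.1), tz.2)).
    by apply: measurable_fun_pair => //; apply: measurable_fun_pair.
  exact: (measurableT_comp (@measurable_Phi x) mp).
under eq_integral do rewrite swap.
pose G (r : R) : \bar R := ((kQ * lQ * (d / 4))%:E * ((\1_V r * r^-1)%:E))%E.
have mV : measurable_fun setT (\1_V : mR -> mR).
  by apply: measurable_indic; exact: measurable_itv.
have mVr : measurable_fun setT (fun r : mR => (\1_V r * r^-1)%:E).
  by apply/measurable_EFinP; apply: measurable_funM => //; exact: measurable_inv.
have V0 (r : mR) : 0 <= \1_V r * r^-1 :> R.
  rewrite indicE; have [|_] := boolP (r \in V); last by rewrite mul0r.
  by rewrite mul1r invr_ge0 inE /V/= in_itv/= => /andP[/(lt_le_trans a0)/ltW].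
have k0 : 0 <= kQ * lQ * (d / 4).
  by rewrite !mulr_ge0 ?expR_ge0 ?exprn_ge0// divr_ge0// ltW.
apply: (@le_trans _ _ (\int[mu]_r G r)%E).
  rewrite /G ge0_integralZl//; last by move=> r _; rewrite lee_fin.
  have -> : (\int[mu]_r (\1_V r * r^-1)%:E = \int[mu]_(r in `[a, (4^-1)%R]) (r^-1)%:E)%E.
    rewrite [RHS]integral_mkcond; apply: eq_integral => r _.
    by rewrite patchE indicE -/V; case: ifP => _; rewrite ?mul1r ?mul0r.
  (* By the choice of [a], the logarithms of 1/4 and of [a] differ by exactly [T]. *)
  rewrite integral_inv// /a ln_div ?posrE ?expR_gt0// expRK lnV ?posrE//.
  by rewrite -EFinM (_ : - ln 4 - (- T - ln 4) = T)//; ring.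
apply: ge0_le_integralW => r; first by rewrite /G -EFinM lee_fin mulr_ge0.
rewrite /G indicE; have [rV|_] := boolP (r \in V); last first.
  by rewrite mul0r mule0; apply: integral_ge0 => z _; exact: integral_ge0.
have Vr : V r by rewrite -in_setE.
have r0 : 0 < r by move: Vr; rewrite /V/= in_itv/= => /andP[/(lt_le_trans a0)].
apply: (@le_trans _ _ (\int[leb]_z ((kQ * (d / (4 * r)))%:E * (\1_Q z)%:E))%E).
  have c00 : 0 <= kQ * (d / (4 * r)).
    by rewrite mulr_ge0 ?expR_ge0// divr_ge0 ?mulr_ge0// ltW.
  have mQ : measurable Q by exact: measurable_cube.
  have IQ : (\int[leb]_z (\1_Q z)%:E = lQ%:E)%E.
    by rewrite (integral_indic leb measurableT mQ) setIT; exact: lebesgueRn_cube.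
  rewrite ge0_integralZl//; last first.
    by apply/measurable_EFinP; apply: measurable_indic.
  rewrite [X in (_ <= _ * X)%E](_ : _ = lQ%:E); last exact: IQ.
  rewrite -!EFinM lee_fin.
  rewrite le_eqVlt; apply/orP; left; apply/eqP; rewrite mul1r.
  by field; rewrite gt_eqF.
apply: ge0_le_integralW => z.
  by rewrite -EFinM lee_fin !mulr_ge0 ?expR_ge0// ?invr_ge0 ?mulr_ge0// ltW.
rewrite indicE; have [zQ|_] := boolP (z \in Q); last by rewrite mule0 integral_ge0.
by rewrite mule1; apply: Phi_slice => //; rewrite -in_setE.
Qed.

Lemma half_integral_ae0 (f : Rn R n -> R) x :
  leb.-integrable setT (EFin \o f) -> {ae leb, forall z, f z = 0} -> half_integral f x = 0.
Proof.
move=> intf f0; rewrite /half_integral.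
suff -> : (\int[leb]_z (if half_space x z then f z else 0)%:E = \int[leb]_z cst 0 z)%E.
  by rewrite integral0.
apply: ae_eq_integral => //.
- exact: measurable_int (integrable_half_integral intf x).
- by apply: filterS f0 => z -> _; case: ifP.
Qed.

(** A function vanishing almost everywhere has zero integral over every half-space, against the
    bound at the centre of the cube. This excludes the trivial example f = 0. *)
Lemma extremal_not_ae0 : ~ {ae leb, forall z, extremal j d z = 0}.
Proof.
move=> f0; have Bx := cube_center cB (ltW hB0).
have := half_integral_extremal_ge Bx.
rewrite (half_integral_ae0 _ (integrable_extremal j d0 d1) f0) oppr0; apply/negP; rewrite -ltNge.
by rewrite !mulr_gt0 ?expR_gt0 ?exprn_gt0 ?divr_gt0 ?mulr_gt0.
Qed.

(** A lower bound for the kernel on the cube of points x, where x_j >= 1 and |x|^2 <= 4n. *)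
Let kB : R := Num.sqrt (4 * n%:R) ^- n.+1.

Let B_riesz_kernel x : cube cB hB x -> 0 < normRn x /\ kB <= riesz_kernel j x.
Proof.
move=> Bx; have /andP[x1 _] := B_coord Bx.
have N0 : 0 < normRn x.
  apply: lt_le_trans (normr_tnth_le x j); rewrite normr_gt0 gt_eqF//.
  exact: lt_le_trans x1.
have NB : normRn x <= Num.sqrt (4 * n%:R).
  by rewrite /normRn ler_sqrt ?mulr_ge0//; exact: B_sqnorm.
split => //; rewrite /riesz_kernel -[kB]mul1r ler_pM ?invr_ge0 ?exprn_ge0 ?sqrtr_ge0//.
rewrite lef_pV2 ?posrE ?exprn_gt0//; last exact: lt_le_trans NB.
by rewrite lerXn2r ?nnegrE ?normRn_ge0 ?sqrtr_ge0.
Qed.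

Let kB0 : 0 < kB.
Proof. by rewrite invr_gt0 exprn_gt0// sqrtr_gt0 mulr_gt0. Qed.

(** The division by 2 provides the strict inequality demanded by level sets. *)
Lemma weakL1_norm_riesz_max_extremal_ge :
  ((kB * (kQ * lQ * (d / 4) * T) / 2 * lB)%:E <=
   weakL1_norm leb (riesz_max j (extremal j d)))%E.
Proof.
have m0 : 0 < kB * (kQ * lQ * (d / 4) * T).
  by rewrite !mulr_gt0 ?expR_gt0 ?exprn_gt0 ?divr_gt0 ?mulr_gt0.
rewrite EFinM -(lebesgueRn_cube cB hB0).
apply: weakL1_norm_riesz_max_ge.
- exact: (integrable_extremal j d0 d1).
- exact: measurable_cube.
- by rewrite divr_gt0.
move=> x Bx; have [N0 kx] := B_riesz_kernel Bx; split => //.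
have hx := half_integral_extremal_ge Bx.
rewrite -normrN -mulrN; apply: lt_le_trans (ler_norm _).
apply: (@lt_le_trans _ _ (kB * (kQ * lQ * (d / 4) * T))); first by lra.
rewrite ler_pM//; first exact: ltW.
by rewrite !mulr_ge0 ?expR_ge0 ?exprn_ge0// ?divr_ge0 ?ltW.
Qed.

End LowerBound.

Theorem theorem2 (R : realType) (n : nat) (hn : (1 <= n)%N) (j : 'I_n)
    (C : R) (hC : 0 < C) :
  exists f : Rn R n -> R,
    [/\ (lebesgueRn n).-integrable setT (EFin \o f),
        ~ (\forall x \ae (lebesgueRn n), f x = 0) &
        (C%:E * 'N[lebesgueRn n]_1[EFin \o riesz j f] <=
           weakL1_norm (lebesgueRn n) (riesz_max j f))%E].
Proof.
have nR0 : 0 < n%:R :> R by rewrite ltr0n.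
pose c0 : R := (radial_mass n)^-1 * Num.sqrt pi ^+ n * disc_area.
(* [A * d] is C times the upper bound for the L^1 norm of the Riesz transform. *)
pose A : R := C * (c0 * Num.sqrt pi ^+ n).
have A0 : 0 <= A.
  rewrite !mulr_ge0 ?(ltW hC) ?exprn_ge0 ?sqrtr_ge0 ?invr_ge0 ?(ltW (radial_mass_gt0 _))//.
  exact: ltW disc_area_gt0.
(* [b * T * d] is the lower bound for the weak norm; the 8 collects the divisions by 4 and by 2
   there. *)
pose b : R := Num.sqrt (4 * n%:R) ^- n.+1 * (expR (- (4 * n%:R)) * (2 * 4^-1) ^+ n) / 8 *
  (2 * (2 * n%:R)^-1) ^+ n.
have b0 : 0 < b.
  rewrite !mulr_gt0 ?invr_gt0 ?expR_gt0 ?exprn_gt0 ?sqrtr_gt0 ?mulr_gt0 ?invr_gt0 ?mulr_gt0//.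
(* Chosen so that b T = A + 1 exceeds A; the added 1 makes [T] positive with only A >= 0 at hand. *)
pose T := (A + 1) / b; have T0 : 0 < T by rewrite divr_gt0// ltr_wpDl.
pose d : R := (expR (- T) / 4) ^+ 2 / 2.
have d0 : 0 < d by rewrite divr_gt0// exprn_gt0// divr_gt0// expR_gt0.
have d1 : d <= 1.
  have : expR (- T) < 1 by rewrite expR_lt1 oppr_lt0.
  by have := expR_gt0 (- T); rewrite /d; nra.
exists (extremal j d); split; [exact: integrable_extremal|exact: extremal_not_ae0|].
apply: le_trans (weakL1_norm_riesz_max_extremal_ge j T0).
apply: (@le_trans _ _ (C%:E * (c0 * Num.sqrt pi ^+ n * d)%:E)%E).
  by rewrite lee_wpmul2l ?lee_fin ?(ltW hC)//; exact: Lnorm_riesz_extremal.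
rewrite -EFinM lee_fin -/d; apply: (@le_trans _ _ ((A + 1) * d)).
  by rewrite mulrA -/A ler_pM2r// lerDl.
have -> : A + 1 = b * T by rewrite /T mulrCA mulfV ?mulr1// gt_eqF.
rewrite /b le_eqVlt; apply/orP; left; apply/eqP.
set s := _ ^- _; set e := expR (- (4 * _)); set q := (_ / 4) ^+ n.
by set p := (2 / _) ^+ n; field.
Qed.
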